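(* (i) Let $1\le p\le k$, let $\lambda=(1)^p$ be a single column of height $p$, and let $w=[w_1\ldots w_n]\in S^{k,n}$ be a Grassmannian permutation with associated partition $\mu$. Then $$|(1)^p\rangle\star|\mu\rangle=\sum_{\{i_1<\cdots<i_p\}\subset[k]}\psi^*_{w_1}\circ\cdots\circ(t_{i_1}.\psi^*_{w_{i_1}})\circ\cdots\circ(t_{i_p-p+1}.\psi^*_{w_{i_p}})\circ\cdots\circ\psi^*_{w_k}.1,$$ where the sum runs over all $p$-subsets of $[k]=\{1,\ldots,k\}$ and, in each summand, the factor $\psi^*_{w_{i_r}}$ is replaced by $t_{i_r-r+1}.\psi^*_{w_{i_r}}$ for $r=1,\ldots,p$. Moreover $i_r-r+1\le w_{i_r}$ and $t_{i_r-r+1}.\psi^*_{w_{i_r}}=\psi^*_{w_{i_r}+1}+(y_{w_{i_r}}-y_{i_r-r+1})\psi^*_{w_{i_r}}$, so that this product is Graham positive: all coefficients $C_{(1)^p,\mu}^{\nu,d}(y)$ lie in $\mathbb{Z}_{\ge0}[y_2-y_1,\ldots,y_n-y_{n-1}]$. (ii) Let $\lambda=(p)$ be a single row of length $1\le p\le n-k$. Then the expansion of $|(p)\rangle\star|\mu\rangle=\Theta_{n-k}\big(|(1^p)\rangle\star|\mu'\rangle\big)$, where the product on the right is taken in $qH_T^*(\mathrm{Gr}(n-k;n))$, is also Graham positive: all $C_{(p),\mu}^{\nu,d}(y)\in\mathbb{Z}_{\ge0}[y_2-y_1,\ldots,y_n-y_{n-1}]$.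
   Context: Fix $n\ge2$ and $1\le k\le n-1$; $R=\mathbb{Z}[y_1,\ldots,y_n]$, $y_j:=0$ for $j>n$. $S^{k,n}\subset S_n$ is the set of $w=[w_1\ldots w_n]$ with $w_1<\cdots<w_k$ and $w_{k+1}<\cdots<w_n$; the associated partition $\lambda(w)$ inside the $k\times(n-k)$ rectangle is given by $w_j=\lambda_{k+1-j}+j$. $(x|y)^m=\prod_{i=1}^m(x-y_i)$; $s_\lambda(x_1,\ldots,x_k|y)=\det\big((x_j|y)^{\lambda_i+k-i}\big)/\prod_{i<j}(x_i-x_j)$; $h_r=s_{(r)}$. The ring is $$qH_T^*(\mathrm{Gr}(k;n))=R[q^{\pm1}][x_1,\ldots,x_k]^{S_k}/\langle h_{n-k+1},\ldots,h_{n-1},h_n+(-1)^kq\rangle$$ with Schubert basis $\sigma_\lambda$ = class of $s_\lambda(x_1,\ldots,x_k|y)$ and product $\star$. It is identified with $\bigwedge^k(R[q^{\pm1}]^n)$ by $\sigma_{\lambda(w)}\leftrightarrow|\lambda(w)\rangle=v_{w_1}\wedge\cdots\wedge v_{w_k}$, $v_1,\ldots,v_n$ the standard basis. The constants are defined by $|\lambda\rangle\star|\mu\rangle=\sum_{\nu,d}q^dC_{\lambda\mu}^{\nu,d}(y)|\nu\rangle$ with $C_{\lambda\mu}^{\nu,d}(y)\in R$. $\psi_i^*=v_i\wedge\cdot$, $1\in\bigwedge^0=R[q^{\pm1}]$, and $t_j.\psi_i^*=\psi^*_{i+1}+(y_i-y_j)\psi_i^*$ for $1\le i,j\le n$ with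 $\psi^*_{n+1}:=(-1)^{k-1}q\,\psi_1^*$. $\Theta_{n-k}:qH_T^*(\mathrm{Gr}(n-k;n))\to qH_T^*(\mathrm{Gr}(k;n))$ is the anti-linear map $f\cdot\sigma_\lambda\mapsto f'\cdot\sigma_{\lambda'}$, with $\lambda'$ the conjugate partition and $f'(y_1,\ldots,y_n;q)=f(-y_n,\ldots,-y_1;q)$. *)

(* Defs.v *)
From HB Require Import structures.
From mathcomp Require Import all_boot all_order all_fingroup all_algebra.
From mathcomp Require Import generic_quotient ring_quotient.
From mathcomp.finmap Require Import finmap.
From mathcomp.multinomials Require monalg.
From mathcomp.multinomials Require Import mpoly.
From Stdlib Require Import ClassicalEpsilon.

Set Implicit Arguments.
Unset Strict Implicit.
Unset Printing Implicit Defensive.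

Import GRing.Theory.
Local Open Scope ring_scope.

(* [monalg] only multiplies over monoids without nontrivial units, which
   excludes [int]; the group algebra product is therefore set up here. *)
Module Laurent.
Import monalg.

(* [A[q, q^-1]], as functions [int -> A] of finite support *)
Definition laurent (A : comNzRingType) := {malg A[int]}.

Section Ring.
Variable A : comNzRingType.
Local Notation L := (laurent A).
Implicit Types (f g h : L) (d e : int) (c : A).

HB.instance Definition _ := GRing.Zmodule.on L.

Definition lcoef d f : A := mcoeff d f.

(* [c q^d] *)
Definition lmonom c d : L := mkmalgU d c.

Local Open Scope fset.

Definition lmul f g : L :=
  \sum_(d <- msupp f) \sum_(e <- msupp g) lmonom (lcoef d f * lcoef e g) (d + e).

Let lmulw (s t : {fset int}) f g : msupp f `<=` s -> msupp g `<=` t ->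
  lmul f g = \sum_(d <- s) \sum_(e <- t) lmonom (lcoef d f * lcoef e g) (d + e).
Proof.
move=> le_s le_t; rewrite /lmul (big_fset_incl _ le_s) /=.
  apply: eq_bigr => d _; apply: big_fset_incl => // e _ /mcoeff_outdom.
  by rewrite /lcoef => ->; rewrite mulr0 /lmonom monalgU0.
move=> d _ /mcoeff_outdom f0; rewrite big1 // => e _.
by rewrite /lcoef f0 mul0r /lmonom monalgU0.
Qed.

Let lmonomE f : f = \sum_(d <- msupp f) lmonom (lcoef d f) d.
Proof. exact: monalgE. Qed.

Let lmulC : commutative lmul.
Proof.
move=> f g; rewrite /lmul exchange_big; apply: eq_bigr => e _ /=.
by apply: eq_bigr => d _; rewrite mulrC addrC.
Qed.

Let lmulDl : left_distributive lmul +%R.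
Proof.
move=> f g h.
rewrite (lmulw (msuppD_le f g) (fsubset_refl _)).
rewrite (lmulw (fsubsetUl _ (msupp g)) (fsubset_refl (msupp h))).
rewrite (lmulw (fsubsetUr (msupp f) _) (fsubset_refl (msupp h))).
rewrite -big_split; apply: eq_bigr => d _ /=.
rewrite -big_split; apply: eq_bigr => e _ /=.
by rewrite /lcoef mcoeffD mulrDl /lmonom monalgUD.
Qed.

Let lmulDr : right_distributive lmul +%R.
Proof. by move=> f g h; rewrite ![lmul f _]lmulC lmulDl. Qed.

Let lmul0 : left_zero 0 lmul.
Proof. by move=> f; rewrite /lmul msupp0 big_seq_fset0. Qed.

Let lmulr0 : right_zero 0 lmul.
Proof. by move=> f; rewrite lmulC lmul0. Qed.

Let lmul_monom c1 d1 c2 d2 :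
  lmul (lmonom c1 d1) (lmonom c2 d2) = lmonom (c1 * c2) (d1 + d2).
Proof.
by rewrite (lmulw msuppU_le msuppU_le) !big_seq_fset1 /lcoef !mcoeffUU.
Qed.

Let lmul_suml (I : Type) (r : seq I) (F : I -> L) g :
  lmul (\sum_(i <- r) F i) g = \sum_(i <- r) lmul (F i) g.
Proof. exact: (big_morph (fun f => lmul f g) (fun f h => lmulDl f h g) (lmul0 g)). Qed.

Let lmul_sumr (I : Type) (r : seq I) (F : I -> L) g :
  lmul g (\sum_(i <- r) F i) = \sum_(i <- r) lmul g (F i).
Proof. exact: (big_morph (lmul g) (fun f h => lmulDr g f h) (lmulr0 g)). Qed.

Let lmulA : associative lmul.
Proof.
move=> f g h; rewrite (lmonomE f) !lmul_suml; apply: eq_bigr => d _.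
rewrite (lmonomE g) lmul_suml !lmul_sumr lmul_suml; apply: eq_bigr => e _.
rewrite (lmonomE h) !lmul_sumr; apply: eq_bigr => i _.
by rewrite !lmul_monom mulrA addrA.
Qed.

Let lmul1 : left_id (lmonom 1 0) lmul.
Proof.
move=> f; rewrite [f in LHS]lmonomE lmul_sumr [RHS]lmonomE; apply: eq_bigr => d _.
by rewrite lmul_monom mul1r add0r.
Qed.

Let lone_neq0 : lmonom 1 0 != 0.
Proof.
apply/eqP => /(congr1 (mcoeff 0)); rewrite mcoeffUU mcoeff0 => /eqP.
by rewrite oner_eq0.
Qed.

HB.instance Definition _ :=
  GRing.Zmodule_isComNzRing.Build L lmulA lmulC lmul1 lmulDl lone_neq0.

Definition lconst c : L := lmonom c 0.

Definition lq : L := lmonom 1 1.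

Let lconst_zmod : zmod_morphism lconst.
Proof. by move=> a b; rewrite /lconst /lmonom monalgUB. Qed.

Let lconst_monoid : monoid_morphism lconst.
Proof. by split=> // a b; rewrite /lconst [RHS]lmul_monom. Qed.

HB.instance Definition _ := GRing.isZmodMorphism.Build A L lconst lconst_zmod.
HB.instance Definition _ := GRing.isMonoidMorphism.Build A L lconst lconst_monoid.

(* Applies [phi] to the coefficients of [f] and fixes [q]. *)
Definition lmap (phi : A -> A) f : L :=
  \sum_(d <- msupp f) lmonom (phi (lcoef d f)) d.

End Ring.

Arguments lq {A}.

End Laurent.

Export (hints, canonicals, coercions) Laurent.
Notation laurent := Laurent.laurent.
Notation lcoef := Laurent.lcoef.
Notation lconst := Laurent.lconst.
Notation lq := Laurent.lq.
Notation lmap := Laurent.lmap.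

(* For [j] in [1..n], the variable [y_j]; zero for the other [j]. *)
Definition yvar (n j : nat) : {mpoly int[n]} :=
  if j is i.+1 then oapp (fun i : 'I_n => 'X_i) 0 (insub i) else 0.

(* [(x|y)^m] *)
Definition facpow (n k m : nat) (x : {mpoly {mpoly int[n]}[k]}) :=
  \prod_(1 <= i < m.+1) (x - (yvar n i)%:MP).

Definition facdet (n k : nat) (la : seq nat) : {mpoly {mpoly int[n]}[k]} :=
  \det (\matrix_(i < k, j < k)
    facpow (nth 0%N la i + (k - i.+1)) ('X_j : {mpoly {mpoly int[n]}[k]})).

Definition vandermonde (A : comNzRingType) (k : nat) : {mpoly A[k]} :=
  \prod_(i < k) \prod_(j < k | (i < j)%N) ('X_i - 'X_j).

Lemma det_evals_dvd (A : comNzRingType) (k : nat) (f : 'I_k -> {poly A})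
    (a : 'I_k -> A) :
  exists c, c * \prod_(i < k) \prod_(j < k | (i < j)%N) (a i - a j)
            = \det (\matrix_(i, j) (f i).[a j]).
Proof.
elim: k => [|k IHk] in f a *; first by exists 1; rewrite big_ord0 det_mx00 mulr1.
have /fin_all_exists [g gE] (i : 'I_k.+1) :
    exists g, f i - (f i).[a 0]%:P = g * ('X - (a 0)%:P).
  by apply/factor_theorem/rootP; rewrite !hornerE subrr.
pose M : 'M[A]_k.+1 := \matrix_(i, j) (f i).[a j].
pose U : 'M[A]_k.+1 := \matrix_(i, j) ((i == j)%:R - ((i == 0) && (j != 0))%:R).
have detU : \det U = 1.
  rewrite -det_tr det_trig; last first.
    apply/is_trig_mxP => i j ij; rewrite !mxE.
    have /negPf -> : j != i by rewrite neq_ltn ij orbT.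
    have /negPf -> : j != 0 by rewrite -lt0n (leq_ltn_trans _ ij).
    by rewrite subr0.
  by rewrite big1 // => i _; rewrite !mxE eqxx andbN subr0.
have MU i j : (M *m U) i j = (f i).[a j] - (if j == 0 then 0 else (f i).[a 0]).
  rewrite !mxE; under eq_bigr do rewrite !mxE mulrBr.
  rewrite sumrB; congr (_ - _).
    rewrite (bigD1 j) //= eqxx mulr1 big1 ?addr0 // => l /negPf ->.
    by rewrite mulr0.
  case: eqVneq => [_|j0]; first by rewrite big1 // => l _; rewrite andbF mulr0.
  rewrite (bigD1 0) //= mulr1 big1 ?addr0 // => l /negPf -> /=.
  by rewrite mulr0.
have /fin_all_exists [c cE] (i : 'I_k.+1) :=
  IHk (fun l => g (lift i l)) (fun l => a (lift 0 l)).
exists (\sum_i (f i).[a 0] * ((-1) ^+ (i + 0) * (c i * (-1) ^+ k))).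
have -> : \det (\matrix_(i, j) (f i).[a j]) = \det (M *m U).
  by rewrite det_mulmx detU mulr1.
rewrite (expand_det_col _ 0) mulr_suml.
apply: eq_bigr => i _; rewrite MU eqxx subr0 -!mulrA; congr (_ * _).
rewrite /cofactor; congr (_ * _).
have -> : row' i (col' 0 (M *m U)) =
    (\matrix_(r, s) (g (lift i r)).[a (lift 0 s)])
    *m diag_mx (\row_s (a (lift 0 s) - a 0)).
  apply/matrixP => r s; rewrite mul_mx_diag mxE mxE MU !mxE /=.
  have /(congr1 (horner^~ (a (lift 0 s)))) := gE (lift i r).
  by rewrite !hornerE.
rewrite det_mulmx -cE det_diag -mulrA; congr (_ * _).
rewrite big_ord_recl big_mkcond big_ord_recl /= mul1r mulrCA mulrA mulrC.
congr (_ * _).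
  apply: eq_bigr => l _; rewrite [LHS]big_mkcond big_ord_recl /= mul1r.
  by rewrite [RHS]big_mkcond; apply: eq_bigr.
have -> : (-1) ^+ k = \prod_(l < k) (-1 : A) by rewrite prodr_const card_ord.
rewrite -big_split /=.
by apply: eq_bigr => l _; rewrite mxE mulrN1 opprB.
Qed.

Lemma facschur_subproof n k la :
  exists s : {mpoly {mpoly int[n]}[k]}, s * vandermonde {mpoly int[n]} k == facdet n k la.
Proof.
pose f (i : 'I_k) : {poly {mpoly {mpoly int[n]}[k]}} :=
  \prod_(1 <= l < (nth 0%N la i + (k - i.+1)).+1) ('X - (yvar n l)%:MP%:P).
have [s sE] := det_evals_dvd f (fun j => 'X_j).
exists s; apply/eqP; rewrite [LHS]sE; congr (\det _).
apply/matrixP => i j; rewrite !mxE /facpow /f horner_prod.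
by apply: eq_bigr => l _; rewrite !hornerE.
Qed.

(* The quotient of the two determinants; it is unique, the polynomial ring
   being a domain. *)
Definition facschur (n k : nat) (la : seq nat) : {mpoly {mpoly int[n]}[k]} :=
  xchoose (facschur_subproof n k la).

Lemma facschurE n k la : facschur n k la * vandermonde {mpoly int[n]} k = facdet n k la.
Proof. exact/eqP/(xchooseP (facschur_subproof n k la)). Qed.

Lemma msym_alternant (A : comNzRingType) (k : nat) (s : 'S_k)
    (F : 'I_k -> {mpoly A[k]} -> {mpoly A[k]}) :
    (forall i j, msym s (F i 'X_j) = F i 'X_(s j)) ->
  msym s (\det (\matrix_(i, j) F i 'X_j))
    = (-1) ^+ s * \det (\matrix_(i, j) F i 'X_j).
Proof.
move=> sF; rewrite -odd_permV -det_perm mulrC -det_mulmx -col_permE -det_map_mx.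
by congr (\det _); apply/matrixP => i j; rewrite !mxE /= sF.
Qed.

Lemma msym_facdet n k la (s : 'S_k) :
  msym s (facdet n k la) = (-1) ^+ s * facdet n k la.
Proof.
pose F (i : 'I_k) (x : {mpoly {mpoly int[n]}[k]}) :=
  facpow (nth 0%N la i + (k - i.+1)) x.
apply: (@msym_alternant _ k s F) => i j.
rewrite /F /facpow rmorph_prod; apply: eq_bigr => l _.
by rewrite rmorphB /= /msym mmapX mmap1U mmapC.
Qed.

Lemma msym_vandermonde (A : comNzRingType) k (s : 'S_k) :
  msym s (vandermonde A k) = (-1) ^+ s * vandermonde A k.
Proof.
pose c : {mpoly A[k]} := \prod_(i < k) \prod_(j < k | (i < j)%N) -1.
pose F (i : 'I_k) (x : {mpoly A[k]}) := x ^+ i.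
have -> : vandermonde A k = c * \det (\matrix_(i, j) F i 'X_j).
  transitivity (c * \det (Vandermonde k (\row_(j < k) ('X_j : {mpoly A[k]})))).
    rewrite det_Vandermonde -big_split; apply: eq_bigr => i _ /=.
    rewrite -big_split; apply: eq_bigr => j _ /=.
    by rewrite !mxE mulN1r opprB.
  by congr (_ * \det _); apply/matrixP => i j; rewrite !mxE.
rewrite rmorphM /= msym_alternant; last first.
  by move=> i j; rewrite /F rmorphXn /= /msym mmapX mmap1U.
rewrite mulrCA; congr (_ * (_ * _)); rewrite rmorph_prod.
by apply: eq_bigr => i _; rewrite rmorph_prod; apply: eq_bigr => j _; rewrite rmorphN1.
Qed.

Lemma vandermonde_neq0 (A : idomainType) k : vandermonde A k != 0.
Proof.
apply/prodf_neq0 => i _; apply/prodf_neq0 => j ij; rewrite subr_eq0.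
apply/eqP => /(congr1 (mcoeff U_(i))); rewrite !mcoeffX eqxx.
case: eqP => [/mnmP/(_ i)|_ /eqP]; last by rewrite oner_eq0.
have ji : j != i by rewrite neq_ltn ij orbT.
by rewrite !mnm1E eqxx (negPf ji).
Qed.

Lemma alternating_div (A : idomainType) (k : nat) (p v : {mpoly A[k]}) :
    v != 0 -> (forall s, msym s v = (-1) ^+ s * v) ->
    (forall s, msym s (p * v) = (-1) ^+ s * (p * v)) ->
  p \is symmetric.
Proof.
move=> v0 sv spv; apply/issymP => s; apply: (mulIf v0).
by apply: (can_inj (signrMK s)); rewrite mulrCA -sv -msymM spv.
Qed.

Lemma facschur_sym n k la : facschur n k la \is symmetric.
Proof.
apply: (alternating_div (vandermonde_neq0 {mpoly int[n]} k)) => s.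
  exact: msym_vandermonde.
by rewrite facschurE msym_facdet.
Qed.

(* [R[q, q^-1]] *)
Notation Rq n := (laurent {mpoly int[n]}).

(* [R[q, q^-1][x_1, ..., x_k]^{S_k}] *)
Record sympoly (n k : nat) := SymPoly {
  sympoly_val : {mpoly (Rq n)[k]};
  sympoly_valP : sympoly_val \is symmetric
}.

HB.instance Definition _ n k := [isSub for @sympoly_val n k].
HB.instance Definition _ n k := [Choice of sympoly n k by <:].
HB.instance Definition _ n k :=
  [SubChoice_isSubComNzRing of sympoly n k by <:].

Lemma map_mpoly_sym (A B : comNzRingType) (phi : {rmorphism A -> B}) (k : nat)
    (p : {mpoly A[k]}) : p \is symmetric -> map_mpoly phi p \is symmetric.
Proof.
move=> /issymP sp; apply/issymP => s; apply/mpolyP => m.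
by rewrite mcoeff_sym !mcoeff_map_mpoly -mcoeff_sym sp.
Qed.

(* [s_la(x|y)], with coefficients extended from [R] to [R[q, q^-1]] *)
Definition sympoly_schur (n k : nat) (la : seq nat) : sympoly n k :=
  SymPoly (map_mpoly_sym (@lconst {mpoly int[n]}) (facschur_sym n k la)).

Lemma sympolyC_subproof n k (c : Rq n) : c%:MP_[k] \is symmetric.
Proof. by apply/issymP => s; rewrite /msym mmapC. Qed.

Definition sympolyC (n k : nat) (c : Rq n) : sympoly n k :=
  SymPoly (sympolyC_subproof k c).

(* [h_{n-k+1}, ..., h_{n-1}, h_n + (-1)^k q] *)
Definition qrels (n k : nat) : seq (sympoly n k) :=
  rcons [seq sympoly_schur n k [:: r] | r <- iota (n - k + 1) (k - 1)]
        (sympoly_schur n k [:: n] + sympolyC k ((-1) ^+ k * lq)).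

Definition qideal_prop (n k : nat) (f : sympoly n k) : Prop :=
  exists a : nat -> sympoly n k,
    f = \sum_(i < size (qrels n k)) a i * (qrels n k)`_i.

Definition qideal (n k : nat) : {pred sympoly n k} := fun f =>
  if excluded_middle_informative (qideal_prop f) then true else false.

Lemma qidealP n k (f : sympoly n k) : reflect (qideal_prop f) (f \in @qideal n k).
Proof.
by rewrite unfold_in /qideal; case: excluded_middle_informative => H; constructor.
Qed.

Lemma qideal_zmod_closed n k : zmod_closed (@qideal n k).
Proof.
split=> [|_ _ /qidealP[a ->] /qidealP[b ->]]; apply/qidealP.
  by exists (fun=> 0); rewrite big1 // => i _; rewrite mul0r.
exists (fun i => a i - b i); rewrite -sumrB.
by apply: eq_bigr => i _; rewrite mulrBl.
Qed.

HB.instance Definition _ n k :=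
  GRing.isZmodClosed.Build (sympoly n k) (@qideal n k) (@qideal_zmod_closed n k).

Lemma qidealMl n k (f g : sympoly n k) : g \in @qideal n k -> f * g \in @qideal n k.
Proof.
case/qidealP => a ->; apply/qidealP; exists (fun i => f * a i).
by rewrite mulr_sumr; apply: eq_bigr => i _; rewrite mulrA.
Qed.

(* [qH_T^*(Gr(k;n))]; only a [comPzRingType] structure is set up, [ring_quotient]
   asking for a proof that the ideal is proper. *)
Definition qH (n k : nat) : Type := @Quotient.quot (sympoly n k) (@qideal n k).

HB.instance Definition _ n k := GRing.Zmodule.on (qH n k).

Section QuantumRing.
Local Open Scope quotient_scope.
Variables n k : nat.

Definition qclass (f : sympoly n k) : qH n k := \pi_(qH n k) f.

Lemma qclassP f g : reflect (qclass f = qclass g) (f - g \in @qideal n k).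
Proof. by rewrite Quotient.idealrBE; apply: eqP. Qed.

Definition qmul (a b : qH n k) : qH n k := qclass (repr a * repr b).

Let qclassK (a : qH n k) : qclass (repr a) = a.
Proof. exact: reprK. Qed.

Let qclassM f g : qclass (f * g) = qmul (qclass f) (qclass g).
Proof.
apply/qclassP; set f' := repr _; set g' := repr _.
have Ef : f - f' \in @qideal n k by apply/qclassP; rewrite qclassK.
have Eg : g - g' \in @qideal n k by apply/qclassP; rewrite qclassK.
have -> : f * g - f' * g' = f * (g - g') + g' * (f - f').
  by rewrite !mulrBr ![g' * _]mulrC subrKA.
by rewrite rpredD ?qidealMl.
Qed.

Let qclassB : {morph qclass : f g / f - g}.
Proof. by move=> f g; rewrite /qclass raddfB. Qed.

Let qclassD : {morph qclass : f g / f + g}.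
Proof. by move=> f g; rewrite /qclass raddfD. Qed.

Let qmulA : associative qmul.
Proof.
by move=> a b c; rewrite -[a]qclassK -[b]qclassK -[c]qclassK -!qclassM mulrA.
Qed.

Let qmulC : commutative qmul.
Proof. by move=> a b; rewrite /qmul mulrC. Qed.

Let qmul1 : left_id (qclass 1) qmul.
Proof. by move=> a; rewrite -[a]qclassK -qclassM mul1r. Qed.

Let qmulDl : left_distributive qmul +%R.
Proof.
move=> a b c; rewrite -[a]qclassK -[b]qclassK -[c]qclassK.
by rewrite -!(qclassD, qclassM) mulrDl.
Qed.

HB.instance Definition _ :=
  GRing.Zmodule_isComPzRing.Build (qH n k) qmulA qmulC qmul1 qmulDl.

HB.instance Definition _ :=
  GRing.isZmodMorphism.Build (sympoly n k) (qH n k) qclass qclassB.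

HB.instance Definition _ := GRing.isMonoidMorphism.Build
  (sympoly n k) (qH n k) qclass (conj (erefl _) qclassM).

End QuantumRing.

(* the Schubert class [sigma_la] *)
Definition schubert (n k : nat) (la : seq nat) : qH n k :=
  qclass (sympoly_schur n k la).

(* [u S] is the coefficient of [v_{i_1} /\ ... /\ v_{i_m}], where
   [S = {i_1 < ... < i_m}]; the element [i] of ['I_n] stands for [v_{i+1}]. *)
Notation ext n := {ffun {set 'I_n} -> (Rq n)^o}.

Definition ext1 (n : nat) : ext n := [ffun S : {set 'I_n} => (S == set0)%:R].

(* [u] lies in the [k]-th exterior power *)
Definition ext_deg (n k : nat) (u : ext n) : Prop :=
  forall S : {set 'I_n}, #|S| != k -> u S = 0.

(* [v_{i+1} /\ u]; the sign moves [v_{i+1}] past the smaller indices *)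
Definition wedge (n : nat) (i : 'I_n) (u : ext n) : ext n :=
  [ffun S : {set 'I_n} => if i \in S
             then (-1) ^+ #|[set j in S | (j < i)%N]| * u (S :\ i) else 0].

(* [psi_i^*], for [1 <= i <= n + 1] *)
Definition psi (n k i : nat) (u : ext n) : ext n :=
  let v j := if j is j'.+1 then oapp (fun l : 'I_n => wedge l u) 0 (insub j')
             else 0 in
  if i == n.+1 then ((-1) ^+ (k - 1) * lq) *: v 1 else v i.

(* [t_j.psi_i^*]; the parameter [k] only enters through [psi_{n+1}^*]. *)
Definition tpsi (n k j i : nat) (u : ext n) : ext n :=
  psi k i.+1 u + lconst (yvar n i - yvar n j) *: psi k i u.

(* [w_j], for [1 <= j <= n] *)
Definition oneline (n : nat) (w : 'S_n) (j : nat) : nat :=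
  if j is j'.+1 then oapp (fun l : 'I_n => (w l).+1) 0 (insub j') else 0.

Definition grassmannian (n k : nat) : {set 'S_n} :=
  [set w : 'S_n | [forall i : 'I_n, forall j : 'I_n,
     (i < j) && ((j < k) || (k <= i)) ==> (w i < w j)]%N].

(* [lambda(w)], as the sequence of its [k] parts, zeros included *)
Definition perm_part (n k : nat) (w : 'S_n) : seq nat :=
  [seq oneline w j - j | j <- rev (iota 1 k)]%N.

(* The conjugate of a partition with at most [m] columns. *)
Definition conj_part (m : nat) (la : seq nat) : seq nat :=
  mkseq (fun j => count (fun a => j < a)%N la) m.

(* [|la> = v_{w_1} /\ ... /\ v_{w_k}] where [w_j = la_{k+1-j} + j] *)
Definition ket (n k : nat) (la : seq nat) : ext n :=
  foldr (fun j u => psi k (nth 0%N la (k - j) + j) u) (ext1 n) (iota 1 k).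

(* [{w_1, ..., w_k}]: the coordinate of [u] along [|lambda(w)>] is
   [u (perm_supp k w)]. *)
Definition perm_supp (n k : nat) (w : 'S_n) : {set 'I_n} :=
  [set w i | i : 'I_n & (i < k)%N].

(* The identification of the [k]-th exterior power with [qH n k]. *)
Definition to_qH (n k : nat) (u : ext n) : qH n k :=
  \sum_(w in grassmannian n k)
    qclass (sympolyC k (u (perm_supp k w))) * schubert n k (perm_part k w).

(* The product of [qH n k] transported to the exterior power: the Schubert
   classes being a basis, [to_qH u * to_qH v] has exactly one preimage. *)
Definition star (n k : nat) (u v : ext n) : ext n :=
  epsilon (inhabits 0) (fun x => ext_deg k x /\ to_qH k x = to_qH k u * to_qH k v).

(* [C_{la, mu}^{nu, d}(y)] for [nu = lambda(w)] *)
Definition struct_const (n k : nat) (la mu : seq nat) (w : 'S_n) (d : int) :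
    {mpoly int[n]} :=
  lcoef d (star k (ket n k la) (ket n k mu) (perm_supp k w)).

(* [f] lies in [Z_{>=0}[y_2 - y_1, ..., y_n - y_{n-1}]] *)
Definition graham_positive (n : nat) (f : {mpoly int[n]}) : Prop :=
  exists P : {mpoly int[n.-1]}, (forall m, 0 <= P@_m) /\
    f = P \mPo [tuple yvar n i.+2 - yvar n i.+1 | i < n.-1].

(* [f(-y_n, ..., -y_1; q)] *)
Definition twist (n : nat) (f : Rq n) : Rq n :=
  lmap (fun c => c \mPo [tuple - 'X_(rev_ord i) | i < n]) f.

(* [Theta_{n-k}], from [qH n (n - k)] to [qH n k] *)
Definition Theta (n k : nat) (u : ext n) : ext n :=
  \sum_(w in grassmannian n (n - k))
    twist (u (perm_supp (n - k) w)) *: ket n k (conj_part k (perm_part (n - k) w)).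

(* [#{i' in I, i' <= i}]: if [I = {i_1 < ... < i_p}], the rank of [i_r] is [r] *)
Definition rank_in (k : nat) (I : {set 'I_k}) (i : 'I_k) : nat :=
  #|[set j in I | (j <= i)%N]|.

(* [i_r - r + 1] where [i_r] is the position [i.+1] *)
Definition t_index (k : nat) (I : {set 'I_k}) (i : 'I_k) : nat :=
  (i.+1 - rank_in I i + 1)%N.

Definition pieri_term (n k : nat) (w : 'S_n) (I : {set 'I_k}) : ext n :=
  foldr (fun (i : 'I_k) u =>
           if i \in I then tpsi k (t_index I i) (oneline w i.+1) u
           else psi k (oneline w i.+1) u)
        (ext1 n) (enum 'I_k).

(* Main.v *)
Require Import Defs.
From HB Require Import structures.
From mathcomp Require Import all_boot all_order all_fingroup all_algebra.
From mathcomp.finmap Require Import finmap.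
From mathcomp.multinomials Require monalg.
From mathcomp.multinomials Require Import ssrcomplements mpoly.
From mathcomp Require Import ring zify.

Set Implicit Arguments.
Unset Strict Implicit.
Unset Printing Implicit Defensive.

Import Order.TTheory GRing.Theory Num.Theory.
Local Open Scope ring_scope.

(** The exterior power is the antisymmetric part of a tensor power, and this is
    where the theorem comes from. Let [V] be free on [v_1, ..., v_n], with [v_i]
    standing for the factorial power [(t|y)^(i-1)], so that multiplication by
    [t] sends [v_i] to [v_(i+1) + y_i v_i], with [v_(n+1) = (-1)^(k-1) q v_1].
    In the quantum ring the polynomial [chi(t) = prod_j (t - x_j)] divides
    [(t|y)^n + (-1)^k q], so factorial powers have coordinates modulo [chi],
    compatibly with that rule ([frow_n]), and the class [sigma_la] is the
    determinant of the coordinates of the [(t|y)^(la_i + k - i)]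
    ([sympoly_schurE]). The identification of the exterior power with the ring
    is therefore [v_(i_1) /\ ... /\ v_(i_k) |-> det (rows i_1, ..., i_k)]
    ([extdet], [to_qH_extdet]).

    Part (i) is then one identity of determinants ([det_pieri]). Multiplication
    by [X - t] on [A[t]/chi] has determinant [chi(X)], so applying it to every
    row of a determinant multiplies the determinant by [chi(X)]. Expanding the
    rows one after the other in the factorial powers of [X] produces the sum
    over [p]-subsets with the shifted indices [i_r - r + 1]; comparing the
    coefficients of [(X|y)^(k-p)] leaves on the other side the coefficient of
    [chi], which is [(-1)^p sigma_(1^p)] ([schur_column]). Each summand is
    positive because the wedged indices stay weakly increasing, except for a
    final [v_(n+1)], whose sign is exactly undone by moving [v_1] to the front
    ([pieri_pos]).

    For part (ii) the same identity is applied to the complementary factor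
    of [(t|y)^n + (-1)^k q], whose coefficients are the classes [sigma_(p)].
    Row [k + i] of the coordinates modulo [chi] expresses a relation, and these
    relations span the kernel of the map from [V] to [A[t]/chi]. That kernel is
    stable under [t] ([corow_rec]), and after a reversal and a change of sign
    its columns obey the same rules as the rows of part (i), with the parameters
    [- y_n, ..., - y_1] and [n - k] in place of [k] ([dual_rowT]). Complementary
    minors agree up to the sign of the permutation ([complementary_minors]), so
    the determinants of these columns are again the Schubert classes, indexed by
    conjugate partitions ([dual_det]). The map [Theta] thus carries the product
    by [sigma_(1^p)] to the product by [sigma_(p)], and it preserves positivity
    because [y_i |-> - y_(n+1-i)] permutes the differences [y_(i+1) - y_i].

    Both parts need the product in the exterior power to be well determined,
    that is, the Schubert classes to be linearly independent ([to_qH_eq0]). This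
    uses the functionals on [A[x_1, ..., x_k]] that reduce each variable
    modulo [(t|y)^n + (-1)^k q] and read off one coordinate of each: evaluated
    at a multiple of the Vandermonde product, they kill the relations and
    separate the Schubert classes. *)

(** * Factorial powers and the companion matrix *)

Section FactorialBasis.
Variables (A : comNzRingType) (a : nat -> A).

Definition fpow (m : nat) : {poly A} := \prod_(l < m) ('X - (a l)%:P).

Lemma fpow0 : fpow 0 = 1. Proof. exact: big_ord0. Qed.

Lemma fpowS m : fpow m.+1 = fpow m * ('X - (a m)%:P).
Proof. exact: big_ord_recr. Qed.

Lemma monic_fpow m : fpow m \is monic.
Proof. by apply: monic_prod => l _; apply: monicXsubC. Qed.

Lemma size_fpow m : size (fpow m) = m.+1.
Proof.
elim: m => [|m IHm]; first by rewrite fpow0 size_poly1.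
rewrite fpowS size_Mmonic ?monicXsubC ?monic_neq0 ?monic_fpow //.
by rewrite IHm size_XsubC addn2.
Qed.

Lemma fpow_free m (c : nat -> A) :
  \sum_(j < m) c j *: fpow j = 0 -> forall j, (j < m)%N -> c j = 0.
Proof.
elim: m => // m IHm; rewrite big_ord_recr /= => sum0.
have cm0 : c m = 0.
  move/(congr1 (fun p : {poly A} => p`_m)): (sum0).
  rewrite coefD coefZ coef0 nth_default ?add0r; last first.
    apply: (leq_trans (size_sum _ _ _)); apply/bigmax_leqP => j _.
    by apply: (leq_trans (size_scale_leq _ _)); rewrite size_fpow.
  have /monicP := monic_fpow m; rewrite lead_coefE size_fpow /= => ->.
  by rewrite mulr1.
move: sum0; rewrite cm0 scale0r addr0 => /IHm IH j.
by rewrite ltnS leq_eqVlt => /predU1P[->|/IH].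
Qed.

Lemma fpow_span m (f : {poly A}) : (size f <= m)%N ->
  exists c : nat -> A, f = \sum_(j < m) c j *: fpow j.
Proof.
elim: m f => [|m IHm] f.
  by rewrite leqn0 size_poly_eq0 => /eqP ->; exists (fun=> 0); rewrite big_ord0.
move=> le_f; have [|c fE] := IHm (f - f`_m *: fpow m).
  apply/leq_sizeP => j; rewrite leq_eqVlt coefB coefZ => /predU1P[<-|lt_mj].
    have /monicP := monic_fpow m; rewrite lead_coefE size_fpow /= => ->.
    by rewrite mulr1 subrr.
  have fj0 : f`_j = 0 by rewrite nth_default // (leq_trans le_f).
  by rewrite fj0 (nth_default _ (leq_trans _ lt_mj)) ?size_fpow // mulr0 subrr.
exists (fun j => if j == m then f`_m else c j).
rewrite big_ord_recr /= eqxx -[LHS](subrK (f`_m *: fpow m)) fE; congr (_ + _).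
by apply: eq_bigr => j _; rewrite ltn_eqF.
Qed.

End FactorialBasis.

Section FactorialCompanion.
Variables (A : comNzRingType) (a c : nat -> A) (k : nat).

(** Multiplication by the variable modulo [fcharp], on row vectors of
    coordinates in the basis [fpow 0, ..., fpow (k - 1)]. *)
Definition fcomp : 'M[A]_k := \matrix_(i, j)
  ((j == i.+1 :> nat)%:R + a i *+ (j == i) - c j *+ (i.+1 == k)).

Definition fcharp : {poly A} := fpow a k + \sum_(j < k) c j *: fpow a j.

(** The coordinates of [fpow m] modulo [fcharp]. *)
Definition frow (m : nat) : 'rV[A]_k :=
  iteri m (fun l r => r *m (fcomp - (a l)%:M)) (\row_j (j == 0 :> nat)%:R).

Lemma frowS m : frow m.+1 = frow m *m (fcomp - (a m)%:M).
Proof. by []. Qed.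

Lemma frowT m : frow m *m fcomp = frow m.+1 + a m *: frow m.
Proof. by rewrite frowS mulmxBr mul_mx_scalar subrK. Qed.

Lemma mulfcompE (r : 'rV[A]_k) (j : 'I_k) :
  (r *m fcomp) 0 j = \sum_(i < k | j == i.+1 :> nat) r 0 i + a j * r 0 j
    - c j * \sum_(i < k | i.+1 == k) r 0 i.
Proof.
rewrite mxE; under eq_bigr do rewrite mxE mulrBr mulrDr.
rewrite sumrB big_split /=; congr (_ + _ - _).
- rewrite [RHS]big_mkcond; apply: eq_bigr => i _.
  by case: eqP => _; rewrite ?mulr1 ?mulr0.
- rewrite (bigD1 j) //= eqxx mulrC big1 ?addr0 // => i /negPf ij.
  by rewrite eq_sym ij mulr0.
- rewrite mulr_sumr [RHS]big_mkcond; apply: eq_bigr => i _.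
  by case: eqP => _; rewrite ?mulr1n ?mulr0 // mulrC.
Qed.

Lemma frow_lt m : (m < k)%N -> frow m = \row_j (j == m :> nat)%:R.
Proof.
elim: m => // m IHm lt_mk; apply/rowP => j; rewrite frowS mulmxBr mul_mx_scalar.
rewrite (IHm (ltnW lt_mk)) mxE mulfcompE !mxE [\sum_(i < k | i.+1 == k) _]big1; last first.
  by move=> i /eqP ik; rewrite mxE; case: eqP => // im; rewrite -im ik ltnn in lt_mk.
rewrite mulr0 subr0 -[RHS]addr0 -addrA; congr (_ + _).
  rewrite big_mkcond (bigD1 (Ordinal (ltnW lt_mk))) //= big1 ?addr0.
    by rewrite mxE eqxx; case: eqP.
  move=> i im; rewrite mxE; case: ifP => // _.
  by case: eqP => // ime; case/eqP: im; apply: val_inj.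
by case: eqP => [->|]; rewrite ?mulr0 subrr.
Qed.

Lemma frow_top (j : 'I_k) : frow k 0 j = - c j.
Proof.
have kE : k.-1.+1 = k by rewrite prednK // (leq_ltn_trans _ (ltn_ord j)).
have lt_k : (k.-1 < k)%N by rewrite kE.
rewrite -[X in frow X]kE frowS mulmxBr mul_mx_scalar frow_lt // mxE mulfcompE.
rewrite [\sum_(i < k | _ == i.+1) _]big1 => [|i]; last first.
  move=> /eqP ji; rewrite mxE; case: eqP => // ik.
  by move: (ltn_ord j); rewrite ji ik kE ltnn.
rewrite (bigD1 (Ordinal lt_k)) /=; last by rewrite kE.
rewrite !mxE eqxx big1 ?addr0 ?mulr1 => [|i].
  by rewrite add0r [in LHS]addrAC; case: eqP => [->|]; rewrite ?mulr0 subrr add0r.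
by rewrite -[X in _ == X]kE eqSS -val_eqE /= => /andP[->].
Qed.

(** The vector of the basis polynomials is an eigenvector up to the last
    coordinate, where the characteristic polynomial appears. *)
Lemma fcomp_charmx_fpow (i : 'I_k) :
  (char_poly_mx fcomp *m \col_j fpow a j) i 0 = fcharp *+ (i.+1 == k).
Proof.
rewrite /char_poly_mx mulmxBl mul_scalar_mx !mxE.
under eq_bigr do rewrite !mxE rmorphB rmorphD /= mulrBl mulrDl.
rewrite sumrB big_split /= opprB.
have -> : \sum_(j < k) (a i *+ (j == i))%:P * fpow a j = (a i)%:P * fpow a i.
  rewrite (bigD1 i) //= eqxx big1 ?addr0 // => j /negPf ->.
  by rewrite mul0r.
have [ik|ik] := eqVneq.
  have fpk : fpow a k = fpow a i * ('X - (a i)%:P) by rewrite -fpowS ik.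
  rewrite /fcharp fpk.
  rewrite [X in _ - (X + _)]big1 ?add0r => [|j _]; last first.
    by rewrite ik ltn_eqF // mul0r.
  under [in LHS]eq_bigr do rewrite mulr1n mul_polyC.
  by rewrite mulr1n; ring.
have lt_ik : (i.+1 < k)%N by rewrite ltn_neqAle ik ltn_ord.
rewrite [X in _ + (X - _)]big1 => [|j _]; last by rewrite mulr0n mul0r.
have -> : \sum_(j < k) ((j == i.+1 :> nat)%:R)%:P * fpow a j = fpow a i.+1.
  rewrite (bigD1 (Ordinal lt_ik)) //= eqxx mul1r big1 ?addr0 // => j.
  by rewrite -val_eqE /= => /negPf ->; rewrite mul0r.
by rewrite fpowS mulr0n; ring.
Qed.

End FactorialCompanion.

(** Replacing the first column of [M] by [M *m b] leaves a single nonzero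
    entry there, over a triangular minor. *)
Lemma det_hessenberg (B : comNzRingType) (n : nat) (M : 'M[B]_n.+1)
    (b : 'cV[B]_n.+1) (x : B) :
    b 0 0 = 1 -> (forall i : 'I_n.+1, (M *m b) i 0 = x *+ (i.+1 == n.+1)) ->
    (forall i j : 'I_n.+1, j = i.+1 :> nat -> M i j = -1) ->
    (forall i j : 'I_n.+1, (i.+1 < j)%N -> M i j = 0) ->
  \det M = x.
Proof.
move=> b0 Mb Msup Mzero.
pose U : 'M[B]_n.+1 := \matrix_(i, j) if j == 0 then b i 0 else (i == j)%:R.
have detU : \det U = 1.
  rewrite det_trig; last first.
    apply/is_trig_mxP => i j ij; rewrite mxE -!val_eqE /= (ltn_eqF ij).
    by rewrite gtn_eqF // (leq_ltn_trans _ ij).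
  rewrite big1 // => i _; rewrite mxE eqxx.
  by case: eqP => [->|].
have MU0 i : (M *m U) i 0 = x *+ (i.+1 == n.+1).
  by rewrite -Mb !mxE; apply: eq_bigr => j _; rewrite mxE.
have MUj i j : j != 0 -> (M *m U) i j = M i j.
  move=> j0; rewrite !mxE (bigD1 j) //= mxE (negPf j0) eqxx mulr1 big1 ?addr0 //.
  by move=> l /negPf lj; rewrite mxE (negPf j0) lj mulr0.
rewrite -[LHS]mulr1 -detU -det_mulmx (expand_det_col _ 0) (bigD1 ord_max) //=.
rewrite MU0 eqxx mulr1n big1 ?addr0; last first.
  move=> i im; rewrite MU0 eqSS; case: eqP => [iE|_]; last by rewrite mul0r.
  by case/eqP: im; apply: val_inj.
rewrite /cofactor det_trig.
  rewrite (eq_bigr (fun=> -1)) => [|i _].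
    by rewrite prodr_const card_ord addn0 -exprD addnn -signr_odd odd_double mulr1.
  by rewrite mxE mxE MUj // Msup // lift_max lift0.
apply/is_trig_mxP => i j ij; rewrite mxE mxE MUj // Mzero //.
by rewrite lift_max lift0.
Qed.

Lemma char_poly_fcomp (A : comNzRingType) (a c : nat -> A) (k : nat) :
  (0 < k)%N -> char_poly (fcomp a c k) = fcharp a c k.
Proof.
case: k => // k' _; rewrite /char_poly.
apply: (@det_hessenberg _ _ _ (\col_j fpow a j)).
- by rewrite mxE fpow0.
- exact: fcomp_charmx_fpow.
- move=> i j ji; have ij : (i < j)%N by rewrite ji.
  have ik : (i.+1 < k'.+1)%N by rewrite -ji.
  rewrite !mxE -!val_eqE /= (ltn_eqF ij) (gtn_eqF ij) (ltn_eqF ik) ji eqxx.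
  by rewrite !mulr0n addr0 subr0 sub0r.
- move=> i j ij; have lt_ij := ltnW ij.
  rewrite !mxE -!val_eqE /= (ltn_eqF lt_ij) (gtn_eqF lt_ij) (gtn_eqF ij).
  rewrite (ltn_eqF (ltn_trans ij (ltn_ord j))).
  by rewrite !mulr0n addr0 subrr subrr.
Qed.

(** * Pieri expansion of a determinant *)

Section Pieri.
Variables (A : comNzRingType) (a : nat -> A) (m : nat) (T : 'M[A]_m).
Variable r : 'I_m -> 'rV[A]_m.
Implicit Type I : {set 'I_m}.

Definition pieri_row I (i : 'I_m) : 'rV[A]_m :=
  if i \in I then r i *m (T - (a (t_index I i).-1)%:M) else r i.

(** Rows of index less than [j] have been expanded according to [I]; the others
    still carry the factor [X - T]. *)
Let mixed j I : 'M[{poly A}]_m := \matrix_i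
  if (i < j)%N then map_mx polyC (pieri_row I i)
  else 'X *: map_mx polyC (r i) - map_mx polyC (r i *m T).

Let mixed0 I : \det (mixed 0 I) = char_poly T * (\det (\matrix_i r i))%:P.
Proof.
rewrite mulrC /char_poly -det_map_mx -det_mulmx /char_poly_mx; congr (\det _).
apply/row_matrixP => i; rewrite rowK /= mulmxBr mul_mx_scalar -map_mxM.
by rewrite linearB linearZ /= -!map_row row_mul rowK.
Qed.

Let mixed_full I : \det (mixed m I) = (\det (\matrix_i pieri_row I i))%:P.
Proof.
rewrite -det_map_mx; congr (\det _); apply/row_matrixP => i.
by rewrite rowK ltn_ord -map_row rowK.
Qed.

Let initial (j : nat) : {set 'I_m} := [set i : 'I_m | (i < j)%N].

Lemma rank_in_setU1 (j i : 'I_m) I :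
  (i < j)%N -> rank_in (j |: I) i = rank_in I i.
Proof.
move=> ij; apply: eq_card => l; rewrite !inE.
by case: eqP => [->|//]; rewrite leqNgt ij !andbF.
Qed.

Lemma rank_in_max (j : 'I_m) I :
  I \subset initial j -> rank_in (j |: I) j = #|I|.+1.
Proof.
move=> /subsetP Ij; have jI : j \notin I.
  by apply/negP => /Ij; rewrite inE ltnn.
rewrite -add1n -[1%N in RHS]/(true : nat) -jI -cardsU1; apply: eq_card => l; rewrite !inE.
by case: eqP => [->|_] /=; rewrite ?leqnn //; apply/andb_idr => /Ij; rewrite inE => /ltnW.
Qed.

(* Only row [j] changes, by [X r - r T = (X - a_l) r - r (T - a_l)]. *)
Let mixedS (j : 'I_m) I : I \subset initial j ->
  \det (mixed j I) = ('X - (a (j - #|I|))%:P) * \det (mixed j.+1 I)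
    - \det (mixed j.+1 (j |: I)).
Proof.
move=> sI; have jI : j \notin I by apply/negP => /(subsetP sI); rewrite inE ltnn.
rewrite -mulN1r; apply: (@determinant_multilinear _ _ _ _ _ j).
- rewrite !rowK ltnn ltnSn /pieri_row (negPf jI) setU11 /t_index rank_in_max //.
  rewrite addn1 /= subSS mulmxBr mul_mx_scalar map_mxB map_mxZ /=.
  by rewrite scalerBl scaleN1r opprB addrA subrK.
- apply/row_matrixP => i; rewrite !row_rowsub !rowK.
  have := neq_lift j i; rewrite -val_eqE ltnS /=.
  by case: ltngtP.
- apply/row_matrixP => i; rewrite !row_rowsub !rowK.
  have := neq_lift j i; rewrite -val_eqE ltnS /=.
  case: ltngtP => // ij _; rewrite /pieri_row /t_index rank_in_setU1 // !inE.
  by rewrite -val_eqE (ltn_eqF ij).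
Qed.

(* The factor [X - a_l] of the previous step turns [fpow l] into
   [fpow (l + 1)], where [l] counts the rows before [j] outside [I]; this is why
   the shift attached to the [r]-th element [i_r] of [I] is [i_r - r + 1]. *)
Let mixed_sum j : (j <= m)%N ->
  \det (mixed 0 set0) = \sum_(I : {set 'I_m} | I \subset initial j)
    (-1) ^+ #|I| * fpow a (j - #|I|) * \det (mixed j I).
Proof.
elim: j => [|j IHj] lt_jm.
  rewrite (big_pred1 set0) => [|I]; first by rewrite cards0 fpow0 !mul1r.
  rewrite /= -subset0; have -> // : initial 0 = set0.
  by apply/setP => i; rewrite !inE.
rewrite {}IHj ?(ltnW lt_jm) //; pose jj := Ordinal lt_jm.
have jN I : I \subset initial j -> jj \notin I.
  by move=> /subsetP sI; apply/negP => /sI; rewrite inE ltnn.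
rewrite [RHS](bigID (fun I => jj \in I)) /=.
rewrite [X in _ = X + _](reindex_onto (fun I => jj |: I) (fun I => I :\ jj)) /=; last first.
  by move=> I /andP[_ jI]; rewrite setD1K.
have initS I : (jj |: I \subset initial j.+1) && (jj \in jj |: I)
    && ((jj |: I) :\ jj == I) = (I \subset initial j).
  rewrite setU11 andbT; apply/andP/idP => [[sI /eqP <-]|sI].
    apply/subsetP => i; rewrite !inE => /andP[ij].
    move: (subsetP sI i); rewrite !inE => /[apply].
    by rewrite ltnS leq_eqVlt; case/predU1P => // ije; case/eqP: ij; apply: val_inj.
  split; last by rewrite setU1K // jN.
  apply/subsetP => i; rewrite !inE => /predU1P[->|/(subsetP sI)]; first exact: ltnSn.
  by rewrite inE => /ltnW.
have initN I : (I \subset initial j.+1) && (jj \notin I) = (I \subset initial j).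
  apply/andP/idP => [[sI jI]|sI].
    apply/subsetP => i iI; have := subsetP sI i iI; rewrite !inE ltnS leq_eqVlt.
    case/predU1P => // ije; case/negP: jI; rewrite (_ : jj = i) //.
    exact: val_inj.
  split; last exact: jN.
  by apply: (subset_trans sI); apply/subsetP => i; rewrite !inE => /ltnW.
rewrite [X in _ = X + _](eq_bigl (fun I => I \subset initial j)) //.
rewrite [X in _ = _ + X](eq_bigl (fun I => I \subset initial j)) // -big_split.
apply: eq_bigr => I sI; rewrite cardsU1 (jN _ sI) add1n subSS.
rewrite (mixedS (j := jj)) //= subSn; last first.
  rewrite -[X in (_ <= X)%N](_ : #|initial j| = j) ?subset_leq_card //.
  rewrite -sum1_card; under eq_bigl do rewrite inE.
  by rewrite -(big_ord_widen m (fun=> 1%N)) ?(ltnW lt_jm) // sum1_card card_ord.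
rewrite fpowS exprS; move: ((-1) ^+ _) (fpow a _) (_%:P) (\det _) (\det _).
by move=> sg F al D1 D2; ring.
Qed.

(** Both sides are coefficients of the determinant of the rows [r_i (X - T)]:
    on the left after expanding row by row in factorial powers of [X], on the
    right after factoring out the characteristic polynomial. *)
Lemma det_pieri (c : nat -> A) (p : nat) : (1 <= p <= m)%N ->
    char_poly T = fcharp a c m ->
  \sum_(I : {set 'I_m} | #|I| == p) \det (\matrix_i pieri_row I i)
    = (-1) ^+ p * c (m - p)%N * \det (\matrix_i r i).
Proof.
case/andP=> p_gt0 le_pm charT.
pose D := \det (\matrix_i r i); pose e q :=
  \sum_(I : {set 'I_m} | #|I| == q) \det (\matrix_i pieri_row I i).
have sum_e : \sum_(j < m.+1) ((-1) ^+ (m - j) * e (m - j)%N) *: fpow a j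
    = D *: fcharp a c m.
  transitivity (\det (mixed 0 set0)); last first.
    by rewrite mixed0 charT mulrC mul_polyC.
  rewrite (mixed_sum (leqnn m)).
  have sI I : I \subset initial m by apply/subsetP => i _; rewrite inE.
  have cardm I : (#|I| < m.+1)%N by rewrite ltnS -[X in (_ <= X)%N]card_ord max_card.
  rewrite (partition_big (fun I => Ordinal (cardm I)) predT) //=.
  rewrite (reindex_inj rev_ord_inj) /=; apply: eq_bigr => q _.
  rewrite subSS subKn -1?ltnS // -scalerA scaler_suml scaler_sumr.
  apply: eq_big => [I|I /eqP qE]; first by rewrite sI -val_eqE.
  rewrite mixed_full qE [RHS]mulrC mul_polyC -[in LHS]signr_odd -[in RHS]signr_odd.
  by rewrite scaler_sign mulr_sign; case: (odd q); rewrite ?scalerN.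
pose d j := (-1) ^+ (m - j) * e (m - j)%N - D * (if j == m then 1 else c j).
have /fpow_free d0 : \sum_(j < m.+1) d j *: fpow a j = 0.
  under eq_bigr do rewrite /d scalerBl.
  rewrite sumrB sum_e big_ord_recr /= eqxx mulr1 /fcharp scalerDr addrC.
  rewrite opprD addrACA subrr add0r scaler_sumr -sumrB big1 // => j _.
  by rewrite ltn_eqF // scalerA subrr.
have := d0 (m - p)%N; rewrite /d ltnS leq_subr subKn // => /(_ isT).
rewrite ltn_eqF; last by rewrite ltn_subrL p_gt0 (leq_trans p_gt0).
move=> /eqP; rewrite subr_eq0 => /eqP ep.
by rewrite -mulrA [c _ * _]mulrC -ep mulrA -exprD addnn -signr_odd odd_double mul1r.
Qed.

End Pieri.

(** * Determinants as functionals on the exterior algebra *)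

Section RowDeterminant.
Variables (B : comPzRingType) (m : nat).
Implicit Types (x y : 'rV[B]_m) (r s : seq 'rV[B]_m).

Definition detl r : B := \det (\matrix_(i < m) nth 0 r i).

Lemma detl_linear r s c x y : (size r < m)%N ->
  detl (r ++ (c *: x + y) :: s) = c * detl (r ++ x :: s) + detl (r ++ y :: s).
Proof.
move=> lt_rm; rewrite -[detl (r ++ y :: s)]mul1r.
apply: (@determinant_multilinear _ _ _ _ _ (Ordinal lt_rm)).
- by rewrite !rowK /= !nth_cat ltnn subnn scale1r.
- apply/row_matrixP => i; rewrite !row_rowsub !rowK !nth_cat.
  have := neq_lift (Ordinal lt_rm) i; rewrite -val_eqE /=.
  case: ltngtP => // lt_ri _; by rewrite -subn_gt0 in lt_ri; case: (_ - _)%N lt_ri.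
- apply/row_matrixP => i; rewrite !row_rowsub !rowK !nth_cat.
  have := neq_lift (Ordinal lt_rm) i; rewrite -val_eqE /=.
  case: ltngtP => // lt_ri _; by rewrite -subn_gt0 in lt_ri; case: (_ - _)%N lt_ri.
Qed.

Lemma detlD r s x y : (size r < m)%N ->
  detl (r ++ (x + y) :: s) = detl (r ++ x :: s) + detl (r ++ y :: s).
Proof. by move=> lt_rm; rewrite -{1}[x]scale1r detl_linear // mul1r. Qed.

Lemma detlZ r s c x : (size r < m)%N ->
  detl (r ++ (c *: x) :: s) = c * detl (r ++ x :: s).
Proof.
move=> lt_rm; have := detl_linear s c x 0 lt_rm; rewrite addr0 => ->.
have := detl_linear s 1 0 0 lt_rm; rewrite scaler0 addr0 mul1r.
by move/eqP; rewrite addrC -subr_eq subrr eq_sym => /eqP ->; rewrite addr0.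
Qed.

Lemma detl_dup r s t x : (size r + size s + 1 < m)%N ->
  detl (r ++ x :: s ++ x :: t) = 0.
Proof.
move=> lt_m; have lt1 : (size r < m)%N by lia.
have lt2 : (size r + (size s).+1 < m)%N by lia.
apply: (@determinant_alternate _ _ _ (Ordinal lt1) (Ordinal lt2)).
  by rewrite -val_eqE /=; lia.
move=> j; rewrite !mxE /= !nth_cat ltnn subnn /= ltnNge leq_addr /=.
by rewrite addKn /= nth_cat ltnn subnn.
Qed.

Lemma detl_swap r s x y : (size r + 1 < m)%N ->
  detl (r ++ x :: y :: s) = - detl (r ++ y :: x :: s).
Proof.
move=> lt_m; apply/eqP; rewrite -addr_eq0; apply/eqP.
have lt_rm : (size r < m)%N by lia.
have lt_rm' z : (size (rcons r z) < m)%N by rewrite size_rcons; lia.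
have dup z : detl (r ++ z :: z :: s) = 0.
  by apply: (@detl_dup r [::]); rewrite addn0.
have := dup (x + y); rewrite detlD //.
rewrite -[r ++ x :: _]cat_rcons -[r ++ y :: _]cat_rcons !detlD // !cat_rcons.
by rewrite !dup add0r addr0.
Qed.

Lemma detl_move r s t x : (size r + size s < m)%N ->
  detl (r ++ x :: s ++ t) = (-1) ^+ size s * detl (r ++ s ++ x :: t).
Proof.
elim: s r => [|y s IHs] r /= lt_m; first by rewrite mul1r.
rewrite detl_swap; last by lia.
rewrite -cat_rcons IHs ?size_rcons; last by lia.
by rewrite cat_rcons exprS mulN1r mulNr.
Qed.

End RowDeterminant.

Section SortedEnum.
Variable n : nat.
Implicit Types (S : {set 'I_n}) (i : 'I_n).

Lemma sorted_enum S : sorted (relpre val ltn) (enum S).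
Proof.
rewrite /enum_mem sorted_filter //; first by move=> ? ? ?; apply: ltn_trans.
by rewrite -enumT -sorted_map val_enum_ord iota_ltn_sorted.
Qed.

Lemma eq_enum_sorted S (s : seq 'I_n) :
  sorted (relpre val ltn) s -> s =i S -> enum S = s.
Proof.
move=> sort_s sS.
apply: (irr_sorted_eq _ _ (sorted_enum S) sort_s) => [? ? ?||i].
- exact: ltn_trans.
- by move=> ?; apply: ltnn.
- by rewrite mem_enum sS.
Qed.

Definition below S i : seq 'I_n := [seq j : 'I_n <- enum S | (j < i)%N].
Definition above S i : seq 'I_n := [seq j : 'I_n <- enum S | (i < j)%N].

Let ltr_trans : transitive (relpre (@nat_of_ord n) ltn).
Proof. by move=> ? ? ?; apply: ltn_trans. Qed.

Let sorted_below S i : sorted (relpre val ltn) (below S i).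
Proof. exact: sorted_filter (sorted_enum S). Qed.

Lemma mem_below S i j : (j \in below S i) = (j < i)%N && (j \in S).
Proof. by rewrite mem_filter mem_enum. Qed.

Lemma mem_above S i j : (j \in above S i) = (i < j)%N && (j \in S).
Proof. by rewrite mem_filter mem_enum. Qed.

Let sorted_above S i : sorted (relpre val ltn) (above S i).
Proof. exact: sorted_filter (sorted_enum S). Qed.

(** Wedging with [v_i] inserts [i] into the increasing enumeration, after the
    [below S i] elements counted by its sign. *)
Lemma enum_setU1 S i : i \notin S -> enum (i |: S) = below S i ++ i :: above S i.
Proof.
move=> iS; apply: eq_enum_sorted => [|j].
  rewrite (sorted_pairwise ltr_trans) pairwise_cat /= -!(sorted_pairwise ltr_trans).
  rewrite sorted_below sorted_above /= filter_all !andbT; apply/allrelP => x y.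
  rewrite mem_below inE => /andP[xi _] /predU1P[->//|].
  by rewrite mem_above => /andP[iy _]; apply: ltn_trans iy.
rewrite mem_cat inE mem_below mem_above !inE -val_eqE.
by case: ltngtP => //= _; rewrite orbF.
Qed.

Lemma enum_split S i : i \notin S -> enum S = below S i ++ above S i.
Proof.
move=> iS; apply: eq_enum_sorted => [|j].
  rewrite (sorted_pairwise ltr_trans) pairwise_cat -!(sorted_pairwise ltr_trans).
  rewrite sorted_below sorted_above !andbT; apply/allrelP => x y.
  by rewrite mem_below mem_above => /andP[xi _] /andP[iy _]; apply: ltn_trans iy.
rewrite mem_cat mem_below mem_above.
case: (ltngtP j i) => [ji|ij|/val_inj ->]; rewrite ?orbF //=.
by rewrite (negPf iS).
Qed.

Lemma size_below S i : size (below S i) = #|[set j in S | (j < i)%N]|.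
Proof.
rewrite cardE; congr size; apply/esym/eq_enum_sorted => [|j].
  by apply: sorted_filter (sorted_enum S) => ? ? ?; apply: ltn_trans.
by rewrite mem_filter mem_enum inE andbC.
Qed.

End SortedEnum.

Section ExteriorDeterminant.
Variables (n m : nat) (B : comPzRingType) (phi : {rmorphism Rq n -> B}).
Variable g : nat -> 'rV[B]_m.
Implicit Types (u v : ext n) (r : seq 'rV[B]_m).

(** The linear functional sending the wedge of [v_(i_1), ..., v_(i_j)] to the
    determinant of the rows [r] followed by [g i_1, ..., g i_j]. The prefix [r]
    lets the factors of an iterated wedge be absorbed one at a time. *)
Definition extdet r u : B := \sum_(S : {set 'I_n} | (size r + #|S|)%N == m)
  phi (u S) * detl (r ++ [seq g (val i) | i <- enum S]).

Lemma extdetD r u v : extdet r (u + v) = extdet r u + extdet r v.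
Proof.
by rewrite -big_split; apply: eq_bigr => S _; rewrite ffunE rmorphD mulrDl.
Qed.

Lemma extdetZ r c u : extdet r (c *: u) = phi c * extdet r u.
Proof.
by rewrite mulr_sumr; apply: eq_bigr => S _; rewrite ffunE rmorphM mulrA.
Qed.

Lemma extdet1 r : size r = m -> extdet r (ext1 n) = detl r.
Proof.
move=> rm; rewrite /extdet (big_pred1 set0) => [|S] /=.
  by rewrite ffunE eqxx rmorph1 mul1r enum_set0 cats0.
by rewrite rm -[X in _ == X]addn0 eqn_add2l cards_eq0.
Qed.

Lemma extdet_wedge r i u : extdet r (wedge i u) = extdet (rcons r (g i)) u.
Proof.
rewrite /extdet (bigID (fun S : {set 'I_n} => i \in S)) /= addrC big1 ?add0r; last first.
  by move=> S /andP[_ iS]; rewrite ffunE (negPf iS) rmorph0 mul0r.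
rewrite [RHS](bigID (fun S : {set 'I_n} => i \in S)) /= [X in X + _]big1 ?add0r; last first.
  move=> S /andP[/eqP rS iS]; rewrite cat_rcons.
  have -> : enum S = below (S :\ i) i ++ i :: above (S :\ i) i.
    by rewrite -enum_setU1 ?setD1K // !inE eqxx.
  rewrite map_cat /= detl_dup ?mulr0 // size_map; move: rS.
  rewrite size_rcons (cardsD1 i) iS cardE (enum_split (i := i)) ?inE ?eqxx //.
  rewrite size_cat add1n => rS; rewrite -[X in (_ < X)%N]rS.
  by rewrite addn1 addSn addnS !ltnS leq_add2l leq_addr.
rewrite (reindex_onto (fun S => i |: S) (fun S => S :\ i)) /=; last first.
  by move=> S /andP[_ iS]; rewrite setD1K.
apply: eq_big => [S|S /andP[/andP[/eqP rS _] /eqP iSD]].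
  rewrite setU11 andbT size_rcons; apply/andP/andP => [[rS /eqP <-]|[rS iS]].
    rewrite !inE eqxx; split=> //.
    by move: rS; rewrite (cardsD1 i) setU11 addSnnS.
  by rewrite setU1K // eqxx cardsU1 iS addnCA add1n.
have iS : i \notin S by rewrite -iSD !inE eqxx.
rewrite ffunE setU11 setU1K // enum_setU1 // map_cat /= cat_rcons (enum_split iS).
rewrite map_cat detl_move; last first.
  rewrite size_map -[X in (_ < X)%N]rS cardsU1 iS cardE (enum_split iS) size_cat.
  by rewrite add1n addnS ltnS leq_add2l leq_addr.
rewrite size_map size_below rmorphM rmorphXn rmorphN1 mulrCA mulrA; congr (_ ^+ _ * _ * _).
by apply: eq_card => j; rewrite !inE; case: eqP => [->|//]; rewrite ltnn !andbF.
Qed.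

(** [v_{n+1}] stands for [(-1)^(k-1) q v_1]. *)
Definition wrap_row k j : 'rV[B]_m :=
  if j == n then phi ((-1) ^+ (k - 1) * lq) *: g 0 else g j.

Lemma extdet_rowZ r c x u : extdet (rcons r (c *: x)) u = c * extdet (rcons r x) u.
Proof.
rewrite /extdet mulr_sumr; apply: eq_big => [S|S /eqP rS]; first by rewrite !size_rcons.
rewrite !cat_rcons detlZ; first exact: mulrCA.
by rewrite -[X in (_ < X)%N]rS size_rcons addSn ltnS leq_addr.
Qed.

Lemma extdet_rowD r x y u :
  extdet (rcons r (x + y)) u = extdet (rcons r x) u + extdet (rcons r y) u.
Proof.
rewrite [extdet (rcons r x) u](eq_bigl (fun S : {set 'I_n} => size (rcons r y) + #|S| == m)%N).
  rewrite -big_split; apply: eq_big => [S|S /eqP rS]; first by rewrite !size_rcons.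
  rewrite !cat_rcons detlD; first exact: mulrDr.
  by rewrite -[X in (_ < X)%N]rS size_rcons addSn ltnS leq_addr.
by move=> S; rewrite !size_rcons.
Qed.

Lemma extdet_psi k r j u : (0 < n)%N -> (j <= n)%N ->
  extdet r (psi k j.+1 u) = extdet (rcons r (wrap_row k j)) u.
Proof.
move=> n_gt0; rewrite leq_eqVlt /psi /wrap_row eqSS => /predU1P[->|lt_jn].
  by rewrite eqxx extdetZ /= insubT extdet_rowZ extdet_wedge.
by rewrite ltn_eqF // insubT /= extdet_wedge.
Qed.

Lemma extdet_tpsi k r j l u : (j < n)%N ->
  extdet r (tpsi k l j.+1 u) = extdet (rcons r
    (wrap_row k j.+1 + phi (lconst (yvar n j.+1 - yvar n l)) *: g j)) u.
Proof.
move=> lt_jn; have n_gt0 := leq_ltn_trans (leq0n j) lt_jn.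
rewrite /tpsi extdetD extdetZ !extdet_psi //; last exact: ltnW.
by rewrite extdet_rowD extdet_rowZ /wrap_row (ltn_eqF lt_jn).
Qed.

Lemma extdet_foldr (I : Type) (op : I -> ext n -> ext n) (row : I -> 'rV[B]_m) s :
    (forall r i u, extdet r (op i u) = extdet (rcons r (row i)) u) ->
  size s = m -> extdet [::] (foldr op (ext1 n) s) = detl (map row s).
Proof.
move=> op_row sm.
suff step t r : extdet r (foldr op (ext1 n) t) = extdet (r ++ map row t) (ext1 n).
  by rewrite step extdet1 // size_map.
elim: t r => [|i t IHt] r /=; first by rewrite cats0.
by rewrite op_row IHt cat_rcons.
Qed.

End ExteriorDeterminant.

(** * Factorial Schur polynomials as determinants of coordinates *)

Lemma lreg_subX (A : comNzRingType) k (i j : 'I_k) :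
  i != j -> GRing.lreg ('X_i - 'X_j : {mpoly A[k]}).
Proof.
move=> ij; set p := 'X_i - 'X_j.
have pE m : p@_m = (U_(i) == m)%MM%:R - (U_(j) == m)%MM%:R.
  by rewrite mcoeffB !mcoeffX.
have Uij : (U_(j) == U_(i))%MM = false.
  by apply/negP => /eqP/mnmP/(_ i); rewrite !mnm1E eqxx eq_sym (negPf ij).
have p0 : p != 0.
  apply/eqP => /(congr1 (mcoeff U_(i))); rewrite pE eqxx Uij mcoeff0 subr0.
  by move/eqP; rewrite oner_eq0.
apply: lreg_mleadc; move: p0; rewrite -mleadc_eq0 pE.
case: (U_(i) == _)%MM; case: (U_(j) == _)%MM; rewrite ?subrr ?eqxx // ?sub0r ?subr0 => _.
- exact: lreg1.
- by apply/lregN/lreg1.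
Qed.

Lemma lreg_vandermonde (A : comNzRingType) k : GRing.lreg (vandermonde A k).
Proof.
rewrite /vandermonde; elim/big_ind: _ => [||i _]; [exact: lreg1|exact: lregM|].
elim/big_ind: _ => [||j ij]; [exact: lreg1|exact: lregM|].
by apply: lreg_subX; rewrite neq_ltn ij.
Qed.

Lemma det_rev (A : comPzRingType) k (M : 'M[A]_k) :
  \det (\matrix_(i, j) M (rev_ord i) (rev_ord j)) = \det M.
Proof.
pose s := perm (@rev_ord_inj k).
transitivity (\det (perm_mx s *m M *m perm_mx s^-1)).
  congr (\det _); rewrite -row_permE -col_permE.
  by apply/matrixP => i j; rewrite !mxE !permE.
by rewrite !det_mulmx !det_perm odd_permV mulrAC -signr_addb addbb mul1r.
Qed.

Lemma prod_rev (A : comPzRingType) k (x : 'I_k -> A) :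
  \prod_(i < k) \prod_(j < k | (i < j)%N) (x (rev_ord j) - x (rev_ord i))
    = \prod_(i < k) \prod_(j < k | (i < j)%N) (x i - x j).
Proof.
rewrite (exchange_big_dep xpredT) //= (reindex_inj rev_ord_inj) /=; apply: eq_bigr => i _.
rewrite (reindex_inj rev_ord_inj) /=; apply: eq_big => [j|j _].
  by move: (ltn_ord i) (ltn_ord j); lia.
by rewrite !rev_ordK.
Qed.

(** A change of basis from powers to polynomials of decreasing degree is
    triangular. *)
Lemma det_horner_trig (A : comNzRingType) k (F : 'I_k -> {poly A}) (x : 'I_k -> A) :
    (forall i, size (F i) <= k - i)%N ->
  \det (\matrix_(i, j) (F i).[x j])
    = (\prod_i (F i)`_(k - i.+1)) * \prod_(i < k) \prod_(j < k | (i < j)%N) (x i - x j).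
Proof.
move=> size_F; pose C : 'M[A]_k := \matrix_(i, l) (F i)`_(k - l.+1).
pose V := Vandermonde k (\row_j x (rev_ord j)).
have -> : \matrix_(i, j) (F i).[x j] = C *m \matrix_(i, j) V (rev_ord i) (rev_ord j).
  apply/matrixP => i j; rewrite !mxE (@horner_coef_wide _ k); last first.
    exact: leq_trans (size_F i) (leq_subr _ _).
  rewrite (reindex_inj rev_ord_inj); apply: eq_bigr => l _.
  by rewrite !mxE rev_ordK.
rewrite det_mulmx det_rev det_Vandermonde -det_tr det_trig; last first.
  apply/is_trig_mxP => i j ij; rewrite !mxE nth_default //.
  by apply: leq_trans (size_F j) _; apply: leq_sub2l.
congr (_ * _); first by apply: eq_bigr => i _; rewrite !mxE.
rewrite -prod_rev; apply: eq_bigr => i _; apply: eq_bigr => j _.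
by rewrite !mxE.
Qed.

Section SymmetricPolynomials.
Variables n k : nat.
Local Notation S := (sympoly n k).
Local Notation Rx := {mpoly (Rq n)[k]}.

Lemma sympolyC_zmod : zmod_morphism (@sympolyC n k).
Proof. by move=> c d; apply: val_inj; rewrite rmorphB /= mpolyCB. Qed.

Lemma sympolyC_monoid : monoid_morphism (@sympolyC n k).
Proof.
by split=> [|c d]; apply: val_inj; rewrite ?rmorph1 ?rmorphM //= mpolyCM.
Qed.

HB.instance Definition _ := GRing.isZmodMorphism.Build (Rq n) S
  (@sympolyC n k) sympolyC_zmod.
HB.instance Definition _ := GRing.isMonoidMorphism.Build (Rq n) S
  (@sympolyC n k) sympolyC_monoid.

Definition yS (j : nat) : S := sympolyC k (lconst (yvar n j)).

Let rootpoly : {poly Rx} := \prod_(j < k) ('X - ('X_j)%:P).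

Let rootpoly_sym i : rootpoly`_i \is symmetric.
Proof.
apply/issymP => s; rewrite -[LHS](coef_map (msym s)).
suff -> : map_poly (msym s) rootpoly = rootpoly by [].
rewrite rmorph_prod /rootpoly [RHS](reindex_inj (@perm_inj _ s)) /=.
apply: eq_bigr => j _; rewrite rmorphB /= map_polyX map_polyC /=.
by rewrite /msym mmapX mmap1U.
Qed.

(** The polynomial whose roots are the variables, written in the factorial
    basis: its coordinates are symmetric functions, since the basis has
    coefficients among the scalars. *)
Lemma rootpoly_fcharp : exists c : nat -> S,
  map_poly val (fcharp (fun l => yS l.+1) c k) = \prod_(j < k) ('X - ('X_j : Rx)%:P).
Proof.
pose f : {poly S} := \poly_(i < k.+1) SymPoly (rootpoly_sym i).
have size_root : size rootpoly = k.+1.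
  by rewrite size_prod_XsubC [index_enum _]unlock -enumT size_enum_ord.
have fE : map_poly val f = rootpoly.
  apply/polyP => i; rewrite coef_map coef_poly /=.
  by case: ltnP => [//|le_ki]; rewrite nth_default ?size_root ?rmorph0.
have [c fc] := @fpow_span S (fun l => yS l.+1) k.+1 f (size_poly _ _).
exists c; rewrite -/rootpoly -fE fc big_ord_recr /= /fcharp addrC.
suff -> : c k = 1 by rewrite scale1r.
apply: val_inj; rewrite rmorph1.
have /monicP : rootpoly \is monic by apply: monic_prod => j _; apply: monicXsubC.
rewrite lead_coefE size_root -fE coef_map /= fc coef_sum big_ord_recr /= big1.
  have /monicP := monic_fpow (fun l => yS l.+1) k.
  by rewrite lead_coefE size_fpow add0r coefZ /= => ->; rewrite mulr1.
move=> j _; rewrite coefZ nth_default ?mulr0 // size_fpow; exact: ltn_ord.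
Qed.

End SymmetricPolynomials.

Section FactorialRows.
Variables (A : comNzRingType) (a c : nat -> A) (k : nat).

Lemma map_frow (B : comNzRingType) (f : {rmorphism A -> B}) m :
  map_mx f (frow a c k m) = frow (f \o a) (f \o c) k m.
Proof.
elim: m => [|m IHm]; first by apply/rowP => j; rewrite !mxE rmorph_nat.
rewrite !frowS map_mxM IHm; congr (_ *m _); apply/matrixP => i j.
by rewrite !mxE !(rmorphB, rmorphD, rmorphMn, rmorph1) /=.
Qed.

(** At a root of [fcharp], reduction modulo [fcharp] does not change values. *)
Lemma frow_horner m x : root (fcharp a c k) x ->
  \sum_(l < k) frow a c k m 0 l * (fpow a l).[x] = (fpow a m).[x].
Proof.
move=> /rootP fx; pose v : 'cV[A]_k := \col_l (fpow a l).[x].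
have Tv : fcomp a c k *m v = x *: v.
  apply/colP => i; apply/eqP; rewrite eq_sym -subr_eq0; apply/eqP.
  transitivity ((fcharp a c k *+ (i.+1 == k)).[x]); last first.
    by rewrite hornerMn fx mul0rn.
  rewrite -fcomp_charmx_fpow.
  have -> : (x *: v) i 0 - (fcomp a c k *m v) i 0 = ((x%:M - fcomp a c k) *m v) i 0.
    by rewrite mulmxBl mul_scalar_mx [RHS]mxE [X in _ = _ + X]mxE.
  rewrite !mxE horner_sum; apply: eq_bigr => j _.
  by rewrite hornerM [in RHS]mxE !mxE hornerD hornerN hornerMn hornerX hornerC.
transitivity ((frow a c k m *m v) 0 0).
  by rewrite mxE; apply: eq_bigr => l _; rewrite mxE.
elim: m => [|m IHm].
  have k_gt0 : (0 < k)%N.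
    rewrite lt0n; apply/negP => /eqP k0; move: fx.
    by rewrite /fcharp k0 big_ord0 addr0 fpow0 hornerC => /eqP; rewrite oner_eq0.
  rewrite fpow0 hornerC mxE (bigD1 (Ordinal k_gt0)) //= !mxE fpow0 hornerC mulr1 big1 ?addr0 //.
  by move=> l; rewrite -val_eqE mxE /= => /negPf ->; rewrite mul0r.
rewrite frowS mulmxBr mulmxBl -!mulmxA Tv mul_scalar_mx -!scalemxAr -scalerBl.
by rewrite mxE IHm fpowS hornerM hornerXsubC mulrC.
Qed.

End FactorialRows.

Lemma map_fpow (A B : comNzRingType) (f : {rmorphism A -> B}) (a : nat -> A) m :
  map_poly f (fpow a m) = fpow (f \o a) m.
Proof.
rewrite rmorph_prod; apply: eq_bigr => l _.
by rewrite rmorphB /= map_polyX map_polyC.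
Qed.

Lemma map_fcharp (A B : comNzRingType) (f : {rmorphism A -> B}) (a c : nat -> A) m :
  map_poly f (fcharp a c m) = fcharp (f \o a) (f \o c) m.
Proof.
rewrite rmorphD rmorph_sum /= map_fpow; congr (_ + _); apply: eq_bigr => j _.
by rewrite map_polyZ map_fpow.
Qed.

Lemma root_prod_subX (A : comNzRingType) k (x : 'I_k -> A) j :
  root (\prod_(i < k) ('X - (x i)%:P)) (x j).
Proof.
by apply/rootP; rewrite horner_prod (bigD1 j) //= hornerXsubC subrr mul0r.
Qed.

Lemma facpow_horner n k m (j : 'I_k) :
  map_mpoly (@lconst _) (facpow m ('X_j : {mpoly {mpoly int[n]}[k]}))
    = (fpow (fun l => (lconst (yvar n l.+1))%:MP_[k]) m).['X_j].
Proof.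
rewrite /facpow big_add1 big_mkord rmorph_prod horner_prod; apply: eq_bigr => l _.
by rewrite rmorphB /= map_mpolyX map_mpolyC hornerXsubC.
Qed.

Lemma schur_vandermonde n k la :
  val (sympoly_schur n k la) * vandermonde (Rq n) k = \det (\matrix_(i < k, j < k)
    (fpow (fun l => (lconst (yvar n l.+1))%:MP_[k]) (nth 0%N la i + (k - i.+1))).['X_j]).
Proof.
have -> : vandermonde (Rq n) k = map_mpoly (@lconst _) (vandermonde {mpoly int[n]} k).
  rewrite rmorph_prod; apply: eq_bigr => i _; rewrite rmorph_prod; apply: eq_bigr => j _.
  by rewrite rmorphB /= !map_mpolyX.
rewrite -[LHS](rmorphM (map_mpoly (@lconst _)) (facschur n k la)) facschurE.
rewrite -det_map_mx; congr (\det _).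
by apply/matrixP => i j; rewrite !mxE; apply: facpow_horner.
Qed.

Section SchurDeterminant.
Variables (n k : nat) (c : nat -> sympoly n k).
Local Notation S := (sympoly n k).
Local Notation Rx := {mpoly (Rq n)[k]}.
Local Notation a := (fun l => yS n k l.+1).
Hypothesis charE :
  map_poly val (fcharp a c k) = \prod_(j < k) ('X - ('X_j : Rx)%:P).

Let aX l : Rx := (lconst (yvar n l.+1))%:MP.

Let root_fcharp (j : 'I_k) : root (fcharp aX (val \o c) k) ('X_j : Rx).
Proof.
have -> : fcharp aX (val \o c) k = map_poly val (fcharp a c k) by rewrite map_fcharp.
by rewrite charE; apply: (root_prod_subX (fun j => 'X_j)).
Qed.

(** The matrix of the numerator of [s_la] is the matrix of coordinates modulo
    the polynomial with roots [x_j], times the matrix of the denominator. *)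
Lemma sympoly_schurE (la : seq nat) :
  sympoly_schur n k la
    = \det (\matrix_(i < k) frow a c k (nth 0%N la (rev_ord i) + i)).
Proof.
set M := \matrix_(i < k) _; apply: val_inj; rewrite -[RHS]det_map_mx.
apply: (@lreg_vandermonde (Rq n) k); rewrite ![vandermonde _ _ * _]mulrC.
pose E : 'M[Rx]_k := \matrix_(i, j) (fpow aX i).['X_j].
have detE : \det (\matrix_(i, j) E (rev_ord i) j) = vandermonde (Rq n) k.
  transitivity (\det (\matrix_(i, j) (fpow aX (rev_ord i)).['X_j])).
    by congr (\det _); apply/matrixP => i j; rewrite !mxE.
  rewrite (det_horner_trig (F := fun i => fpow aX (rev_ord i)) (fun j => 'X_j)) /=.
    rewrite big1 ?mul1r // => i _; have /monicP := monic_fpow aX (k - i.+1).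
    by rewrite lead_coefE size_fpow.
  by move=> i; rewrite size_fpow subnSK.
rewrite schur_vandermonde -detE -[\det (map_mx _ M)]det_rev -det_mulmx.
congr (\det _); apply/matrixP => i j; rewrite !mxE.
under eq_bigr do rewrite !mxE rev_ordK.
rewrite -[LHS](frow_horner _ (root_fcharp j)).
rewrite [LHS](reindex_inj rev_ord_inj).
apply: eq_bigr => l _; congr (_ * _).
transitivity (map_mx val (frow a c k (nth 0%N la i + rev_ord i)) 0 (rev_ord l)).
  by rewrite map_frow.
by rewrite mxE.
Qed.

End SchurDeterminant.

(** * Special Schur polynomials and the quantum relations *)

Section FactorialRowEntries.
Variables (A : comNzRingType) (a c : nat -> A) (k : nat).
Implicit Types i j l : 'I_k.

Lemma frowS_entry m i j l : j = i.+1 :> nat -> l.+1 = k ->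
  frow a c k m.+1 0 j =
    frow a c k m 0 i + (a j - a m) * frow a c k m 0 j - c j * frow a c k m 0 l.
Proof.
move=> ji lk; rewrite frowS mulmxBr mul_mx_scalar mxE mulfcompE !mxE.
rewrite (big_pred1 i) => [|i']; last by rewrite ji eqSS eq_sym.
rewrite (big_pred1 l) => [|i']; last by rewrite -[X in _ == X]lk eqSS.
ring.
Qed.

End FactorialRowEntries.

Section SpecialSchur.
Variables (n k : nat) (c : nat -> sympoly n k).
Local Notation S := (sympoly n k).
Local Notation Rx := {mpoly (Rq n)[k]}.
Local Notation a := (fun l => yS n k l.+1).
Hypothesis k_gt0 : (0 < k)%N.
Hypothesis charE :
  map_poly val (fcharp a c k) = \prod_(j < k) ('X - ('X_j : Rx)%:P).

Let lt_k : (k.-1 < k)%N. Proof. by rewrite prednK. Qed.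
Let last := Ordinal lt_k.

(** All rows of the determinant but the last are basis vectors. *)
Lemma schur_row r : sympoly_schur n k [:: r] = frow a c k (k.-1 + r) 0 last.
Proof.
rewrite (sympoly_schurE charE); set M := \matrix_i _.
have rowM (i : 'I_k) : (i < k.-1)%N -> row i M = \row_j (j == i :> nat)%:R.
  move=> lt_i; rewrite rowK nth_default ?add0n ?frow_lt //.
  by move: lt_i => /=; lia.
rewrite det_trig; last first.
  apply/is_trig_mxP => i j ij.
  have lt_i : (i < k.-1)%N by have := ltn_ord j; lia.
  by have /rowP/(_ j) := rowM i lt_i; rewrite !mxE => ->; rewrite gtn_eqF.
rewrite (bigD1 last) //= big1 ?mulr1 => [|i].
  by rewrite mxE /= prednK // subnn addnC.
rewrite -val_eqE /= => i_last.
have lt_i : (i < k.-1)%N by have := ltn_ord i; lia.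
by have /rowP/(_ i) := rowM i lt_i; rewrite !mxE => ->; rewrite eqxx.
Qed.

(** Here the rows are the basis vectors except the one of index [k - p], and
    then the reduction of [fpow k]; expanding along the latter leaves a single
    coordinate, a coefficient of the root polynomial. *)
Lemma schur_column p : (1 <= p <= k)%N ->
  sympoly_schur n k (nseq p 1%N) = (-1) ^+ p * c (k - p)%N.
Proof.
case/andP => p_gt0 le_pk; rewrite (sympoly_schurE charE); set M := \matrix_i _.
have lt_pk : (k - p < k)%N by rewrite ltn_subrL p_gt0.
pose j0 := Ordinal lt_pk.
have Mlift (i : 'I_k.-1) j : M (lift last i) j = (j == lift j0 i)%:R.
  have lt_i := ltn_ord i.
  rewrite mxE (_ : _ + _ = bump (k - p) i)%N; last first.
    rewrite nth_nseq /= /bump [(k.-1 <= i)%N]leqNgt lt_i /= add0n.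
    by case: ifP; case: leqP; lia.
  rewrite frow_lt; last by rewrite /bump; case: leqP; lia.
  by rewrite mxE -val_eqE.
have Mlast j : M last j = - c j.
  rewrite mxE /= prednK // subnn nth_nseq p_gt0 add1n prednK //.
  exact: frow_top.
rewrite (expand_det_row _ last) (bigD1 j0) //= [X in _ + X]big1 ?addr0 => [|j jj0].
  rewrite Mlast /cofactor (_ : row' last (col' j0 M) = 1%:M) ?det1.
    rewrite mulr1 mulNr mulrC -mulNr; congr (_ * _).
    rewrite -[X in - X]signr_odd -[RHS]signr_odd -signrN; congr (_ ^+ _).
    by rewrite /=; lia.
  by apply/matrixP => i l; rewrite mxE mxE Mlift (inj_eq lift_inj) !mxE eq_sym.
case: (unliftP j j0) => [l lE|/eqP]; last by rewrite eq_sym (negPf jj0).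
rewrite /cofactor (expand_det_col _ l) big1 ?mulr0 // => i _.
by rewrite mxE mxE Mlift -lE (negPf (neq_lift j0 i)) mul0r.
Qed.

Hypothesis lt_kn : (k < n)%N.
Local Notation phi := (@qclass n k \o @sympolyC n k).

Lemma qclass_rel i : (i < size (qrels n k))%N -> qclass ((qrels n k)`_i) = 0.
Proof.
move=> lt_i; rewrite -(rmorph0 (@qclass n k)); apply/qclassP; rewrite subr0; apply/qidealP.
exists (fun j => (j == i)%:R).
rewrite (bigD1 (Ordinal lt_i)) //= eqxx mul1r big1 ?addr0 // => j.
by rewrite -val_eqE /= => /negPf ->; rewrite mul0r.
Qed.

Lemma qclass_row r : (n - k < r < n)%N -> schubert n k [:: r] = 0.
Proof.
move=> r_bd; have := @qclass_rel (r - (n - k + 1)).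
rewrite /qrels size_rcons size_map size_iota nth_rcons size_map size_iota.
rewrite (nth_map 0%N) ?size_iota; last by lia.
rewrite nth_iota; last by lia.
case: ifP; last by lia.
by move=> _ /(_ ltac:(lia)); rewrite subnKC //; lia.
Qed.

Lemma qclass_row_n : schubert n k [:: n] = phi ((-1) ^+ (k - 1) * lq).
Proof.
have := @qclass_rel (k - 1).
rewrite /qrels size_rcons size_map size_iota nth_rcons size_map size_iota ltnn eqxx.
move=> /(_ ltac:(lia)) /eqP; rewrite rmorphD /= addr_eq0 => /eqP.
rewrite /schubert => ->; rewrite -!rmorphN /=; congr (qclass (sympolyC k _)).
by rewrite -mulNr -[k in LHS](subnK k_gt0) exprD expr1 mulrN1 opprK.
Qed.

Lemma yS_gt j : (n < j)%N -> yS n k j = 0.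
Proof.
case: j => // j lt_nj; rewrite /yS /= insubF ?rmorph0 //.
by rewrite ltnNge -ltnS lt_nj.
Qed.

(** Passing to the quotient forces the factorial power of exponent [n] to be
    the scalar [(-1)^(k-1) q]: the relations say so for the leading coordinates
    of its multiples by powers of the variable, and the remaining coordinates
    follow downwards from those. *)
Lemma frow_n : map_mx (@qclass n k) (frow a c k n)
  = phi ((-1) ^+ (k - 1) * lq) *: map_mx (@qclass n k) (frow a c k 0).
Proof.
pose z i (j : 'I_k) := qclass (frow a c k (n + i) 0 j).
have zlast i : (i <= k.-1)%N ->
    z i last = if (i == k.-1)%N then phi ((-1) ^+ (k - 1) * lq) else 0.
  move=> le_ik; have -> : z i last = schubert n k [:: (n - k + i).+1].
    by rewrite /schubert schur_row /z; congr (qclass (frow a c k _ 0 _)); lia.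
  case: eqP => ik; last by apply: qclass_row; lia.
  by rewrite -qclass_row_n; congr (schubert n k [:: _]); lia.
have step d i (j : 'I_k) : (j + d = k.-1)%N -> (i + d <= k.-1)%N ->
    z i j = if (i + d == k.-1)%N then phi ((-1) ^+ (k - 1) * lq) else 0.
  elim: d i j => [|d IHd] i j jd id_le.
    have {jd} -> : j = last by apply: val_inj; rewrite /= -jd addn0.
    by rewrite addn0 in id_le *; apply: zlast.
  have lt_jk : (j.+1 < k)%N by lia.
  pose j1 := Ordinal lt_jk.
  have zE : z i.+1 j1 = z i j + qclass (a j1) * z i j1 - qclass (c j1) * z i last.
    rewrite /z addnS (@frowS_entry _ a c k (n + i) j j1 last erefl (prednK k_gt0)).
    by rewrite /= (@yS_gt (n + i).+1) ?ltnS ?leq_addr // subr0 rmorphB rmorphD !rmorphM.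
  have -> : z i j = z i.+1 j1 - qclass (a j1) * z i j1 + qclass (c j1) * z i last.
    by rewrite zE [_ - _ - _]addrAC subrK addrK.
  have i1 : (i.+1 + d)%N = (i + d.+1)%N by rewrite addSnnS.
  have jd1 : (j1 + d = k.-1)%N by rewrite /= addSnnS.
  have lt_id : (i + d < k.-1)%N by rewrite -addnS.
  have lt_i : (i < k.-1)%N by apply: leq_ltn_trans lt_id; apply: leq_addr.
  rewrite (IHd i.+1 j1) ?i1 // (IHd i j1) ?(ltnW lt_id) // zlast ?(ltnW lt_i) //.
  by rewrite (ltn_eqF lt_id) (ltn_eqF lt_i) !mulr0 subr0 addr0.
apply/rowP => j; rewrite !mxE.
have -> : qclass (frow a c k n 0 j) = z 0%N j by rewrite /z addn0.
have jk : (j + (k.-1 - j) = k.-1)%N by rewrite subnKC // -ltnS prednK.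
rewrite (step _ _ _ jk) add0n ?leq_subr //.
have [-> | j0] := eqVneq (j : nat) 0%N; first by rewrite subn0 eqxx rmorph1 mulr1.
rewrite rmorph0 mulr0 ltn_eqF // -[X in (_ < X)%N]jk -[X in (X < _)%N]add0n.
by rewrite ltn_add2r lt0n.
Qed.

End SpecialSchur.

(** * Grassmannian permutations and partitions *)

Section Grassmannian.
Variables n k : nat.
Hypothesis le_kn : (k <= n)%N.
Implicit Types (w : 'S_n) (S : {set 'I_n}).

Lemma grassP w : reflect
  (forall i j : 'I_n, (i < j)%N -> (j < k)%N || (k <= i)%N -> (w i < w j)%N)
  (w \in grassmannian n k).
Proof.
rewrite inE; apply: (iffP forallP) => [Hw i j ij jk|Hw i].
  by have /forallP/(_ j) := Hw i; rewrite ij jk.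
by apply/forallP => j; apply/implyP => /andP[]; apply: Hw.
Qed.

Lemma mem_perm_supp w (i : 'I_n) : (w i \in perm_supp k w) = (i < k)%N.
Proof.
apply/imsetP/idP => [[j jk /perm_inj ->]|ik]; last by exists i; rewrite ?inE.
by move: jk; rewrite inE.
Qed.

Lemma card_perm_supp w : #|perm_supp k w| = k.
Proof.
rewrite card_imset; last exact: perm_inj.
rewrite -sum1_card; under eq_bigl do rewrite inE.
by rewrite -(big_ord_widen n (fun=> 1%N)) // sum1_card card_ord.
Qed.

Lemma enum_imset_incr w (P : {set 'I_n}) :
    {in P &, forall i j : 'I_n, (i < j)%N -> (w i < w j)%N} ->
  enum (w @: P) = map w (enum P).
Proof.
move=> w_incr; apply: eq_enum_sorted => [|j].
  rewrite sorted_map; apply: (sub_in_sorted (P := mem P) _ _ (sorted_enum P)).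
    by move=> i j iP jP; apply: w_incr.
  by apply/allP => i; rewrite mem_enum.
by apply/mapP/imsetP => -[i iP ->]; exists i; rewrite ?mem_enum // -mem_enum.
Qed.

Lemma enum_perm_supp w : w \in grassmannian n k ->
  enum (perm_supp k w) = [seq w (widen_ord le_kn i) | i <- enum 'I_k].
Proof.
move=> /grassP Hw; apply: eq_enum_sorted => [|j].
  rewrite sorted_map; apply: (@sub_sorted _ (relpre (@nat_of_ord k) ltn)).
    by move=> i j ij /=; apply: Hw => //=; rewrite ltn_ord.
  by rewrite -sorted_map val_enum_ord iota_ltn_sorted.
apply/mapP/imsetP => [[i _ ->]|[i]]; first by exists (widen_ord le_kn i); rewrite ?inE /=.
rewrite inE => ik ->; exists (Ordinal ik); rewrite ?mem_enum //.
by congr (w _); apply: val_inj.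
Qed.

(** Listing a subset and then its complement, each in increasing order, inverts
    [perm_supp]. *)
Definition grass_seq S : seq 'I_n := enum S ++ enum (~: S).

Lemma size_grass_seq S : size (grass_seq S) = n.
Proof. by rewrite size_cat -!cardE cardsC card_ord. Qed.

Lemma grass_fun_inj S : injective (fun i : 'I_n => nth i (grass_seq S) i).
Proof.
move=> i j; rewrite (set_nth_default j) ?size_grass_seq // => /eqP.
rewrite nth_uniq ?size_grass_seq // => [/eqP/val_inj //|].
rewrite cat_uniq !enum_uniq /= andbT; apply/hasPn => l.
by rewrite !mem_enum inE.
Qed.

Definition grass_perm S : 'S_n := perm (@grass_fun_inj S).

Lemma grass_perm_lt S (i : 'I_n) : #|S| = k -> (i < k)%N ->
  grass_perm S i = nth i (enum S) i.
Proof. by move=> Sk ik; rewrite permE nth_cat -cardE Sk ik. Qed.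

Lemma grass_perm_ge S (i : 'I_n) : #|S| = k -> (k <= i)%N ->
  grass_perm S i = nth i (enum (~: S)) (i - k).
Proof. by move=> Sk ik; rewrite permE nth_cat -cardE Sk ltnNge ik. Qed.

Lemma card_setC_k S : #|S| = k -> #|~: S| = (n - k)%N.
Proof. by move=> Sk; rewrite -[X in (X - _)%N]card_ord -(cardsC S) Sk addKn. Qed.

Let ltr_trans : transitive (relpre (@nat_of_ord n) ltn).
Proof. by move=> ? ? ?; apply: ltn_trans. Qed.

Lemma grass_perm_grass S : #|S| = k -> grass_perm S \in grassmannian n k.
Proof.
move=> Sk; apply/grassP => i j ij /orP[jk|ik].
  rewrite !grass_perm_lt // ?(ltn_trans ij) //.
  rewrite (set_nth_default j) -?cardE ?Sk ?(ltn_trans ij) //.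
  apply: (sorted_ltn_nth ltr_trans _ (sorted_enum S)) => //;
    by rewrite inE -cardE Sk // (ltn_trans ij).
have kj := leq_trans ik (ltnW ij).
have lt_sub (l : 'I_n) : (k <= l)%N -> (l - k < size (enum (~: S)))%N.
  by move=> kl; rewrite -cardE card_setC_k // ltn_sub2r // (leq_ltn_trans kl).
rewrite !grass_perm_ge // (set_nth_default j) ?lt_sub //.
apply: (sorted_ltn_nth ltr_trans _ (sorted_enum (~: S))); rewrite ?inE ?lt_sub //.
by rewrite ltn_sub2r // (leq_ltn_trans ik).
Qed.

Lemma grass_permK S : #|S| = k -> perm_supp k (grass_perm S) = S.
Proof.
move=> Sk; apply/eqP; rewrite eqEcard card_perm_supp Sk leqnn andbT.
apply/subsetP => _ /imsetP[i ik ->]; rewrite inE in ik.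
by rewrite grass_perm_lt // -mem_enum mem_nth // -cardE Sk.
Qed.

Lemma perm_supp_inj w1 w2 : w1 \in grassmannian n k -> w2 \in grassmannian n k ->
  perm_supp k w1 = perm_supp k w2 -> w1 = w2.
Proof.
move=> /grassP Hw1 /grassP Hw2 eq_supp.
have eq_on (P : {set 'I_n}) :
    {in P &, forall i j : 'I_n, (i < j)%N -> (w1 i < w1 j)%N} ->
    {in P &, forall i j : 'I_n, (i < j)%N -> (w2 i < w2 j)%N} ->
    w1 @: P = w2 @: P -> {in P, w1 =1 w2}.
  move=> incr1 incr2 eqP i iP.
  have /eq_in_map : map w1 (enum P) = map w2 (enum P).
    by rewrite -!enum_imset_incr // eqP.
  by apply; rewrite mem_enum.
pose low := [set i : 'I_n | (i < k)%N].
have lowE w : w @: low = perm_supp k w 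
  by apply/setP => j; apply/imsetP/imsetP => -[i]; rewrite ?inE => ik ->; exists i; rewrite ?inE.
have highE w : w @: (~: low) = ~: perm_supp k w.
  by apply/setP => j; rewrite -(permKV w j) -lowE in_setC !mem_imset ?in_setC //; apply: perm_inj.
apply/permP => i; have [ik|ki] := ltnP i k.
  apply: (eq_on low); rewrite ?lowE ?inE //.
    by move=> j l; rewrite !inE => _ lk jl; apply: Hw1; rewrite ?lk.
  by move=> j l; rewrite !inE => _ lk jl; apply: Hw2; rewrite ?lk.
apply: (eq_on (~: low)); rewrite ?highE ?eq_supp ?inE -?leqNgt //.
  by move=> j l; rewrite !inE -!leqNgt => kj _ jl; apply: Hw1; rewrite ?kj ?orbT.
by move=> j l; rewrite !inE -!leqNgt => kj _ jl; apply: Hw2; rewrite ?kj ?orbT.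
Qed.

End Grassmannian.

Lemma oneline_ord n (w : 'S_n) (i : 'I_n) : oneline w i.+1 = (w i).+1.
Proof. by rewrite /oneline valK. Qed.

Section PermPart.
Variables n k : nat.
Hypothesis le_kn : (k <= n)%N.
Local Notation widen := (widen_ord le_kn).
Variable w : 'S_n.
Hypothesis grass_w : w \in grassmannian n k.

Lemma grass_ge (i : 'I_n) : (i < k)%N -> (i <= w i)%N.
Proof.
case: i => i lt_in /=; elim: i lt_in => // i IHi lt_in lt_ik.
apply: leq_ltn_trans (IHi (ltnW lt_in) (ltnW lt_ik)) _.
by move/grassP: grass_w; apply=> //=; rewrite lt_ik.
Qed.

Lemma size_perm_part : size (perm_part k w) = k.
Proof. by rewrite size_map size_rev size_iota. Qed.

Lemma nth_perm_part (i : 'I_k) :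
  nth 0%N (perm_part k w) (k - i.+1) = (w (widen i) - i)%N.
Proof.
have lt_i : (k - i.+1 < k)%N by rewrite ltn_subrL (leq_ltn_trans _ (ltn_ord i)).
rewrite (nth_map 0%N) ?size_rev ?size_iota // nth_rev ?size_iota //.
rewrite nth_iota; last by rewrite ltn_subrL (leq_ltn_trans _ (ltn_ord i)).
rewrite subnSK // subKn; last by rewrite ltnW.
by rewrite add1n (oneline_ord w (widen i)) subSS.
Qed.

Lemma nth_perm_partD (i : 'I_k) :
  (nth 0%N (perm_part k w) (rev_ord i) + i)%N = w (widen i).
Proof. by rewrite nth_perm_part subnK // (grass_ge (i := widen i)) //=. Qed.

End PermPart.

Section ExteriorDegree.
Variable n : nat.
Implicit Types u v : ext n.

Lemma ext_degD d u v : ext_deg d u -> ext_deg d v -> ext_deg d (u + v).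
Proof. by move=> du dv S Sd; rewrite ffunE du // dv // addr0. Qed.

Lemma ext_degZ d c u : ext_deg d u -> ext_deg d (c *: u).
Proof. by move=> du S Sd; rewrite ffunE du // scaler0. Qed.

Lemma ext_deg_sum d (I : Type) (r : seq I) (P : pred I) (F : I -> ext n) :
  (forall i, P i -> ext_deg d (F i)) -> ext_deg d (\sum_(i <- r | P i) F i).
Proof.
move=> dF; elim/big_ind: _ => // [S _|]; [by rewrite ffunE | exact: ext_degD].
Qed.

Lemma ext_deg1 : ext_deg 0 (ext1 n).
Proof. by move=> S; rewrite cards_eq0 ffunE => /negPf ->. Qed.

Lemma ext_deg_wedge d i u : ext_deg d u -> ext_deg d.+1 (wedge i u).
Proof.
move=> du S Sd; rewrite ffunE; case: ifP => // iS; rewrite du ?mulr0 //.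
by move: Sd; rewrite (cardsD1 i) iS add1n eqSS.
Qed.

Lemma ext_deg_psi d k j u : ext_deg d u -> ext_deg d.+1 (psi k j u).
Proof.
move=> du; have dv i : ext_deg d.+1 (oapp ((wedge (n:=n))^~ u) 0 (insub i)).
  by case: insubP => [l _ _|_] /=; [apply: ext_deg_wedge | move=> S _; rewrite ffunE].
rewrite /psi; case: eqP => _; first exact/ext_degZ/dv.
by case: j => [|j]; [move=> S _; rewrite ffunE | apply: dv].
Qed.

Lemma ext_deg_tpsi d k l j u : ext_deg d u -> ext_deg d.+1 (tpsi k l j u).
Proof. by move=> du; apply: ext_degD; [|apply: ext_degZ]; apply: ext_deg_psi. Qed.

Lemma ext_deg_foldr (I : Type) (op : I -> ext n -> ext n) s :
    (forall d i u, ext_deg d u -> ext_deg d.+1 (op i u)) ->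
  ext_deg (size s) (foldr op (ext1 n) s).
Proof. by move=> dop; elim: s => [|i s IHs]; [exact: ext_deg1 | apply: dop]. Qed.

Lemma ext_deg_ket k la : ext_deg k (ket n k la).
Proof.
rewrite -[X in ext_deg X _](size_iota 1 k); apply: ext_deg_foldr => d i u.
exact: ext_deg_psi.
Qed.

Lemma ext_deg_pieri_term k (w : 'S_n) (I : {set 'I_k}) : ext_deg k (pieri_term w I).
Proof.
rewrite -[X in ext_deg X _]size_enum_ord; apply: ext_deg_foldr => d i u du.
by case: ifP => _; [apply: ext_deg_tpsi | apply: ext_deg_psi].
Qed.

End ExteriorDegree.

Section ExteriorGrassmannian.
Variables (n k : nat) (B : comPzRingType) (phi : {rmorphism Rq n -> B}).
Variable g : nat -> 'rV[B]_k.
Hypothesis le_kn : (k <= n)%N.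
Local Notation widen := (widen_ord le_kn).

Lemma detl_matrix (r : 'I_k -> 'rV[B]_k) :
  detl [seq r i | i <- enum 'I_k] = \det (\matrix_i r i).
Proof.
congr (\det _); apply/row_matrixP => i; rewrite !rowK.
by rewrite (nth_map i) ?size_enum_ord // nth_ord_enum.
Qed.

Lemma extdet_grass u : extdet phi g [::] u =
  \sum_(w in grassmannian n k)
    phi (u (perm_supp k w)) * \det (\matrix_(i < k) g (w (widen i))).
Proof.
rewrite /extdet (reindex_onto (perm_supp k) (@grass_perm n)) /=; last first.
  by move=> S /eqP Sk; rewrite (grass_permK le_kn).
apply: eq_big => [w|w].
  rewrite (card_perm_supp le_kn) eqxx /=; apply/eqP/idP => [gwK|grass_w].
    by rewrite -gwK; apply: grass_perm_grass; apply: card_perm_supp.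
  apply: (perm_supp_inj (k := k)) => //; last first.
    by rewrite (grass_permK le_kn) ?(card_perm_supp le_kn).
  by apply: grass_perm_grass; apply: card_perm_supp.
rewrite (card_perm_supp le_kn) eqxx /= => /eqP gwK.
have grass_w : w \in grassmannian n k.
  by rewrite -gwK; apply: grass_perm_grass; apply: card_perm_supp.
by rewrite (enum_perm_supp le_kn grass_w) -map_comp -detl_matrix -map_comp.
Qed.

End ExteriorGrassmannian.

(** * The column Pieri formula in the quantum ring *)

Lemma extdet_sum n m (B : comPzRingType) (phi : {rmorphism Rq n -> B}) g r
    (I : Type) (s : seq I) (P : pred I) (F : I -> ext n) :
  extdet (m := m) phi g r (\sum_(i <- s | P i) F i)
    = \sum_(i <- s | P i) extdet phi g r (F i).
Proof.
apply: (big_morph _ (extdetD phi g r)).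
by rewrite /extdet big1 // => S _; rewrite ffunE rmorph0 mul0r.
Qed.

Section PieriFormula.
Variables (n m : nat) (B : comPzRingType) (phi : {rmorphism Rq n -> B}).
Variables (A : comNzRingType) (f : {rmorphism A -> B}).
Variables (a c : nat -> A) (T : 'M[A]_m) (g : nat -> 'rV[A]_m).
Local Notation fg := (fun j => map_mx f (g j)).
Hypothesis le_mn : (m <= n)%N.
Local Notation widen := (widen_ord le_mn).
Hypothesis phi_y : forall l, phi (lconst (yvar n l.+1)) = f (a l).
Hypothesis fgT : forall j, (j < n)%N ->
  map_mx f (g j *m T) = wrap_row phi fg m j.+1 + f (a j) *: fg j.
Hypothesis charT : char_poly T = fcharp a c m.

(** Wedging with [t_j.psi_i] appends the row [g i *m (T - y_j)]. *)
Lemma extdet_pieri_term (w : 'S_n) (I : {set 'I_m}) :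
  extdet phi fg [::] (pieri_term w I)
    = f (\det (\matrix_i pieri_row a T (fun i => g (w (widen i))) I i)).
Proof.
rewrite -det_map_mx; set M := map_mx _ _.
transitivity (detl [seq row i M | i <- enum 'I_m]); last first.
  by rewrite detl_matrix; congr (\det _); apply/row_matrixP => i; rewrite rowK.
apply: extdet_foldr; last by rewrite size_enum_ord.
move=> r i u; rewrite (oneline_ord w (widen i)) -map_row rowK /pieri_row.
have n_gt0 : (0 < n)%N := leq_ltn_trans (leq0n _) (ltn_ord (w (widen i))).
case: ifP => _; last first.
  by rewrite extdet_psi // /wrap_row ?ltn_eqF // ltnW.
have t_gt0 : (t_index I i).-1.+1 = t_index I i by rewrite prednK // /t_index addn1.
rewrite extdet_tpsi //; congr (extdet _ _ (rcons _ _) _).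
rewrite mulmxBr mul_mx_scalar map_mxB fgT // map_mxZ /= -!phi_y t_gt0.
by rewrite !rmorphB /= scalerBl addrA.
Qed.

Lemma extdet_pieri (w : 'S_n) p : (1 <= p <= m)%N ->
  extdet phi fg [::] (\sum_(I : {set 'I_m} | #|I| == p) pieri_term w I)
    = f ((-1) ^+ p * c (m - p)%N) * \det (\matrix_i fg (w (widen i))).
Proof.
move=> p_bd; rewrite extdet_sum.
under eq_bigr do rewrite extdet_pieri_term.
rewrite -rmorph_sum (det_pieri _ p_bd charT) rmorphM; congr (_ * _).
by rewrite -det_map_mx; congr (\det _); apply/row_matrixP => i; rewrite -map_row !rowK.
Qed.

End PieriFormula.

Section ColumnPieri.
Variables (n k : nat) (c : nat -> sympoly n k).
Local Notation S := (sympoly n k).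
Local Notation Rx := {mpoly (Rq n)[k]}.
Local Notation a := (fun l => yS n k l.+1).
Hypothesis k_gt0 : (0 < k)%N.
Hypothesis lt_kn : (k < n)%N.
Hypothesis charE :
  map_poly val (fcharp a c k) = \prod_(j < k) ('X - ('X_j : Rx)%:P).
Local Notation phi := (@qclass n k \o @sympolyC n k).
Local Notation g := (fun j => map_mx (@qclass n k) (frow a c k j)).

Lemma schubert_det la :
  schubert n k la = \det (\matrix_(i < k) g (nth 0%N la (rev_ord i) + i)%N).
Proof.
rewrite /schubert (sympoly_schurE charE) -[LHS]det_map_mx; congr (\det _).
by apply/row_matrixP => i; rewrite -map_row !rowK.
Qed.

Lemma schubert_perm_part (w : 'S_n) : w \in grassmannian n k ->
  schubert n k (perm_part k w) = \det (\matrix_(i < k) g (w (widen_ord (ltnW lt_kn) i))).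
Proof.
move=> grass_w; rewrite schubert_det; congr (\det _); apply/row_matrixP => i.
by rewrite !rowK (nth_perm_partD (ltnW lt_kn)).
Qed.

Lemma to_qH_extdet u : to_qH k u = extdet phi g [::] u.
Proof.
rewrite (extdet_grass _ _ (ltnW lt_kn)); apply: eq_bigr => w grass_w.
by rewrite schubert_perm_part.
Qed.

Lemma wrap_frow j : (j <= n)%N -> wrap_row phi g k j = g j.
Proof. by rewrite /wrap_row => _; case: eqP => // ->; rewrite (frow_n k_gt0 charE lt_kn). Qed.

Lemma to_qH_ket la : (forall i, nth 0%N la i <= n - k)%N ->
  to_qH k (ket n k la) = schubert n k la.
Proof.
move=> la_le; rewrite to_qH_extdet schubert_det -detl_matrix.
have -> : ket n k la = foldr (fun (i : 'I_k) u =>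
    psi k (nth 0%N la (k - i.+1) + i.+1) u) (ext1 n) (enum 'I_k).
  by rewrite /ket (iotaDl 1 0) -val_enum_ord -map_comp foldr_map.
apply: extdet_foldr; last by rewrite size_enum_ord.
have n_gt0 : (0 < n)%N := leq_trans k_gt0 (ltnW lt_kn).
move=> r i u; have le_n : (nth 0%N la (k - i.+1) + i < n)%N.
  by have := la_le (k - i.+1)%N; have := ltn_ord i; lia.
by rewrite addnS (extdet_psi _ _ _ _ _ n_gt0 (ltnW le_n)) wrap_frow ?(ltnW le_n).
Qed.

Lemma to_qH_pieri (w : 'S_n) p : (1 <= p <= k)%N -> w \in grassmannian n k ->
  to_qH k (\sum_(I : {set 'I_k} | #|I| == p) pieri_term w I)
    = schubert n k (nseq p 1%N) * schubert n k (perm_part k w).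
Proof.
move=> p_bd grass_w; rewrite to_qH_extdet schubert_perm_part // /schubert.
rewrite (schur_column k_gt0 charE p_bd).
apply: (extdet_pieri (T := fcomp a c k)) => //; last exact: char_poly_fcomp.
move=> j lt_jn; rewrite frowT map_mxD map_mxZ; congr (_ + _).
by rewrite wrap_frow.
Qed.

End ColumnPieri.

(** * Linear independence of the Schubert classes *)

Section LinearExtension.
Variables (k : nat) (A : comNzRingType) (F : 'X_{1..k} -> A).

Definition mlin (p : {mpoly A[k]}) : A := \sum_(m <- msupp p) p@_m * F m.

Lemma mlinE d p : (msize p <= d)%N -> mlin p = \sum_(m : 'X_{1..k < d}) p@_m * F m.
Proof.
move=> le_pd; pose I : subFinType _ := 'X_{1..k < d}.
rewrite /mlin (big_mksub I) ?msupp_uniq //=; first last.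
  by move=> m /msize_mdeg_lt /leq_trans; apply.
by rewrite big_rmcond //= => m /memN_msupp_eq0 ->; rewrite mul0r.
Qed.

Lemma mlin_is_linear c p q : mlin (c *: p + q) = c * mlin p + mlin q.
Proof.
pose d := maxn (msize (c *: p + q)) (maxn (msize p) (msize q)).
rewrite !(@mlinE d) ?leq_max ?leqnn ?orbT // mulr_sumr -big_split.
by apply: eq_bigr => m _; rewrite mcoeffD mcoeffZ mulrDl mulrA.
Qed.

HB.instance Definition _ :=
  GRing.isLinear.Build A {mpoly A[k]} A^o *%R mlin mlin_is_linear.

Lemma mlinX m : mlin 'X_[m] = F m.
Proof. by rewrite /mlin msuppX big_seq1 mcoeffX eqxx mul1r. Qed.

End LinearExtension.

Section TensorFunctional.
Variables (n' k : nat) (A : comNzRingType) (a c : nat -> A).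
Local Notation n := n'.+1.
Local Notation T := (fcomp a c n).
Variable t : 'I_k -> 'I_n.

(** The coordinate of index [t j] of [f] modulo [fcharp]. *)
Definition coordf (j : 'I_k) (f : {poly A}) : A := (frow a c n 0 *m horner_mx T f) 0 (t j).

Lemma coordf_is_linear j : linear_for *%R (coordf j).
Proof. by move=> x p q; rewrite /coordf linearP /= mulmxDr -scalemxAr !mxE. Qed.

HB.instance Definition _ j := GRing.isLinear.Build A {poly A} A^o *%R
  (coordf j) (coordf_is_linear j).

Lemma frow_hornerE m : frow a c n m = frow a c n 0 *m horner_mx T (fpow a m).
Proof.
elim: m => [|m IHm]; first by rewrite fpow0 rmorph1 mulmx1.
by rewrite frowS IHm fpowS rmorphM rmorphB /= horner_mx_X horner_mx_C mulmxA.
Qed.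

Lemma coordf_fpow j m : coordf j (fpow a m) = frow a c n m 0 (t j).
Proof. by rewrite frow_hornerE. Qed.

Lemma coordf_fcharp j f : coordf j (f * fcharp a c n) = 0.
Proof.
by rewrite /coordf -char_poly_fcomp // rmorphM /= Cayley_Hamilton mulr0 mulmx0 mxE.
Qed.

(** The tensor product of the functionals [coordf j], one for each variable. *)
Definition tensorf := mlin (fun m : 'X_{1..k} => \prod_(j < k) coordf j ('X^(m j))).

HB.instance Definition _ := GRing.Linear.on tensorf.

Local Notation evX f j := ((map_poly (@mpolyC k A) f).['X_j]).

Lemma tensorfZ x p : tensorf (x *: p) = x * tensorf p.
Proof. exact: linearZ. Qed.

Lemma poly_wide (f : {poly A}) d : (size f <= d)%N ->
  f = \sum_(e < d) f`_e *: 'X^e.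
Proof.
move=> le_fd; rewrite -poly_def; apply/polyP => i; rewrite coef_poly.
by case: ltnP => // le_di; rewrite nth_default // (leq_trans le_fd).
Qed.

Lemma tensorf_prod (f : 'I_k -> {poly A}) :
  tensorf (\prod_j evX (f j) j) = \prod_j coordf j (f j).
Proof.
pose d := \max_j size (f j).
have le_d j : (size (f j) <= d)%N by apply: leq_bigmax.
have evE j : evX (f j) j = \sum_(e < d) (f j)`_e *: 'X_j ^+ e.
  rewrite (@horner_coef_wide _ d); last exact: leq_trans (size_poly _ _) (le_d j).
  by apply: eq_bigr => e _; rewrite coef_map /= mul_mpolyC.
have coE j : coordf j (f j) = \sum_(e < d) (f j)`_e * coordf j 'X^e.
  by rewrite [in LHS](poly_wide (le_d j)) linear_sum; apply: eq_bigr => e _; rewrite linearZ.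
under eq_bigr do rewrite evE.
under [RHS]eq_bigr do rewrite coE.
rewrite !bigA_distr_bigA linear_sum /=; apply: eq_bigr => s _.
rewrite scaler_prod linearZ /= [RHS]big_split /=; congr (_ * _).
have -> : \prod_(j < k) 'X_j ^+ s j = 'X_[[multinom s j : nat | j < k]] :> {mpoly A[k]}.
  by rewrite mpolyXE_id; apply: eq_bigr => j _; rewrite mnmE.
by rewrite /tensorf mlinX; apply: eq_bigr => j _; rewrite mnmE.
Qed.

(** By linearity [p] may be taken to be a monomial, which only replaces each
    factor [f j] by ['X^(m j) * f j]. *)
Lemma tensorf_kill p (f : 'I_k -> {poly A}) j0 h :
  f j0 = h * fcharp a c n -> tensorf (p * \prod_j evX (f j) j) = 0.
Proof.
move=> fj0; rewrite [p]mpolyE mulr_suml linear_sum big1 // => m _.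
rewrite -scalerAl linearZ /= (_ : _ * _ = \prod_j evX ('X^(m j) * f j) j).
  by rewrite tensorf_prod (bigD1 j0) //= fj0 mulrA coordf_fcharp mul0r mulr0.
rewrite mpolyXE_id -big_split; apply: eq_bigr => j _ /=.
by rewrite rmorphM hornerM /= map_polyXn hornerXn.
Qed.

Lemma det_evX (G : 'I_k -> {poly A}) :
  \det (\matrix_(i, j) evX (G i) j)
    = \sum_(s : 'S_k) (-1) ^+ s * \prod_j evX (G (s j)) j.
Proof.
rewrite -det_tr; apply: eq_bigr => s _; congr (_ * _).
by apply: eq_bigr => j _; rewrite !mxE.
Qed.

Lemma tensorf_det (G : 'I_k -> {poly A}) :
  tensorf (\det (\matrix_(i, j) evX (G i) j)) = \det (\matrix_(i, j) coordf j (G i)).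
Proof.
rewrite det_evX linear_sum -det_tr; apply: eq_bigr => s _.
have -> : (-1) ^+ s = ((-1) ^+ s)%:MP :> {mpoly A[k]}.
  by rewrite rmorphXn rmorphN1.
rewrite mul_mpolyC linearZ /= tensorf_prod; congr (_ * _).
by apply: eq_bigr => j _; rewrite !mxE.
Qed.

Lemma tensorf_det_kill p (G : 'I_k -> {poly A}) i0 h :
  G i0 = h * fcharp a c n -> tensorf (p * \det (\matrix_(i, j) evX (G i) j)) = 0.
Proof.
move=> Gi0; rewrite det_evX mulr_sumr linear_sum big1 // => s _; rewrite mulrA.
by apply: (@tensorf_kill _ (fun j => G (s j)) ((s^-1)%g i0) h); rewrite permKV.
Qed.

End TensorFunctional.

Section Independence.
Variables n' k : nat.
Local Notation n := n'.+1.
Hypothesis k_gt0 : (0 < k)%N.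
Hypothesis lt_kn : (k < n)%N.
Local Notation A := (Rq n).
Local Notation Rx := {mpoly A[k]}.
Local Notation aQ := (fun l => lconst (yvar n l.+1) : A).
(* With these coordinates [fcharp] is [(t|y)^n + (-1)^k q]. *)
Let cQ (j : nat) : A := if j == 0%N then (-1) ^+ k * lq else 0.
Local Notation P := (fcharp aQ cQ n).
Local Notation evX f j := ((map_poly (@mpolyC k A) f).['X_j]).

Let PE : P = fpow aQ n + ((-1) ^+ k * lq)%:P.
Proof.
rewrite /fcharp big_ord_recl /= /cQ eqxx fpow0 -mul_polyC mulr1 big1 ?addr0 // => j _.
by rewrite scale0r.
Qed.

Lemma schur_evX la : val (sympoly_schur n k la) * vandermonde A k
  = \det (\matrix_(i < k, j < k) evX (fpow aQ (nth 0%N la i + (k - i.+1))) j).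
Proof.
rewrite schur_vandermonde; congr (\det _); apply/matrixP => i j.
by rewrite !mxE map_fpow.
Qed.

(** The parameters of index greater than [n] vanish. *)
Lemma fpow_addn i : fpow aQ (n + i) = fpow aQ n * 'X^i.
Proof.
elim: i => [|i IHi]; first by rewrite addn0 mulr1.
rewrite addnS fpowS IHi exprSr mulrA; congr (_ * _).
rewrite /= insubF ?rmorph0 ?subr0 //.
by rewrite ltnNge leq_addr.
Qed.

(** The numerator of the [i]-th relation has a multiple of
    [P = (t|y)^n + (-1)^k q] as its first row: the powers of the variable of
    degree at most [k - 2] lie in the span of the other rows, so the term with
    [q] only contributes to the last relation. *)
Lemma rel_evX i : (i < k)%N -> val (qrels n k)`_i * vandermonde A k
  = \det (\matrix_(r < k, j < k)
      evX (if r == 0%N :> nat then 'X^i * P else fpow aQ (k - r.+1)) j).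
Proof.
move=> lt_ik; pose i0 := Ordinal k_gt0.
pose M F : 'M[Rx]_k := \matrix_(r, j)
  evX (if r == 0%N :> nat then F else fpow aQ (k - r.+1)) j.
have detM d : (d < k)%N -> \det (M 'X^d) = (d == k.-1)%:R * vandermonde A k.
  move=> lt_dk.
  pose F (r : 'I_k) : {poly Rx} :=
    map_poly (@mpolyC k A) (if r == 0%N :> nat then 'X^d else fpow aQ (k - r.+1)).
  have prodF : \prod_r (F r)`_(k - r.+1) = (d == k.-1)%:R.
    rewrite (bigD1 i0 isT) big1; last first.
      move=> r /andP[_ ri0].
      have r0 : (r == 0%N :> nat) = false by apply/negbTE; rewrite -val_eqE in ri0.
      rewrite /F r0 map_fpow.
      have /monicP := monic_fpow ((@mpolyC k A) \o aQ) (k - r.+1).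
      by rewrite lead_coefE size_fpow.
    apply: etrans (mulr1 _) _.
    by rewrite /F eqxx map_polyXn coefXn subn1 eq_sym.
  rewrite -prodF; apply: (det_horner_trig (F := F) (fun j => 'X_j)) => r.
  rewrite /F; case: ifP => [/eqP -> |_].
    by rewrite map_polyXn size_polyXn subn0.
  by rewrite map_fpow size_fpow subnSK.
have detM_row F G b : \det (M (F + b *: G)) = \det (M F) + b%:MP * \det (M G).
  rewrite -[\det (M F)]mul1r; apply: (@determinant_multilinear _ _ _ _ _ i0).
  - rewrite scale1r; apply/rowP => j; rewrite !mxE eqxx rmorphD /= hornerD.
    by rewrite map_polyZ hornerZ.
  - apply/row_matrixP => r; apply/rowP => j; rewrite !mxE.
    by have -> : (lift i0 r == 0%N :> nat) = false by [].
  - apply/row_matrixP => r; apply/rowP => j; rewrite !mxE.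
    by have -> : (lift i0 r == 0%N :> nat) = false by [].
have -> : 'X^i * P = fpow aQ (n + i) + ((-1) ^+ k * lq) *: 'X^i.
  by rewrite PE mulrDr fpow_addn mulrC [X in _ + X]mulrC mul_polyC.
rewrite [RHS]detM_row detM //.
have -> : \det (M (fpow aQ (n + i)))
    = val (sympoly_schur n k [:: (n - k + i).+1]) * vandermonde A k.
  rewrite schur_evX; congr (\det _); apply/matrixP => r j; rewrite !mxE.
  have nth_r : nth 0%N [:: (n - k + i).+1] r = if r == 0%N :> nat then (n - k + i).+1 else 0%N.
    by case: (nat_of_ord r) => // r'; rewrite /= nth_nil.
  rewrite nth_r; case: eqP => [-> | _]; last by rewrite add0n.
  by congr (map_poly _ (fpow _ _)).[_]; lia.
rewrite mulrA -mulrDl; congr (_ * _).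
rewrite /qrels nth_rcons size_map size_iota; case: ltnP => [lt_ik1|le_ki].
  rewrite (nth_map 0%N) ?size_iota // nth_iota //.
  have -> : (i == k.-1) = false by lia.
  by rewrite mulr0 addr0; congr (val (sympoly_schur _ _ [:: _])); lia.
have ik : i = k.-1 by lia.
rewrite ik subn1 eqxx.
rewrite [X in _ = _ + X]mulr1.
rewrite [LHS]rmorphD.
have -> : (n - k + k.-1).+1 = n by lia.
apply: (congr2 +%R) => //.
Qed.

Local Notation widen := (widen_ord (ltnW lt_kn)).

Lemma det_perm_pattern (w w0 : 'S_n) :
    w \in grassmannian n k -> w0 \in grassmannian n k ->
  \det (\matrix_(i < k, j < k) (w0 (widen j) == w (widen i))%:R) = (w == w0)%:R :> A.
Proof.
move=> grass_w grass_w0; have [-> | ww0] := eqVneq w w0.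
  rewrite -[RHS](det1 A k); congr (\det _); apply/matrixP => i j.
  by rewrite !mxE (inj_eq perm_inj) -!val_eqE eq_sym.
have supp_neq : ~~ (perm_supp k w \subset perm_supp k w0).
  apply: contra ww0 => sub; apply/eqP/(perm_supp_inj (k := k)) => //.
  by apply/eqP; rewrite eqEcard sub !card_perm_supp ?leqnn // ltnW.
case/subsetPn: supp_neq => _ /imsetP[i ik ->] wi; rewrite inE in ik.
rewrite (expand_det_row _ (Ordinal ik)) big1 // => j _.
rewrite mxE; case: eqP => [wE|]; last by rewrite mul0r.
case/negP: wi; rewrite (_ : i = widen (Ordinal ik)); last exact: val_inj.
by rewrite -wE mem_perm_supp /=.
Qed.

(** The functional that reads the coordinates listed by [w0] kills the multiples
    of the Vandermonde product by relations, and takes the value 1 at the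
    numerator of the Schubert polynomial of [w0] and 0 at the others. *)
Lemma to_qH_eq0 (u : ext n) : ext_deg k u -> to_qH k u = 0 -> u = 0.
Proof.
move=> deg_u u0; pose f : sympoly n k := \sum_(w in grassmannian n k)
  sympolyC k (u (perm_supp k w)) * sympoly_schur n k (perm_part k w).
have : f \in @qideal n k.
  rewrite -[f]subr0; apply/qclassP; rewrite rmorph0 -u0 rmorph_sum.
  by apply: eq_bigr => w _; rewrite rmorphM.
case/qidealP => b fE.
have coord0 (w0 : 'S_n) : w0 \in grassmannian n k -> u (perm_supp k w0) = 0.
  move=> grass_w0.
  pose L := @tensorf n' k A aQ cQ (fun j => w0 (widen (rev_ord j))).
  have : L (val f * vandermonde A k) = 0.
    rewrite fE rmorph_sum mulr_suml /L linear_sum big1 // => i _.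
    rewrite rmorphM -mulrA rel_evX; last first.
      have size_rels : size (qrels n k) = k.
        by rewrite size_rcons size_map size_iota; lia.
      by rewrite -[X in (_ < X)%N]size_rels.
    by apply: (@tensorf_det_kill _ _ _ _ _ _ _ _ (Ordinal k_gt0) 'X^i); rewrite eqxx.
  rewrite rmorph_sum mulr_suml /L linear_sum.
  have termE (w : 'S_n) : w \in grassmannian n k ->
      L (val (sympolyC k (u (perm_supp k w)) * sympoly_schur n k (perm_part k w))
         * vandermonde A k) = u (perm_supp k w) * (w == w0)%:R.
    move=> grass_w; rewrite rmorphM -mulrA schur_evX.
    transitivity (L (u (perm_supp k w) *: \det (\matrix_(i < k, j < k)
        evX (fpow aQ (nth 0%N (perm_part k w) i + (k - i.+1))) j))).
      by congr (L _); apply: mul_mpolyC.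
    pose G (i : 'I_k) := fpow aQ (nth 0%N (perm_part k w) i + (k - i.+1)).
    rewrite /L.
    rewrite tensorfZ.
    rewrite (tensorf_det aQ cQ _ G).
    congr (_ * _).
    rewrite -(det_perm_pattern grass_w grass_w0).
    rewrite -[RHS]det_rev.
    congr (\det _); apply/matrixP => i j; rewrite !mxE.
    have GE : G i = fpow aQ (w (widen (rev_ord i))).
      rewrite /G -(nth_perm_partD (ltnW lt_kn) grass_w (rev_ord i)) rev_ordK.
      by congr (fpow _ (_ + _)); rewrite /= subnSK // subKn // ltnW.
    by rewrite GE coordf_fpow frow_lt // mxE -val_eqE.
  rewrite (eq_bigr _ termE) (bigD1 w0) // eqxx mulr1 big1; last first.
    by move=> w /andP[_ /negPf ->]; rewrite mulr0.
  by move=> u_w0; apply: etrans u_w0; apply/esym/addr0.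
apply/ffunP => S; rewrite ffunE; have [Sk | /eqP Sk] := eqVneq #|S| k; last first.
  by apply: deg_u; apply/eqP.
by rewrite -(grass_permK (ltnW lt_kn) Sk) coord0 // grass_perm_grass.
Qed.

End Independence.

(** * Laurent polynomials, the twist and Graham positivity *)

Module LaurentTheory.
Import monalg.
Section LaurentTheory.
Variable A : comNzRingType.
Local Notation L := (laurent A).
Implicit Types (f g : L) (d e : int) (c : A).
Local Notation lmonom := (@Laurent.lmonom A).

Lemma lcoef_is_zmod d : zmod_morphism (@lcoef A d).
Proof. exact: mcoeffB. Qed.

HB.instance Definition _ d := GRing.isZmodMorphism.Build L A (@lcoef A d) (lcoef_is_zmod d).

Lemma lcoef_monom d c e : lcoef d (lmonom c e) = c *+ (e == d).
Proof. exact: mcoeffU. Qed.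

Lemma laurentP f g : (forall d, lcoef d f = lcoef d g) -> f = g.
Proof. by move=> fg; apply/malgP. Qed.

Lemma lmulE f g :
  f * g = \sum_(d <- msupp f) \sum_(e <- msupp g) lmonom (lcoef d f * lcoef e g) (d + e).
Proof. by []. Qed.

Lemma laurentE f : f = \sum_(d <- msupp f) lmonom (lcoef d f) d.
Proof. exact: monalgE. Qed.

Lemma lmonomM c1 d1 c2 d2 : lmonom c1 d1 * lmonom c2 d2 = lmonom (c1 * c2) (d1 + d2).
Proof.
have lmonom0 d : lmonom 0 d = 0 by apply: monalgU0.
have [-> | c1_neq0] := eqVneq c1 0; first by rewrite !(mul0r, lmonom0).
have [-> | c2_neq0] := eqVneq c2 0; first by rewrite !(mulr0, lmonom0).
rewrite lmulE /Laurent.lmonom !msuppU (negPf c1_neq0) (negPf c2_neq0).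
by rewrite !big_seq_fset1 !lcoef_monom !eqxx.
Qed.

Section Map.
Variable phi : {rmorphism A -> A}.

Lemma lcoef_lmap d f : lcoef d (lmap phi f) = phi (lcoef d f).
Proof.
rewrite [in RHS](laurentE f) /Laurent.lmap !raddf_sum; apply: eq_bigr => e _.
by rewrite /= !lcoef_monom raddfMn.
Qed.

Lemma lmap_is_zmod : zmod_morphism (lmap phi).
Proof.
by move=> f g; apply: laurentP => d; rewrite raddfB /= !lcoef_lmap !raddfB.
Qed.

HB.instance Definition _ := GRing.isZmodMorphism.Build L L (lmap phi) lmap_is_zmod.

Lemma lmap_monom c d : lmap phi (lmonom c d) = lmonom (phi c) d.
Proof. by apply: laurentP => e; rewrite lcoef_lmap !lcoef_monom rmorphMn. Qed.

Lemma lmap_is_monoid : monoid_morphism (lmap phi).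
Proof.
split=> [|f g]; first by rewrite [1]/(lmonom 1 0) lmap_monom rmorph1.
rewrite (laurentE f) mulr_suml !raddf_sum mulr_suml; apply: eq_bigr => d _ /=.
rewrite (laurentE g) mulr_sumr !raddf_sum mulr_sumr; apply: eq_bigr => e _ /=.
by rewrite !(lmonomM, lmap_monom) rmorphM.
Qed.

HB.instance Definition _ := GRing.isMonoidMorphism.Build L L (lmap phi) lmap_is_monoid.

Lemma lmap_const c : lmap phi (lconst c) = lconst (phi c).
Proof. exact: lmap_monom. Qed.

Lemma lmap_q : lmap phi lq = lq.
Proof. by rewrite /lq lmap_monom rmorph1. Qed.

End Map.
End LaurentTheory.
End LaurentTheory.
Import LaurentTheory.

Section Twist.
Variable n : nat.

Definition ytwist : n.-tuple {mpoly int[n]} := [tuple - 'X_(rev_ord i) | i < n].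

HB.instance Definition _ := GRing.RMorphism.copy (@twist n) (lmap (comp_mpoly ytwist)).

Lemma yvar_ord (i : 'I_n) : yvar n i.+1 = 'X_i.
Proof. by rewrite /yvar valK. Qed.

Lemma yvar_gt j : (n < j)%N -> yvar n j = 0.
Proof. by case: j => // j lt_nj; rewrite /= insubF // ltnNge -ltnS lt_nj. Qed.

Lemma comp_ytwist l : yvar n l.+1 \mPo ytwist = - yvar n (n - l).
Proof.
have [lt_ln | le_nl] := ltnP l n; last first.
  by rewrite yvar_gt // comp_mpoly0 (eqP le_nl) oppr0.
rewrite (yvar_ord (Ordinal lt_ln)) comp_mpolyXU -tnth_nth tnth_mktuple.
by rewrite -yvar_ord -[in RHS](subnSK lt_ln).
Qed.

Lemma twist_y l : twist (lconst (yvar n l.+1)) = lconst (- yvar n (n - l)).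
Proof. by rewrite -comp_ytwist -lmap_const. Qed.

Lemma twist_q : twist lq = lq :> Rq n.
Proof. exact: lmap_q. Qed.

Lemma lcoef_twist d (f : Rq n) : lcoef d (twist f) = lcoef d f \mPo ytwist.
Proof. exact: lcoef_lmap. Qed.

End Twist.

Section GrahamPositivity.
Variable n : nat.
Implicit Types f g : {mpoly int[n]}.
Local Notation ydiff := [tuple yvar n i.+2 - yvar n i.+1 | i < n.-1].

Lemma graham0 : graham_positive (0 : {mpoly int[n]}).
Proof. by exists 0; split=> [m|]; rewrite ?mcoeff0 ?comp_mpoly0. Qed.

Lemma graham1 : graham_positive (1 : {mpoly int[n]}).
Proof. by exists 1; split=> [m|]; rewrite ?mcoeff1 ?ler0n ?comp_mpoly1. Qed.

Lemma grahamD f g : graham_positive f -> graham_positive g -> graham_positive (f + g).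
Proof.
move=> [p [p_ge0 ->]] [q [q_ge0 ->]]; exists (p + q); split=> [m|].
  by rewrite mcoeffD addr_ge0.
by rewrite comp_mpolyD.
Qed.

Lemma grahamM f g : graham_positive f -> graham_positive g -> graham_positive (f * g).
Proof.
move=> [p [p_ge0 ->]] [q [q_ge0 ->]]; exists (p * q); split=> [m|].
  by rewrite mcoeffM sumr_ge0 // => i _; rewrite mulr_ge0.
by rewrite rmorphM.
Qed.

Lemma graham_sum (I : Type) (r : seq I) (P : pred I) (F : I -> {mpoly int[n]}) :
  (forall i, P i -> graham_positive (F i)) -> graham_positive (\sum_(i <- r | P i) F i).
Proof. by move=> posF; elim/big_ind: _ => //; [exact: graham0 | exact: grahamD]. Qed.

Lemma graham_yvarB i j : (0 < i <= j)%N -> (j <= n)%N ->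
  graham_positive (yvar n j - yvar n i).
Proof.
case/andP=> i_gt0 /subnK <-; elim: (j - i)%N => [|d IHd] le_n.
  by rewrite add0n subrr; apply: graham0.
rewrite addSn -(subrK (yvar n (d + i)) (yvar n _)) -addrA.
apply: grahamD; last exact/IHd/ltnW.
case: i i_gt0 {IHd} le_n => // i _; rewrite ?addSn !addnS => lt_n.
have lt_n1 : (d + i < n.-1)%N by rewrite -ltnS prednK // (leq_trans _ lt_n).
exists 'X_(Ordinal lt_n1); split=> [m|]; first by rewrite mcoeffX ler0n.
by rewrite comp_mpolyXU -tnth_nth tnth_mktuple.
Qed.

(** Substituting Graham positive polynomials into a polynomial with nonnegative
    coefficients only takes sums and products of them. *)
Lemma graham_comp m (p : {mpoly int[m]}) (s : m.-tuple {mpoly int[n]}) :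
    (forall l, 0 <= p@_l) -> (forall i, graham_positive (tnth s i)) ->
  graham_positive (p \mPo s).
Proof.
move=> p_ge0 pos_s; rewrite comp_mpolyE; apply: graham_sum => l _.
have -> : p@_l = `|p@_l|%N%:R by rewrite natz gez0_abs.
rewrite scaler_nat -mulr_natl; apply: grahamM.
  by elim: `|_|%N => [|e IHe]; [exact: graham0 | rewrite mulrS; exact: (grahamD graham1)].
elim/big_ind: _ => [||i _]; [exact: graham1 | exact: grahamM | ].
by elim: (l i) => [|e IHe]; [exact: graham1 | rewrite exprS; exact: grahamM].
Qed.

(** The substitution [y_i -> - y_(n+1-i)] permutes the differences
    [y_(i+1) - y_i]. *)
Lemma graham_twist f : graham_positive f -> graham_positive (f \mPo ytwist n).
Proof.
move=> [p [p_ge0 ->]].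
have -> : (p \mPo ydiff) \mPo ytwist n =
    p \mPo [tuple tnth ydiff i \mPo ytwist n | i < n.-1].
  rewrite [p \mPo ydiff]comp_mpolyE [RHS]comp_mpolyE raddf_sum; apply: eq_bigr => m _ /=.
  rewrite comp_mpolyZ rmorph_prod; congr (_ *: _); apply: eq_bigr => i _.
  by rewrite rmorphXn /= !tnth_mktuple.
apply: graham_comp => // i; rewrite !tnth_mktuple comp_mpolyB !comp_ytwist.
rewrite opprK addrC; apply: graham_yvarB; have := ltn_ord i; lia.
Qed.

Definition lpos (f : Rq n) : Prop := forall d, graham_positive (lcoef d f).

Lemma lpos0 : lpos 0.
Proof. by move=> d; rewrite raddf0; apply: graham0. Qed.

Lemma lposD (f g : Rq n) : lpos f -> lpos g -> lpos (f + g).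
Proof. by move=> pf pg d; rewrite raddfD; apply: grahamD; [apply: pf | apply: pg]. Qed.

Lemma lpos_monom c d : graham_positive c -> lpos (Laurent.lmonom c d).
Proof. by move=> pc e; rewrite lcoef_monom; case: eqP => _; rewrite ?mulr1n //; apply: graham0. Qed.

Lemma lposM (f g : Rq n) : lpos f -> lpos g -> lpos (f * g).
Proof.
move=> pf pg d; rewrite lmulE raddf_sum; apply: graham_sum => i _ /=.
by rewrite raddf_sum; apply: graham_sum => j _; apply/lpos_monom/grahamM; [apply: pf | apply: pg].
Qed.

Lemma lpos1 : lpos 1.
Proof. exact/lpos_monom/graham1. Qed.

Lemma lpos_const c : graham_positive c -> lpos (lconst c).
Proof. exact: lpos_monom. Qed.

Lemma lpos_q : lpos lq.
Proof. exact/lpos_monom/graham1. Qed.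

Lemma lpos_twist (f : Rq n) : lpos f -> lpos (twist f).
Proof. by move=> pf d; rewrite lcoef_twist; apply/graham_twist/pf. Qed.

End GrahamPositivity.

Lemma t_index_leq k (I : {set 'I_k}) i : i \in I -> (i.+1 - rank_in I i <= i)%N.
Proof.
move=> iI; rewrite leq_subLR -add1n leq_add2r /rank_in card_gt0.
by apply/set0Pn; exists i; rewrite inE iI leqnn.
Qed.

Section PieriPositivity.
Variables (n k : nat) (w : 'S_n).
Hypothesis lt_kn : (k < n)%N.
Hypothesis grass_w : w \in grassmannian n k.
Implicit Types u v : ext n.

(** The value of [w] at [j], and [n] from [k] on: the vectors of index at least
    [j] in a Pieri term lie weakly beyond it, apart from a wrapped [v_1]. *)
Definition wbound j : nat :=
  if (insub j : option 'I_n) is Some i then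
    (if (j < k)%N then nat_of_ord (w i) else n)
  else n.

(** The invariant when the factors of index at least [j] have been wedged. A
    wrapped last factor brings in [(-1)^(k-1) q v_1]; each of the [k - 1 - j]
    later factors passes before [v_1], and the [j] remaining ones will cancel
    the sign [(-1)^j] that is left. *)
Definition pieri_pos j u : Prop := forall S : {set 'I_n},
  lpos ((-1) ^+ (j * [exists i in S, i == 0%N :> nat]) * u S) /\
  (u S != 0 -> forall i, i \in S -> (i == 0%N :> nat) || (wbound j <= i)%N).

Lemma pieri_posD j u v : pieri_pos j u -> pieri_pos j v -> pieri_pos j (u + v).
Proof.
move=> pu pv S; have [pu1 pu2] := pu S; have [pv1 pv2] := pv S; split.
  by rewrite ffunE mulrDr; apply: (lposD pu1 pv1).
rewrite ffunE; have [-> | uS] := eqVneq (u S) 0; first by rewrite add0r.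
by move=> _; apply: pu2.
Qed.

Lemma pieri_posZ j c u : lpos c -> pieri_pos j u -> pieri_pos j (c *: u).
Proof.
move=> pc pu S; have [pu1 pu2] := pu S; split.
  rewrite ffunE (_ : _ * _ = c * ((-1) ^+ (j * [exists i in S, i == 0%N :> nat]) * u S)).
    exact: lposM pc pu1.
  exact: mulrCA.
rewrite ffunE; have [-> | uS] := eqVneq (u S) 0; first by rewrite scaler0 eqxx.
by move=> _; apply: pu2.
Qed.

Lemma pieri_pos1 : pieri_pos k (ext1 n).
Proof.
move=> S; rewrite ffunE; case: eqP => [-> | _].
  split; last by move=> _ i; rewrite inE.
  rewrite (_ : [exists i in _, _] = false) ?muln0 ?mulr1; first exact: lpos1.
  by apply/existsP => -[i]; rewrite inE.
by split; rewrite ?mulr0 ?eqxx //; apply: lpos0.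
Qed.

Lemma wbound_lt j (lt_jn : (j < n)%N) : (j < k)%N -> wbound j = w (Ordinal lt_jn).
Proof. by rewrite /wbound insubT => ->. Qed.

Lemma wbound_k : wbound k = n.
Proof. by rewrite /wbound ltnn; case: insub. Qed.

Lemma wbound_incr j : (j < k)%N -> (wbound j < wbound j.+1)%N.
Proof.
move=> lt_jk; have lt_j1n := leq_ltn_trans lt_jk lt_kn.
rewrite (wbound_lt (ltnW lt_j1n)) //.
have := lt_jk; rewrite leq_eqVlt => /predU1P[jk|lt_j1k].
  by rewrite [X in (_ < X)%N](_ : _ = n) // -wbound_k jk.
by rewrite (wbound_lt lt_j1n) //; move/grassP: grass_w; apply=> //=; rewrite lt_j1k.
Qed.

Lemma leq_wbound j : (j < k)%N -> (j <= wbound j)%N.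
Proof.
move=> lt_jk; rewrite (wbound_lt (ltn_trans lt_jk lt_kn)) //.
exact: (grass_ge grass_w (i := Ordinal (ltn_trans lt_jk lt_kn))).
Qed.

Lemma pieri_pos_wedge j (y : 'I_n) u : (j < k)%N ->
    (wbound j <= y <= wbound j.+1)%N -> pieri_pos j.+1 u -> pieri_pos j (wedge y u).
Proof.
move=> lt_jk /andP[ge_y le_y] pu S; have [pu1 pu2] := pu (S :\ y).
rewrite ffunE; case: ifP => yS; last first.
  by rewrite mulr0 eqxx; split=> //; apply: lpos0.
have [u0 | u_neq0] := eqVneq (u (S :\ y)) 0.
  by rewrite u0 !mulr0 eqxx; split=> //; apply: lpos0.
have below_y i : i \in S -> (i < y)%N -> i = 0%N :> nat.
  move=> iS iy; have /orP[/eqP //|] : (i == 0%N :> nat) || (wbound j.+1 <= i)%N.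
    by apply: pu2; rewrite // !inE iS andbT -val_eqE ltn_eqF.
  by move/(leq_trans le_y); rewrite leqNgt iy.
split; last first.
  move=> _ i iS; have [-> | iy] := eqVneq i y; first by rewrite ge_y orbT.
  have /orP[-> //|] : (i == 0%N :> nat) || (wbound j.+1 <= i)%N.
    by apply: pu2; rewrite // !inE iy.
  by move=> le_i; rewrite (leq_trans _ le_i) ?orbT // ltnW // wbound_incr.
have [y0 | y_gt0] := posnP y.
  have j0 : j = 0%N.
    by apply/eqP; rewrite -leqn0 -[X in (_ <= X)%N]y0 (leq_trans (leq_wbound lt_jk)).
  have -> : [set l in S | (l < y)%N] = set0 by apply/setP => l; rewrite !inE y0 andbF.
  rewrite cards0 j0 mul0n !mul1r; move: pu1.
  rewrite (_ : [exists i in S :\ y, _] = false) ?muln0 ?mul1r //.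
  apply/existsP => -[i /andP[]]; rewrite !inE => /andP[iy _] /eqP i0.
  by case/eqP: iy; apply: val_inj; rewrite /= i0.
have -> : [exists i in S, i == 0%N :> nat] = [exists i in S :\ y, i == 0%N :> nat].
  apply/existsP/existsP => -[i /andP[iS i0]]; exists i; rewrite i0 andbT ?inE.
    by rewrite iS andbT -val_eqE /= (eqP i0) ltn_eqF.
  by move: iS; rewrite !inE => /andP[].
set e := [exists i in _, _] in pu1 *.
suff -> : #|[set l in S | (l < y)%N]| = e by rewrite mulrA -exprD addnC -mulSn.
case: (boolP e) => [/existsP[i0 /andP[i0S /eqP i00]] | /existsPn no0].
  apply/eqP/cards1P; exists i0; apply/setP => l; rewrite !inE.
  apply/andP/eqP => [[lS ly]|->]; first by apply: val_inj; rewrite /= i00 below_y.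
  by rewrite i00 y_gt0; move: i0S; rewrite !inE => /andP[].
apply/eqP; rewrite cards_eq0; apply/eqP/setP => l; rewrite !inE.
apply/andP => -[lS ly]; have := no0 l; rewrite !inE lS andbT below_y // eqxx andbT.
by rewrite -val_eqE /= below_y // ltn_eqF.
Qed.

Lemma pieri_pos_wrap u : (0 < k)%N ->
  pieri_pos k u -> pieri_pos k.-1 (psi k n.+1 u).
Proof.
move=> k_gt0 pu S; have n_gt0 : (0 < n)%N := leq_ltn_trans (leq0n k) lt_kn.
pose y := Ordinal n_gt0.
have -> : psi k n.+1 u = ((-1) ^+ (k - 1) * lq) *: wedge y u.
  by rewrite /psi eqxx /= insubT.
rewrite !ffunE; have [pu1 pu2] := pu (S :\ y); case: ifP => yS; last first.
  by rewrite scaler0 mulr0 eqxx; split=> //; apply: lpos0.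
have -> : [set l in S | (l < y)%N] = set0 by apply/setP => l; rewrite !inE andbF.
have -> : [exists i in S, i == 0%N :> nat] by apply/existsP; exists y; rewrite yS.
rewrite cards0 mul1r muln1; split.
  rewrite (_ : _ * _ = lq * u (S :\ y)); last first.
    rewrite -[_ *: _]/(_ * _) !mulrA -exprD subn1 addnn -signr_odd odd_double.
    by rewrite mul1r.
  apply: lposM; first exact: lpos_q.
  move: pu1; rewrite (_ : [exists i in S :\ y, _] = false) ?muln0 ?mul1r //.
  apply/existsP => -[i /andP[]]; rewrite !inE => /andP[iy _] /eqP i0.
  by case/eqP: iy; apply: val_inj.
have [-> | u_neq0] := eqVneq (u (S :\ y)) 0; first by rewrite scaler0 eqxx.
move=> _ i iS; have [-> // | iy] := eqVneq i y.
have : (i == 0%N :> nat) || (wbound k <= i)%N by apply: pu2; rewrite // !inE iy.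
by rewrite wbound_k leqNgt ltn_ord orbF => ->.
Qed.

Lemma pieri_pos_term (I : {set 'I_k}) : pieri_pos 0 (pieri_term w I).
Proof.
pose op (i : 'I_k) u := if i \in I then tpsi k (t_index I i) (oneline w i.+1) u
  else psi k (oneline w i.+1) u.
suff drop_pos d : (d <= k)%N ->
    pieri_pos (k - d) (foldr op (ext1 n) (drop (k - d) (enum 'I_k))).
  by have := drop_pos k (leqnn k); rewrite subnn drop0.
elim: d => [|d IHd] lt_dk.
  by rewrite subn0 drop_oversize ?size_enum_ord //; apply: pieri_pos1.
have lt_j : (k - d.+1 < k)%N by rewrite ltn_subrL (leq_trans _ lt_dk).
have := IHd (ltnW lt_dk); rewrite -(subnSK lt_dk); move: {IHd}lt_j.
move: (k - d.+1)%N => j lt_jk pu.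
pose i := Ordinal lt_jk.
rewrite (drop_nth i) ?size_enum_ord // (nth_ord_enum i i) /=.
move: (foldr op (ext1 n) _) pu => u pu.
have lt_jn := ltn_trans lt_jk lt_kn.
have wE : oneline w i.+1 = (w (Ordinal lt_jn)).+1 by rewrite -(oneline_ord w (Ordinal lt_jn)).
have bE := wbound_lt lt_jn lt_jk.
have psi_pos : pieri_pos j (psi k (oneline w i.+1) u).
  rewrite wE /psi eqSS ltn_eqF // valK /=; apply: pieri_pos_wedge => //.
  by rewrite bE leqnn -bE ltnW // wbound_incr.
rewrite /op; case: ifP => // iI; apply: pieri_posD; last first.
  apply: (pieri_posZ _ psi_pos); apply/lpos_const/graham_yvarB; rewrite wE //.
  rewrite /t_index addn1 /= ltnS (leq_trans (t_index_leq iI)) // -bE.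
  exact: leq_wbound.
rewrite wE; have [wn | w_neq] := eqVneq (w (Ordinal lt_jn)).+1 n.
  have jk : j.+1 = k.
    apply/eqP; rewrite eqn_leq lt_jk leqNgt; apply/negP => lt_j1k.
    have := wbound_incr lt_jk; rewrite bE (wbound_lt (ltn_trans lt_j1k lt_kn)) //.
    by rewrite wn leqNgt ltn_ord.
  have {1}-> : j = k.-1 by rewrite -jk.
  rewrite wn; apply: pieri_pos_wrap; first exact: (leq_ltn_trans (leq0n j) lt_jk).
  by rewrite -[X in pieri_pos X _]jk.
have lt_wn : ((w (Ordinal lt_jn)).+1 < n)%N by rewrite ltn_neqAle w_neq ltn_ord.
rewrite /psi eqSS ltn_eqF // insubT /=; apply: (pieri_pos_wedge lt_jk _ pu) => /=.
by rewrite bE leqnSn -bE wbound_incr.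
Qed.

Lemma lpos_pieri_term (I : {set 'I_k}) S : lpos (pieri_term w I S).
Proof. by have [+ _] := pieri_pos_term I S; rewrite mul0n mul1r. Qed.


End PieriPositivity.

(** * Complementary minors and conjugate partitions *)

Section GrassmannianCounts.
Variables (n m : nat) (w : 'S_n).
Hypothesis le_mn : (m <= n)%N.
Hypothesis grass_w : w \in grassmannian n m.
Implicit Types i j l : 'I_n.

Lemma grass_mono i j : ((i < m) == (j < m))%N -> (w i < w j)%N = (i < j)%N.
Proof.
move/grassP: grass_w => w_incr ij; have [lt_ij|lt_ji|/val_inj ->] := ltngtP i j.
- by rewrite w_incr //; case: ltnP ij => //= _; case: ltnP.
- apply/negbTE; rewrite -leqNgt ltnW // w_incr //.
  by case: ltnP ij => //= _; case: ltnP.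
- by rewrite ltnn.
Qed.

Lemma sum_ord_lt (P : pred 'I_n) d : (forall i, P i = (i < d)%N) -> (d <= n)%N ->
  (\sum_(i < n) P i = d)%N.
Proof.
move=> PE le_dn; under eq_bigr do rewrite PE.
rewrite -big_mkcond /= -(big_ord_widen n (fun=> 1%N)) // sum1_card card_ord //.
Qed.

Lemma sum_perm_lt l : (\sum_(i < n) (w i < w l) = w l)%N.
Proof.
rewrite (reindex_inj (@perm_inj _ w^-1)) /=.
by apply: sum_ord_lt => [i|]; rewrite ?permKV // ltnW.
Qed.

(** Among the values smaller than [w l], those at positions before [m] are the
    [l] preceding ones. *)
Lemma inversions_row l : (l < m)%N ->
  (\sum_(i < n | (m <= i)%N) (w i < w l) + l = w l)%N.
Proof.
move=> lm; rewrite -[RHS]sum_perm_lt [RHS](bigID (fun i => (m <= i)%N)) /=.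
congr (_ + _)%N; rewrite big_mkcond /=.
rewrite (eq_bigr (fun i => ((i < m) && (w i < w l))%N : nat)) => [|i _]; last first.
  by rewrite -ltnNge; case: ltnP.
apply/esym; apply: sum_ord_lt => [i|]; last by rewrite ltnW.
have [im|mi] := ltnP i m; first by rewrite grass_mono // im lm.
by apply/esym/negbTE; rewrite -leqNgt ltnW // (leq_trans lm).
Qed.

Lemma inversions_col l : (m <= l)%N ->
  (\sum_(i < n | (i < m)%N) (w i < w l) + (l - m) = w l)%N.
Proof.
move=> ml; rewrite -[RHS]sum_perm_lt [RHS](bigID (fun i : 'I_n => (i < m)%N)) /=.
congr (_ + _)%N; apply/eqP; rewrite -(eqn_add2l m); apply/eqP.
rewrite subnKC // -[X in _ = (X + _)%N](sum_ord_lt (P := fun i => (i < m)%N)) //.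
rewrite [X in _ = (_ + X)%N]big_mkcond.
rewrite -big_split /= (eq_bigr (fun i : 'I_n => (i < l)%N : nat)) => [|i _].
  by apply/esym; apply: sum_ord_lt => //; apply: ltnW.
have [im|mi] /= := ltnP i m; first by rewrite (leq_trans im ml).
by rewrite add0n grass_mono // !ltnNge mi ml.
Qed.

(** The sign of a permutation is read off the Vandermonde determinant at its
    values; the only negative differences come from the inversions. *)
Lemma grass_sign : odd_perm w = odd (\sum_(i < n | (i < m)%N) (w i + i)).
Proof.
pose V := Vandermonde n (\row_(j < n) (j%:Z)).
pose Vw := Vandermonde n (\row_(j < n) ((w j)%:Z)).
have detVw : \det Vw = (-1) ^+ w * \det V.
  rewrite mulrC -odd_permV -det_perm -det_mulmx -col_permE; congr (\det _).
  by apply/matrixP => i j; rewrite !mxE.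
have V_gt0 : 0 < \det V.
  rewrite det_Vandermonde; apply: prodr_gt0 => i _; apply: prodr_gt0 => j ij.
  by rewrite !mxE subr_gt0 ltz_nat.
pose inv := (\sum_(i < n | (i < m)%N) \sum_(j < n | (m <= j)%N) (w j < w i))%N.
have sgVw : Num.sg (\det Vw) = (-1) ^+ inv.
  rewrite det_Vandermonde (big_morph _ (@sgrM _) (@sgr1 _)).
  rewrite /inv (big_morph _ (@exprD _ (-1)) (expr0 _)) [RHS]big_mkcond.
  apply: eq_bigr => i _; rewrite (big_morph _ (@sgrM _) (@sgr1 _)).
  case: ifP => im.
    rewrite (big_morph _ (@exprD _ (-1)) (expr0 _)) [LHS]big_mkcond [RHS]big_mkcond.
    apply: eq_bigr => j _; rewrite !mxE.
    case: ltnP => [ij|ji]; last by rewrite leqNgt (leq_ltn_trans ji im).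
    case: (leqP m j) => [mj|jm].
      have [ji|ij'|/val_inj/perm_inj ji] := ltngtP (w j) (w i).
      - by rewrite /= expr1 ltr0_sg // subr_lt0 ltz_nat.
      - by rewrite /= expr0 gtr0_sg // subr_gt0 ltz_nat.
      - by rewrite ji ltnn in ij.
    by rewrite gtr0_sg // subr_gt0 ltz_nat grass_mono // im jm.
  rewrite big1 // => j ij; rewrite !mxE gtr0_sg // subr_gt0 ltz_nat grass_mono //.
  by rewrite im ltnNge (leq_trans _ (ltnW ij)) // leqNgt im.
have inv_odd : odd inv = odd (\sum_(i < n | (i < m)%N) (w i + i)).
  rewrite /inv !(big_morph odd oddD (erefl _)); apply: eq_bigr => i im.
  by rewrite -[X in _ = odd (X + _)](inversions_row im) -addnA addnn oddD odd_double addbF.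
move: sgVw; rewrite detVw sgrM (gtr0_sg V_gt0) mulr1 sgrX sgrN1 -[RHS]signr_odd inv_odd.
by case: (odd_perm w); case: (odd _).
Qed.

End GrassmannianCounts.

(** The matrix [M] of [N] completed by the unit columns outside the subset has,
    up to the sign of [w], the minor of [N] as its determinant. Clearing the
    lower rows of [N] by the unimodular matrix with lower block [(- N | 1)] turns
    it into the complementary minor of that block. *)
Lemma complementary_minors (B : comPzRingType) k m (N : 'M[B]_(k + m, k)) (w : 'S_(k + m)) :
    usubmx N = 1%:M ->
  (-1) ^+ w * \det (\matrix_(i, j) N (w (lshift m i)) j)
    = \det (\matrix_(i, j) (row_mx (- dsubmx N) 1%:M : 'M_(m, k + m)) i (w (rshift k j))).
Proof.
move=> N1; pose D : 'M[B]_(k + m, m) := \matrix_(r, j) (r == w (rshift k j))%:R.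
pose M := row_mx N D.
pose G := row_mx (- dsubmx N) 1%:M : 'M_(m, k + m).
have MU : col_mx (row_mx 1%:M 0) G *m M = block_mx 1%:M (usubmx D) 0
    (\matrix_(i, j) G i (w (rshift k j))).
  rewrite mul_col_row; congr (block_mx _ _ _ _).
  - by rewrite -[X in _ *m X]vsubmxK mul_row_col N1 mul1mx mul0mx addr0.
  - by rewrite -[D]vsubmxK mul_row_col mul1mx mul0mx addr0 vsubmxK.
  - by rewrite /G -[X in _ *m X]vsubmxK mul_row_col N1 mulmx1 mul1mx addNr.
  - apply/matrixP => i j; rewrite [LHS]mxE [RHS]mxE (bigD1 (w (rshift k j))) //=.
    rewrite [D _ _]mxE eqxx mulr1 big1 ?addr0 // => r /negPf rw.
    by rewrite [D _ _]mxE rw mulr0.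
have detM : \det M = \det (\matrix_(i, j) G i (w (rshift k j))).
  have := congr1 determinant MU.
  by rewrite det_mulmx -/(block_mx _ _ _ _) det_lblock det_ublock !det1 !mul1r.
rewrite -[RHS]detM.
have -> : \det M = (-1) ^+ w * \det (row_perm w M).
  by rewrite row_permE det_mulmx det_perm mulrA -signr_addb addbb mul1r.
congr (_ * _); rewrite (_ : row_perm w M = block_mx
  (\matrix_(i, j) N (w (lshift m i)) j) 0 (\matrix_(i, j) N (w (rshift k i)) j) 1%:M).
  by rewrite det_lblock det1 mulr1.
apply/matrixP => r c; rewrite [LHS]mxE.
case: (split_ordP r) => {}r ->; case: (split_ordP c) => {}c ->.
- by rewrite row_mxEl block_mxEul mxE.
- by rewrite row_mxEr block_mxEur !mxE (inj_eq perm_inj) eq_lrshift.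
- by rewrite row_mxEl block_mxEdl mxE.
- by rewrite row_mxEr block_mxEdr !mxE (inj_eq perm_inj) eq_rshift.
Qed.

Section RowCoordinates.
Variables (A : comNzRingType) (a c : nat -> A) (k : nat).
Hypothesis k_gt0 : (0 < k)%N.

Lemma mulfcomp_nat (r : nat -> A) (b : 'I_k) :
  ((\row_(i < k) r i) *m fcomp a c k) 0 b
    = r b.-1 *+ (0 < b)%N + a b * r b - c b * r k.-1.
Proof.
have lt_k : (k.-1 < k)%N by rewrite prednK.
rewrite mulfcompE mxE; congr (_ + _ - _ * _).
  have [b0 | b_gt0] := posnP b.
    by rewrite mulr0n big_pred0 // => i; rewrite b0.
  have lt_b : (b.-1 < k)%N by rewrite (leq_ltn_trans (leq_pred b)).
  rewrite (big_pred1 (Ordinal lt_b)) ?mxE // => i.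
  by rewrite /= -[RHS]val_eqE /= -[X in X == _](prednK b_gt0) eqSS eq_sym.
rewrite (big_pred1 (Ordinal lt_k)) ?mxE // => i.
by rewrite /= -[RHS]val_eqE /= -[X in _ == X](prednK k_gt0) eqSS.
Qed.

Definition rowcoord r j : A :=
  if insub j is Some l then frow a c k r 0 l else 0.

Lemma rowcoordE r (j : 'I_k) : rowcoord r j = frow a c k r 0 j.
Proof. by rewrite /rowcoord valK. Qed.

Lemma frow_rowcoord r : frow a c k r = \row_(j < k) rowcoord r j.
Proof. by apply/rowP => j; rewrite mxE rowcoordE. Qed.

Lemma rowcoordS r j : (j < k)%N -> rowcoord r.+1 j + a r * rowcoord r j =
  rowcoord r j.-1 *+ (0 < j)%N + a j * rowcoord r j + rowcoord k j * rowcoord r k.-1.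
Proof.
move=> lt_jk; have -> : rowcoord k j = - c j.
  by rewrite -[j]/(nat_of_ord (Ordinal lt_jk)) rowcoordE frow_top.
rewrite mulNr -(mulfcomp_nat (rowcoord r) (Ordinal lt_jk)) -frow_rowcoord frowT.
by rewrite [RHS]mxE [X in _ = _ + X]mxE -!rowcoordE.
Qed.

End RowCoordinates.

(** Row [i] of [corow] is the relation [fpow (k + i) - (its remainder)] in the
    basis of factorial powers. These relations are the multiples of the monic
    polynomial [chi] of degree [k], hence are stable under multiplication by the
    variable. *)
Section ComplementaryRows.
Variables (B : comPzRingType) (k m : nat) (rc : nat -> nat -> B) (y h : nat -> B) (q : B).
Local Notation n := (k + m)%N.
Hypothesis k_gt0 : (0 < k)%N.
Hypothesis m_gt0 : (0 < m)%N.
Hypothesis rcS : forall r j, (j < k)%N -> rc r.+1 j + y r.+1 * rc r j =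
  rc r j.-1 *+ (0 < j)%N + y j.+1 * rc r j + rc k j * rc r k.-1.
Hypothesis rc_last : forall p, rc (k.-1 + p) k.-1 = h p.
Hypothesis rc_n : forall j, (j < k)%N -> rc n j = ((-1) ^+ (k - 1) * q) *+ (j == 0%N).

Definition corow i j : B := if (j < k)%N then - rc (k + i) j else (j == k + i)%N%:R.

(** Multiplying relation [i] by the variable gives relation [i + 1] plus
    [y_(k+i+1)] times relation [i], and the leading coordinate [h (i + 1)] of the
    remainder produces the multiple of relation [0]; the statement compares the
    coefficients of index [j]. The wrap at [j = 0] comes from [fpow n]. *)
Lemma corow_rec i j : (i < m)%N -> (j < n)%N ->
  (if j == 0%N then (-1) ^+ (k - 1) * q * corow i n.-1 else corow i j.-1)
      + y j.+1 * corow i j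
    = corow i.+1 j *+ (i.+1 < m)%N + y (k + i).+1 * corow i j - h i.+1 * corow 0 j.
Proof.
move=> lt_im lt_jn; have [lt_jk | le_kj] := ltnP j k.
  have := rcS (k + i) lt_jk; have -> : rc (k + i) k.-1 = h i.+1.
    by rewrite -rc_last; congr (rc _ _); lia.
  rewrite /corow !addn0 lt_jk addnS => rec.
  have n1k : (n.-1 < k)%N = false by lia.
  rewrite n1k; have -> : (n.-1 == k + i)%N = (i.+1 == m) by apply/eqP/eqP; lia.
  have [j0 | j_gt0] := posnP j.
    rewrite j0 /= in rec *; have [im | im] := eqVneq i.+1 m.
      have := rc_n k_gt0; rewrite -im addnS => rc_n0; rewrite rc_n0 eqxx in rec.
      rewrite ltnn mulr0n mulr1.
      rewrite mulr0n add0r mulr1n in rec.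
      have -> : (-1) ^+ (k - 1) * q = y 1%N * rc (k + i) 0%N + rc k 0%N * h i.+1
          - y (k + i).+1 * rc (k + i) 0%N by rewrite -rec addrK.
      by ring.
    have -> : (i.+1 < m)%N by rewrite ltn_neqAle im.
    rewrite mulr0 add0r mulr1n; rewrite mulr0n add0r in rec.
    have -> : rc (k + i).+1 0%N = y 1%N * rc (k + i) 0%N + rc k 0%N * h i.+1
        - y (k + i).+1 * rc (k + i) 0%N by rewrite -rec addrK.
    by ring.
  have j1k : (j.-1 < k)%N by lia.
  rewrite j1k. rewrite j_gt0 mulr1n in rec.
  have -> : rc (k + i) j.-1 = rc (k + i).+1 j + y (k + i).+1 * rc (k + i) j
      - y j.+1 * rc (k + i) j - rc k j * h i.+1 by rewrite rec; ring.
  have [im | im] := eqVneq i.+1 m.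
    have := rc_n lt_jk; rewrite -im addnS (gtn_eqF j_gt0) mulr0n => ->.
    by rewrite ltnn mulr0n; ring.
  have -> : (i.+1 < m)%N by rewrite ltn_neqAle im.
  by rewrite mulr1n; ring.
have j_gt0 : (0 < j)%N by lia.
rewrite (gtn_eqF j_gt0) /corow addn0.
have -> : (j < k)%N = false by lia.
have [-> | j_neq] := eqVneq j k.
  rewrite prednK // leqnn /= -rc_last.
  have -> : (k == k + i.+1)%N = false by lia.
  have -> : (k.-1 + i.+1)%N = (k + i)%N by lia.
  have [-> | i0] := eqVneq i 0%N; first by rewrite addn0 eqxx /= mulr0n mul0rn; ring.
  have -> : (k == k + i)%N = false by lia.
  by rewrite /= !mulr0n mul0rn; ring.
have -> : (j.-1 < k)%N = false by lia.
have -> : (j.-1 == k + i)%N = (j == k + i.+1)%N by lia.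
have -> : ((j == k + i.+1)%N%:R *+ (i.+1 < m)%N : B) = (j == k + i.+1)%N%:R.
  by case: eqP => [jE|_]; rewrite ?mul0rn //; have -> : (i.+1 < m)%N by lia.
have [->|_] := eqVneq j (k + i)%N; by rewrite /= !mulr0n; ring.
Qed.

(** Reversing both indices and changing signs by parity gives multiplication by
    the variable the shape of [fcomp], for the parameters [- y_n, ..., - y_1]. *)
Definition dualrow j b : B := (-1) ^+ (j + b) * corow (m.-1 - b) (n.-1 - j).

Lemma dualrow_rec j b : (j < n)%N -> (b < m)%N ->
  dualrow j b.-1 *+ (0 < b)%N + (- y (n - b)%N) * dualrow j b
      - ((-1) ^+ (m - b) * h (m - b)%N) * dualrow j m.-1
    = (if j.+1 == n then (-1) ^+ (m - 1) * q * dualrow 0 b else dualrow j.+1 b)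
      + (- y (n - j)%N) * dualrow j b.
Proof.
move=> lt_jn lt_bm; pose i := (m.-1 - b)%N; pose l := (n.-1 - j)%N.
have := @corow_rec i l ltac:(rewrite /i; lia) ltac:(rewrite /l; lia).
have -> : (n - b = (k + i).+1)%N by rewrite /i; lia.
have -> : (n - j = l.+1)%N by rewrite /l; lia.
have -> : (m - b = i.+1)%N by rewrite /i; lia.
rewrite /dualrow -/i -/l subnn.
have lE : (l == 0%N) = (j.+1 == n) by rewrite /l; lia.
have bE : (0 < b)%N = (i.+1 < m)%N by rewrite /i; lia.
have lE1 : (n.-1 - j.+1 = l.-1)%N by rewrite /l; lia.
rewrite lE bE lE1 => rec.
have -> : (-1) ^+ (j + b.-1) * corow (m.-1 - b.-1) l *+ (i.+1 < m)%N
    = - ((-1) ^+ (j + b)) * (corow i.+1 l *+ (i.+1 < m)%N) :> B.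
  case: ltnP => im; last by rewrite !mulr0n mulr0.
  rewrite !mulr1n; have -> : (m.-1 - b.-1 = i.+1)%N by move: im; rewrite /i; lia.
  have -> : (j + b = (j + b.-1).+1)%N by move: im; rewrite /i; lia.
  by rewrite exprS mulN1r opprK.
have sgn_h : (-1) ^+ i.+1 * h i.+1 * ((-1) ^+ (j + m.-1) * corow 0 l)
    = - ((-1) ^+ (j + b)) * (h i.+1 * corow 0 l).
  rewrite mulrACA -exprD -[X in X * _ = _]signr_odd.
  have -> : (i.+1 + (j + m.-1) = (j + b + i.*2).+1)%N by rewrite /i; clear - lt_bm; lia.
  by rewrite oddS oddD odd_double addbF signrN signr_odd.
have -> : (if j.+1 == n then (-1) ^+ (m - 1) * q * ((-1) ^+ (0 + b) * corow i (n.-1 - 0))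
      else (-1) ^+ (j.+1 + b) * corow i l.-1)
    = - ((-1) ^+ (j + b)) * (if j.+1 == n then (-1) ^+ (k - 1) * q * corow i n.-1
        else corow i l.-1) :> B.
  case: eqP => [jn | _]; last by rewrite addSn exprS mulN1r.
  rewrite subn0 add0n -!mulrA [q * _]mulrCA !mulrA; congr (_ * _ * _).
  rewrite mulNr -!exprD -[LHS]signr_odd -[(-1) ^+ (j + b + _)]signr_odd -signrN; congr (_ ^+ _).
  have -> : (j + b + (k - 1) = (m - 1 + b + (k - 1).*2).+1)%N
    by clear - jn k_gt0 m_gt0; lia.
  by rewrite oddS [odd (_ + _.*2)]oddD odd_double addbF negbK.
rewrite sgn_h; move: rec => /(canRL (addrK _)) ->.
move: (_ *+ _) (h _ * _) (corow i l) (y _) (y _) ((-1) ^+ (j + b)) => c1 c2 c3 y1 y2 s.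
by ring.
Qed.

End ComplementaryRows.

Section ConjugatePermutation.
Variable n : nat.
Implicit Type w : 'S_n.

Definition rev_perm : 'S_n := perm (@rev_ord_inj n).

(** On the subsets given by the first [d] values of Grassmannian permutations,
    this is complementation followed by the reversal of [{1, ..., n}], which
    conjugates the partition. *)
Definition conj_perm w : 'S_n := (rev_perm * w * rev_perm)%g.

Lemma conj_permE w i : conj_perm w i = rev_ord (w (rev_ord i)).
Proof. by rewrite !permM !permE. Qed.

Lemma conj_permK : involutive conj_perm.
Proof. by move=> w; apply/permP => i; rewrite !conj_permE !rev_ordK. Qed.

Lemma odd_conj_perm w : odd_perm (conj_perm w) = odd_perm w.
Proof. by rewrite !odd_permM addbAC addbb. Qed.

Lemma conj_perm_grass d w : (d <= n)%N -> w \in grassmannian n d ->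
  conj_perm w \in grassmannian n (n - d).
Proof.
move=> le_dn /grassP w_incr; apply/grassP => i j ij jd; rewrite !conj_permE /=.
have := w_incr (rev_ord j) (rev_ord i); rewrite /=.
have := ltn_ord (w (rev_ord j)); have := ltn_ord (w (rev_ord i)).
by have := ltn_ord i; have := ltn_ord j; lia.
Qed.

End ConjugatePermutation.

Lemma sum_ord_range n m d : (m <= d <= n)%N ->
  (\sum_(i < n | (m <= i)%N) (i < d) = d - m)%N.
Proof.
case/andP=> le_md le_dn; apply/eqP; rewrite -(eqn_add2l m) subnKC //; apply/eqP.
rewrite -[RHS](sum_ord_lt (P := fun i : 'I_n => (i < d)%N)) //.
rewrite [RHS](bigID (fun i : 'I_n => (i < m)%N)) /=; congr (_ + _)%N; last first.
  by apply: eq_bigl => i; rewrite -leqNgt.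
rewrite -[LHS](sum_ord_lt (P := fun i : 'I_n => (i < m)%N)) ?(leq_trans le_md) //.
rewrite [RHS]big_mkcond; apply: eq_bigr => i _; case: ltnP => // im.
by rewrite (leq_trans im).
Qed.

(** Part [j] of the conjugate counts the [i] with [w i - i > j]. As [w i - i] is
    the number of values beyond position [m] that are smaller than [w i], this
    says that the [j]-th of these values is smaller than [w i]. *)
Lemma conj_part_perm n m (w : 'S_n) : (m <= n)%N -> w \in grassmannian n m ->
  conj_part (n - m) (perm_part m w) = perm_part (n - m) (conj_perm w).
Proof.
move=> le_mn; suff conj_add k (v : 'S_(k + m)) : v \in grassmannian (k + m) m ->
    conj_part k (perm_part m v) = perm_part k (conj_perm v).
  by move: w; have := conj_add (n - m)%N; rewrite subnK //; apply.
move=> {n w le_mn} grass_w; move: v grass_w => w grass_w.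
have le_mn : (m <= k + m)%N := leq_addl k m.
have le_kn : (k <= k + m)%N := leq_addr m k.
apply: (@eq_from_nth _ 0%N) => [|j]; first by rewrite size_mkseq size_perm_part.
rewrite size_mkseq => lt_jk; rewrite nth_mkseq //.
have lt_i : (k - j.+1 < k)%N by lia.
have := nth_perm_part le_kn (conj_perm w) (Ordinal lt_i).
rewrite /= (_ : k - (k - j.+1).+1 = j)%N; last by lia.
move=> ->; rewrite conj_permE /=.
have lt_mj : (m + j < k + m)%N by lia.
pose l := Ordinal lt_mj.
have -> : rev_ord (widen_ord le_kn (Ordinal lt_i)) = l by apply: val_inj => /=; lia.
have := inversions_col le_mn grass_w (l := l) (leq_addr _ _); rewrite /= addKn => col.
have le_wl := ltn_ord (w l).
transitivity (\sum_(i < k + m | (i < m)%N) (w l < w i))%N; last first.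
  pose A := (\sum_(i < k + m | (i < m)%N) (w l < w i))%N.
  pose b := (\sum_(i < k + m | (i < m)%N) (w i < w l))%N.
  have total : (A + b = m)%N.
    rewrite -big_split /= -[RHS](sum_ord_lt (n := k + m) (P := fun i => (i < m)%N)) //.
    rewrite big_mkcond; apply: eq_bigr => i _; case: ltnP => // im.
    have [//|//|/val_inj/perm_inj il] := ltngtP (w i) (w l).
    by rewrite il /= ltnNge leq_addr in im.
  have {}col : (b + j = w l)%N := col.
  change (A = (k + m - (w l).+1 - (k - j.+1))%N).
  by move: A b total col => A b; lia.
rewrite /perm_part count_map count_rev -sum1_count big_mkcond.
rewrite (_ : iota 1 m = index_iota 1 m.+1); last by rewrite /index_iota subn1.
rewrite big_add1 big_mkord.
rewrite (big_ord_widen _ (fun i => if (preim (fun l => oneline w l - l)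
  (fun b => j < b) i.+1)%N then 1%N else 0%N) le_mn).
apply: eq_bigr => i im; rewrite -[preim _ _ _]/(j < oneline w i.+1 - i.+1)%N.
rewrite oneline_ord subSS.
suff -> : (j < w i - i)%N = (w l < w i)%N by case: ltnP.
have row := inversions_row grass_w im.
have low d : (d <= k)%N -> (\sum_(i' < k + m | (m <= i')%N) (i' < m + d) = d)%N.
  by move=> le_d; rewrite sum_ord_range ?addKn ?leq_addr // addnC leq_add2r.
case: (ltnP (w l) (w i)) => [lt_wl | le_wi].
  rewrite -row addnK -[X in (X <= _)%N](low j.+1) //; apply: leq_sum => i' mi'.
  case: ltnP => // lt_i'; rewrite (leq_ltn_trans _ lt_wl) //.
  have [-> // | neq] := eqVneq i' l; rewrite ltnW // (grass_mono grass_w) ?(leq_addr) //.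
    by rewrite ltn_neqAle neq /= -ltnS -addnS.
  by rewrite !ltnNge mi' leq_addr.
apply/negbTE; rewrite -leqNgt -row addnK -[X in (_ <= X)%N](low j) ?(ltnW lt_jk) //.
apply: leq_sum => i' mi'; case: ltnP => // lt_wi'.
rewrite -(grass_mono grass_w (j := l)) ?(leq_trans lt_wi') //.
by rewrite !ltnNge mi' leq_addr.
Qed.

(** * Level-rank duality *)

Lemma det_scale (B : comPzRingType) m (s t : 'I_m -> B) (M : 'M[B]_m) :
  \det (\matrix_(i, j) (s i * t j * M i j)) = (\prod_i s i) * (\prod_j t j) * \det M.
Proof.
have -> : \matrix_(i, j) (s i * t j * M i j)
    = diag_mx (\row_i s i) *m M *m diag_mx (\row_j t j).
  by apply/matrixP => i j; rewrite mul_mx_diag mul_diag_mx !mxE mulrAC.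
rewrite !det_mulmx !det_diag mulrAC.
by congr (_ * _ * _); apply: eq_bigr => i _; rewrite mxE.
Qed.

Lemma perm_part_leq n k (w : 'S_n) i : (k <= n)%N -> w \in grassmannian n k ->
  (nth 0%N (perm_part k w) i <= n - k)%N.
Proof.
move=> le_kn grass_w; have [lt_ik | le_ki] := ltnP i k; last first.
  by rewrite nth_default // size_perm_part.
have lt_jk : (k - i.+1 < k)%N by lia.
have := nth_perm_part le_kn w (Ordinal lt_jk).
rewrite /= (_ : k - (k - i.+1).+1 = i)%N => [->|]; last by lia.
have := inversions_row grass_w (l := widen_ord le_kn (Ordinal lt_jk)) lt_jk.
move=> /= inv; rewrite -[X in (X - _ <= _)%N]inv addnK.
rewrite -[X in (_ <= X)%N](sum_ord_range (n := n) (m := k) (d := n)) ?leqnn ?andbT //.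
by apply: leq_sum => j _; rewrite ltn_ord; case: ltnP.
Qed.

Lemma rmorph_comb (A B : pzRingType) (f : {rmorphism A -> B}) x d s y t z x' s' y' t' z' :
    f x = x' -> f s = s' -> f y = y' -> f t = t' -> f z = z' ->
  f (x *+ d + s * y - t * z) = x' *+ d + s' * y' - t' * z'.
Proof. by move=> <- <- <- <- <-; rewrite rmorphB rmorphD rmorphMn !rmorphM. Qed.

Section Duality.
Variables k m : nat.
Local Notation n := (k + m)%N.
Hypothesis k_gt0 : (0 < k)%N.
Hypothesis m_gt0 : (0 < m)%N.
Local Notation S := (sympoly n k).
Local Notation Rx := {mpoly (Rq n)[k]}.
Local Notation a := (fun l => yS n k l.+1).
Variable c : nat -> S.
Hypothesis charE :
  map_poly val (fcharp a c k) = \prod_(j < k) ('X - ('X_j : Rx)%:P).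

Let lt_kn : (k < n)%N. Proof. by rewrite -[X in (X < _)%N]addn0 ltn_add2l. Qed.
Let le_mn : (m <= n)%N. Proof. exact: leq_addl. Qed.
Local Notation f := (@qclass n k).
Local Notation phi := (@qclass n k \o @sympolyC n k).
Local Notation rho := (rowcoord a c k).

(** The parameters and the coefficients, in the factorial basis, of the
    complementary factor of [(t|y)^n + (-1)^k q] at [- t], made monic. *)
Definition dual_shift l : S := - yS n k (n - l).
Definition dual_coef j : S := (-1) ^+ (m - j) * sympoly_schur n k [:: (m - j)%N].

Definition dual_row j : 'rV[S]_m := \row_b dualrow k m rho j b.
Local Notation g := (fun j => map_mx f (dual_row j)).
Local Notation phi' := (phi \o @twist n).

Lemma rowcoord_last p : rho (k.-1 + p) k.-1 = sympoly_schur n k [:: p].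
Proof.
have lt_k : (k.-1 < k)%N by rewrite prednK.
rewrite (schur_row k_gt0 charE) -[X in rowcoord _ _ _ _ X]/(nat_of_ord (Ordinal lt_k)).
by rewrite rowcoordE; congr (frow _ _ _ _ 0 _); apply: val_inj.
Qed.

Lemma rowcoord_n j : (j < k)%N ->
  f (rho n j) = ((-1) ^+ (k - 1) * phi lq) *+ (j == 0%N).
Proof.
move=> lt_jk; rewrite -[j]/(nat_of_ord (Ordinal lt_jk)) rowcoordE.
have /rowP/(_ (Ordinal lt_jk)) := frow_n k_gt0 charE lt_kn.
rewrite !mxE => ->; rewrite rmorphM rmorphXn rmorphN1.
by case: eqP => _; rewrite ?rmorph1 ?rmorph0 ?mulr1 ?mulr0.
Qed.

Lemma map_dualrow j b : f (dualrow k m rho j b) = dualrow k m (fun r i => f (rho r i)) j b.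
Proof.
rewrite /dualrow /corow rmorphM rmorphXn rmorphN1; congr (_ * _).
by case: ifP => _; rewrite ?rmorphN ?rmorph_nat.
Qed.

Lemma dual_rowT j : (j < n)%N ->
  map_mx f (dual_row j *m fcomp dual_shift dual_coef m)
    = wrap_row phi' g m j.+1 + f (dual_shift j) *: g j.
Proof.
move=> lt_jn; apply/rowP => b; rewrite mxE (mulfcomp_nat _ _ m_gt0).
have rec := @dualrow_rec _ k m (fun r i => f (rho r i)) (fun j => f (yS n k j))
  (fun p => schubert n k [:: p]) (phi lq) k_gt0 m_gt0.
have {}rec : dualrow k m (fun r i => f (rho r i)) j b.-1 *+ (0 < b)%N
      + (- f (yS n k (n - b))) * dualrow k m (fun r i => f (rho r i)) j b
      - ((-1) ^+ (m - b) * schubert n k [:: (m - b)%N])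
        * dualrow k m (fun r i => f (rho r i)) j m.-1
    = (if j.+1 == n then (-1) ^+ (m - 1) * phi lq * dualrow k m (fun r i => f (rho r i)) 0 b
       else dualrow k m (fun r i => f (rho r i)) j.+1 b)
      + (- f (yS n k (n - j))) * dualrow k m (fun r i => f (rho r i)) j b.
  apply: rec => // [r i lt_ik | p | i lt_ik].
  - rewrite -!rmorphM -rmorphD (rowcoordS _ _ k_gt0 _ lt_ik).
    by rewrite !rmorphD rmorphMn.
  - by rewrite rowcoord_last.
  - exact: rowcoord_n.
have shiftE l : f (dual_shift l) = - f (yS n k (n - l)) by apply: rmorphN.
have coefE l : f (dual_coef l) = (-1) ^+ (m - l) * schubert n k [:: (m - l)%N].
  by apply: etrans (rmorphM _ _ _) _; rewrite rmorphXn rmorphN1.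
apply: etrans (rmorph_comb _ (map_dualrow _ _) (shiftE b) (map_dualrow _ _)
  (coefE b) (map_dualrow _ _)) _.
apply: etrans rec _; rewrite [RHS]mxE [X in _ = _ + X]mxE [g j _ _]mxE [dual_row j _ _]mxE.
rewrite shiftE map_dualrow; congr (_ + _).
rewrite /wrap_row; case: eqP => _; last by rewrite !mxE map_dualrow.
rewrite [RHS]mxE [map_mx _ _ _ _]mxE [dual_row 0 _ _]mxE map_dualrow; congr (_ * _).
by rewrite rmorphM rmorphXn rmorphN1 /= twist_q.
Qed.

Lemma dual_pieri (w : 'S_n) p : (1 <= p <= m)%N ->
  extdet phi' g [::] (\sum_(I : {set 'I_m} | #|I| == p) pieri_term w I)
    = schubert n k [:: p] * \det (\matrix_i g (w (widen_ord le_mn i))).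
Proof.
move=> p_bd; have /andP[_ le_pm] := p_bd.
rewrite (extdet_pieri (a := dual_shift) (c := dual_coef)
  (T := fcomp dual_shift dual_coef m) le_mn) //.
- congr (_ * _); rewrite /dual_coef subKn // mulrA -exprD addnn -signr_odd odd_double.
  by rewrite mul1r.
- by move=> l; rewrite /= twist_y rmorphN rmorphN.
- exact: dual_rowT.
- exact: char_poly_fcomp.
Qed.

(** The rows [dual_row] are, up to signs and reversal, the columns of the matrix
    of relations, so this is the identity of complementary minors; the signs
    add up to the sign of [w] by [grass_sign]. *)
Lemma dual_det (w : 'S_n) : w \in grassmannian n m ->
  \det (\matrix_(b < m) g (w (widen_ord le_mn b)))
    = schubert n k (perm_part k (conj_perm w)).
Proof.
move=> grass_w; set w' := conj_perm w.
have grass_w' : w' \in grassmannian n k.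
  by have := conj_perm_grass le_mn grass_w; rewrite addnK.
pose N : 'M[qH n k]_(k + m, k) := \matrix_(r, j) f (rho r j).
have N1 : usubmx N = 1%:M.
  apply/matrixP => i j; rewrite !mxE rowcoordE frow_lt ?mxE ?rmorph_nat //=.
  by rewrite val_eqE eq_sym.
rewrite (schubert_perm_part lt_kn charE grass_w').
have := complementary_minors w' N1.
have -> : \matrix_(i, j) N (w' (lshift m i)) j
    = \matrix_(i < k) map_mx f (frow a c k (w' (widen_ord (ltnW lt_kn) i))).
  apply/matrixP => i j; rewrite !mxE rowcoordE; congr (f (frow _ _ _ (w' _) 0 j)).
  exact: val_inj.
move=> minors; apply: (can_inj (signrMK w')); rewrite minors.
pose M : 'M[qH n k]_m := \matrix_(i, b)
  (row_mx (- dsubmx N) 1%:M : 'M_(m, k + m)) i (w' (rshift k b)).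
rewrite -[RHS]/(\det M) -[\det M]det_tr -[\det M^T]det_rev.
have GE (i : 'I_m) (r : 'I_(k + m)) : (row_mx (- dsubmx N) 1%:M : 'M_(m, k + m)) i r
    = corow k (fun r i => f (rho r i)) i r.
  rewrite /corow; case: (split_ordP r) => l ->.
    by rewrite row_mxEl !mxE.
  by rewrite row_mxEr mxE eqn_add2l eq_sym.
pose MT := \matrix_(r, s) M^T (rev_ord r) (rev_ord s).
have -> : \matrix_(b < m) g (w (widen_ord le_mn b))
    = \matrix_(b, i) ((-1) ^+ w (widen_ord le_mn b) * (-1) ^+ i * MT b i).
  apply/matrixP => b i; rewrite [RHS]mxE [MT _ _]mxE [M^T _ _]mxE [M _ _]mxE GE.
  rewrite 2![LHS]mxE [dual_row _ _ _]mxE map_dualrow /dualrow exprD; congr (_ * corow _ _ _ _).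
    by rewrite /=; lia.
  rewrite /w' conj_permE /= -subn1 -subnDA add1n; congr (_ - (nat_of_ord (w _)).+1)%N.
  by apply: val_inj => /=; have := ltn_ord b; lia.
rewrite (det_scale (fun b => (-1) ^+ w (widen_ord le_mn b)) (fun i : 'I_m => (-1) ^+ i) MT).
rewrite -big_split /= -[RHS]mul1r mulrA; congr (_ * _).
under eq_bigr do rewrite -exprD.
rewrite -expr_sum -[X in _ * X]signr_odd.
have <- := big_ord_narrow (F := fun i : 'I_n => (w i + i)%N) le_mn.
by rewrite -(grass_sign grass_w) /w' odd_conj_perm -signr_addb addbb.
Qed.

Lemma to_qH_Theta u : to_qH k (Theta k u) = extdet phi' g [::] u.
Proof.
rewrite (to_qH_extdet lt_kn charE) /Theta extdet_sum (extdet_grass _ _ le_mn).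
rewrite addKn; apply: eq_bigr => w grass_w.
have := conj_part_perm le_mn grass_w; rewrite addnK => conjE.
rewrite extdetZ dual_det // conjE; congr (_ * _).
rewrite -(to_qH_extdet lt_kn charE) (to_qH_ket k_gt0 lt_kn charE) // => i.
apply: perm_part_leq; first exact: leq_addr.
by have := conj_perm_grass le_mn grass_w; rewrite addnK.
Qed.

End Duality.

(** * The theorem *)

(** [to_qH] is injective in degree [k], so a preimage of the product that is
    exhibited explicitly is the chosen one. *)
Lemma star_eq n k (x u v : ext n) : (0 < k)%N -> (k < n)%N ->
    ext_deg k x -> to_qH k x = to_qH k u * to_qH k v ->
  star k u v = x.
Proof.
case: n x u v => // n' x u v k_gt0 lt_kn deg_x xE.
have [deg_s sE] : ext_deg k (star k u v) /\ to_qH k (star k u v) = to_qH k u * to_qH k v.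
  exact: (ClassicalEpsilon.epsilon_spec (inhabits 0)
    (fun y => ext_deg k y /\ to_qH k y = to_qH k u * to_qH k v) (ex_intro _ x (conj deg_x xE))).
have [c charE] := rootpoly_fcharp n'.+1 k.
apply/eqP; rewrite -subr_eq0; apply/eqP; apply: (to_qH_eq0 k_gt0 lt_kn).
  by apply: ext_degD => //; rewrite -scaleN1r; apply: ext_degZ.
rewrite !(to_qH_extdet lt_kn charE) -scaleN1r extdetD extdetZ rmorphN1 mulN1r.
by rewrite -!(to_qH_extdet lt_kn charE) sE xE subrr.
Qed.

Lemma ket_perm_part n k (w : 'S_n) : (k <= n)%N -> w \in grassmannian n k ->
  ket n k (perm_part k w) = pieri_term w (set0 : {set 'I_k}).
Proof.
move=> le_kn grass_w; rewrite /ket /pieri_term (iotaDl 1 0) -val_enum_ord -map_comp foldr_map.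
elim: (enum _) => //= i s ->; rewrite inE; congr (psi _ _ _).
have := nth_perm_partD le_kn grass_w i; rewrite /= add1n addnS => ->.
by rewrite -(oneline_ord w (widen_ord le_kn i)).
Qed.

Lemma lpos_sum n (I : Type) (r : seq I) (P : pred I) (F : I -> Rq n) :
  (forall i, P i -> lpos (F i)) -> lpos (\sum_(i <- r | P i) F i).
Proof. by move=> posF; elim/big_ind: _ => //; [exact: lpos0 | exact: lposD]. Qed.

Section ColumnCase.
Variables n k : nat.
Hypothesis k_gt0 : (0 < k)%N.
Hypothesis lt_kn : (k < n)%N.
Variables (p : nat) (w : 'S_n).

Lemma star_column : (1 <= p <= k)%N -> w \in grassmannian n k ->
  star k (ket n k (nseq p 1%N)) (ket n k (perm_part k w))
    = \sum_(I : {set 'I_k} | #|I| == p) pieri_term w I.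
Proof.
move=> p_bd grass_w; have [c charE] := rootpoly_fcharp n k.
apply: star_eq => //; first by apply: ext_deg_sum => I _; apply: ext_deg_pieri_term.
rewrite (to_qH_pieri k_gt0 lt_kn charE p_bd grass_w).
congr (_ * _); rewrite (to_qH_ket k_gt0 lt_kn charE) // => i.
  by rewrite nth_nseq; case: ifP => // _; rewrite subn_gt0.
exact: perm_part_leq (ltnW lt_kn) grass_w.
Qed.

Lemma lpos_column : (1 <= p <= k)%N -> w \in grassmannian n k ->
  forall S, lpos (star k (ket n k (nseq p 1%N)) (ket n k (perm_part k w)) S).
Proof.
move=> p_bd grass_w S; rewrite star_column // sum_ffunE; apply: lpos_sum => I _.
exact: lpos_pieri_term lt_kn grass_w I S.
Qed.

End ColumnCase.

Section RowCase.
Variables (n k p : nat) (w : 'S_n).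
Hypothesis k_gt0 : (0 < k)%N.
Hypothesis lt_kn : (k < n)%N.
Hypothesis p_bd : (1 <= p <= n - k)%N.
Hypothesis grass_w : w \in grassmannian n k.

Let m_gt0 : (0 < n - k)%N. Proof. by rewrite subn_gt0. Qed.
Let lt_mn : (n - k < n)%N. Proof. by rewrite ltn_subrL k_gt0 (leq_trans _ lt_kn). Qed.
Let grass_w' : conj_perm w \in grassmannian n (n - k).
Proof. exact: conj_perm_grass (ltnW lt_kn) grass_w. Qed.

Lemma ext_deg_Theta (u : ext n) : ext_deg k (Theta k u).
Proof. by apply: ext_deg_sum => v _; apply/ext_degZ/ext_deg_ket. Qed.

Lemma to_qH_Theta_pieri :
  to_qH k (Theta k (\sum_(I : {set 'I_(n - k)} | #|I| == p) pieri_term (conj_perm w) I))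
    = schubert n k [:: p] * schubert n k (perm_part k w).
Proof.
suff key m (v : 'S_(k + m)) : (1 <= p <= m)%N -> v \in grassmannian (k + m) m ->
    to_qH k (Theta k (\sum_(I : {set 'I_m} | #|I| == p) pieri_term v I))
      = schubert (k + m) k [:: p] * schubert (k + m) k (perm_part k (conj_perm v)).
  have := key (n - k)%N; rewrite subnKC ?(ltnW lt_kn) // => /(_ (conj_perm w) p_bd grass_w').
  by rewrite conj_permK.
move=> p_bd' grass_v; have [c charE] := rootpoly_fcharp (k + m) k.
have m_gt0' : (0 < m)%N by case/andP: p_bd' => p_gt0 /(leq_trans p_gt0).
rewrite (to_qH_Theta k_gt0 m_gt0' charE) (dual_pieri k_gt0 m_gt0' charE) //.
by rewrite (dual_det k_gt0 m_gt0' charE).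
Qed.

Lemma star_row : star k (ket n k [:: p]) (ket n k (perm_part k w))
  = Theta k (star (n - k) (ket n (n - k) (nseq p 1%N))
                  (ket n (n - k) (conj_part (n - k) (perm_part k w)))).
Proof.
rewrite (conj_part_perm (ltnW lt_kn) grass_w) (star_column m_gt0 lt_mn p_bd grass_w').
have [c charE] := rootpoly_fcharp n k.
apply: star_eq => //; first exact: ext_deg_Theta.
rewrite to_qH_Theta_pieri; congr (_ * _); rewrite (to_qH_ket k_gt0 lt_kn charE) // => i.
  by case: i => [|i] /=; [case/andP: p_bd | rewrite nth_nil].
exact: perm_part_leq (ltnW lt_kn) grass_w.
Qed.

Lemma lpos_row S : lpos (star k (ket n k [:: p]) (ket n k (perm_part k w)) S).
Proof.
rewrite star_row (conj_part_perm (ltnW lt_kn) grass_w) /Theta sum_ffunE.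
apply: lpos_sum => v grass_v; rewrite ffunE; apply: lposM.
  exact/lpos_twist/(lpos_column m_gt0 lt_mn p_bd grass_w').
have := conj_part_perm (ltnW lt_mn) grass_v; rewrite subKn ?(ltnW lt_kn) // => ->.
have grass_v' := conj_perm_grass (ltnW lt_mn) grass_v.
rewrite subKn ?(ltnW lt_kn) // in grass_v'.
rewrite (ket_perm_part (ltnW lt_kn) grass_v').
exact: lpos_pieri_term lt_kn grass_v' _ S.
Qed.

End RowCase.

Theorem corollary4p6 (n k : nat) (hn : (2 <= n)%N) (hk : (1 <= k <= n - 1)%N) :
  (forall (p : nat) (w : 'S_n), (1 <= p <= k)%N -> w \in grassmannian n k ->
     [/\ star k (ket n k (nseq p 1%N)) (ket n k (perm_part k w))
           = \sum_(I : {set 'I_k} | #|I| == p) pieri_term w I,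
         forall (I : {set 'I_k}) (i : 'I_k), #|I| = p -> i \in I ->
           (t_index I i <= oneline w i.+1)%N /\
           tpsi k (t_index I i) (oneline w i.+1)
             = (fun u : ext n => psi k (oneline w i.+1).+1 u
                 + lconst (yvar n (oneline w i.+1) - yvar n (t_index I i))
                   *: psi k (oneline w i.+1) u)
       & forall (v : 'S_n) (d : int), v \in grassmannian n k ->
           graham_positive (struct_const k (nseq p 1%N) (perm_part k w) v d)]) /\
  (forall (p : nat) (w : 'S_n), (1 <= p <= n - k)%N -> w \in grassmannian n k ->
     star k (ket n k [:: p]) (ket n k (perm_part k w))
       = Theta k (star (n - k) (ket n (n - k) (nseq p 1%N))
                       (ket n (n - k) (conj_part (n - k) (perm_part k w)))) /\
     forall (v : 'S_n) (d : int), v \in grassmannian n k ->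
       graham_positive (struct_const k [:: p] (perm_part k w) v d)).
Proof.
have /andP[k_gt0 le_kn1] := hk.
have lt_kn : (k < n)%N by rewrite -(subnK (ltnW hn)) addn1 ltnS.
split=> p w p_bd grass_w; split.
- exact: star_column.
- move=> I i _ iI; split=> //.
  rewrite (oneline_ord w (widen_ord (ltnW lt_kn) i)) /t_index addn1 ltnS.
  apply: leq_trans (t_index_leq iI) _.
  exact: (grass_ge grass_w (i := widen_ord (ltnW lt_kn) i) (ltn_ord i)).
- by move=> v d _; exact: (lpos_column k_gt0 lt_kn p_bd grass_w (perm_supp k v) d).
- exact: star_row.
- by move=> v d _; exact: (lpos_row k_gt0 lt_kn p_bd grass_w (perm_supp k v) d).
Qed.
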